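(* For all $\alpha\in(1,2)$ and all integers $k\ge3$ and $r\ge1$, $$\frac1N\#\{n\in[1,N]\cap\mathbb{Z} : (\lfloor (n+rj)^\alpha\rfloor)_{j=0}^{k-1}\in\mathcal{P}_{k,1}\}=\frac{1}{k-1}+O_{\alpha,k,r}(F(N))\quad(N\to\infty),$$ where $$F(x)=\begin{cases}x^{(1-\alpha)/2} & \alpha\in(1,5/4),\\ x^{(\alpha-3)/14}(\log x)^{1/2} & \alpha\in[5/4,11/6),\\ x^{(\alpha-2)/6}(\log x)^{1/2} & \alpha\in[11/6,2).\end{cases}$$
   Context: $\lfloor x\rfloor$ is the greatest integer $\le x$. $\mathcal{P}_{k,1}$ is the set of all strictly increasing arithmetic progressions $(a(n))_{n=0}^{k-1}$ of length $k$ in the positive integers. $O_{\alpha,k,r}(F(N))$ as $N\to\infty$ denotes a quantity bounded in absolute value by $C F(N)$ for all sufficiently large $N$, where $C>0$ depends only on $\alpha,k,r$. *)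

(* Defs.v *)
From HB Require Import structures.
From mathcomp Require Import all_boot all_order all_algebra.
From mathcomp Require Import all_classical all_reals all_analysis.
Set Implicit Arguments.
Unset Strict Implicit.
Unset Printing Implicit Defensive.
Import Order.TTheory GRing.Theory Num.Theory.
Import numFieldNormedType.Exports.
Local Open Scope classical_set_scope.
Local Open Scope ring_scope.

(* Strictly increasing arithmetic progressions of length k in the positive
   integers.  The ambient type is int, the codomain of Num.floor. *)
Definition arith_prog (k : nat) : set ('I_k -> int) :=
  [set a | exists b d : int,
     [/\ 0 < b, 0 < d & forall j : 'I_k, a j = b + d * (j : nat)%:Z]].
Arguments arith_prog : clear implicits.

Definition floor_powers (R : realType) (alpha : R) (k r n : nat) : 'I_k -> int :=
  fun j => Num.floor ((n + r * j)%:R `^ alpha).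

Definition count_progs (R : realType) (alpha : R) (k r N : nat) : nat :=
  count (fun n => floor_powers alpha r n \in arith_prog k) (index_iota 1 N.+1).

(* Only meaningful for 1 < alpha < 2. *)
Definition error_rate (R : realType) (alpha x : R) : R :=
  if alpha < 5 / 4 then x `^ ((1 - alpha) / 2)
  else if alpha < 11 / 6 then x `^ ((alpha - 3) / 14) * ln x `^ (1 / 2)
  else x `^ ((alpha - 2) / 6) * ln x `^ (1 / 2).

(* Main.v *)
Require Import Defs.
From mathcomp Require Import all_boot all_order all_algebra.
From mathcomp Require Import all_classical all_reals all_analysis.
From mathcomp Require Import ring lra zify.
From mathcomp.real_closed Require Import complex.
Import Order.TTheory GRing.Theory Num.Theory.
Import numFieldNormedType.Exports.
Local Open Scope classical_set_scope.
Local Open Scope ring_scope.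
Set Implicit Arguments.
Unset Strict Implicit.
Unset Printing Implicit Defensive.

(** Put K = k - 1, rho = r K, f(x) = x ^ alpha, and e(t) = exp(2 pi i t).

    Reduction to residues.  The points (n + r j, f(n + r j)), 0 <= j <= K, lie
    below the chord joining the two extreme ones, at distance O(n ^ (alpha - 2))
    since f'' has that size.  If the integer parts are in progression, then
    floor f(n) and floor f(n + rho) agree modulo K.  Conversely, if they agree
    modulo K, the progression through these two integers stays within [0, 1) of
    the chord, hence has the right integer parts at the intermediate points,
    unless the fractional part of f(n) or of f(n + rho) is below that small
    distance ([chord_deficit], [floor_arith_prog]).  So the quantity to count is
    the number of n for which x_n = f(n) / K and y_n = f(n + rho) / K, taken
    modulo 1, lie in the same interval [c / K, (c + 1) / K).  If the pairs
    (x_n, y_n) are equidistributed this has density K * (1 / K) ^ 2 = 1 / K.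
    Only boxes occur here, so no square root is lost in passing from boxes to
    triangles.

    Equidistribution.  Indicators of intervals are replaced by averages of
    translates of a Fejer kernel of degree H over a fine grid; the error is
    O(1 / (H d)) at distance d from an endpoint, and its average over n is again
    a count of points near the endpoints, which the kernel itself bounds.  This
    gives [same_cell_count]: the discrepancy is O(log H / H + (log H) ^ 2 B / N)
    if all sums of e(a x_n + b y_n) with 0 < max(|a|, |b|) < H are at most B.

    Exponential sums.  If a + b != 0 the phase (a f(x) + b f(x + rho)) / K has
    m-th derivative of exact order |a + b| x ^ (alpha - m), and if a + b = 0 it
    is a difference, with derivatives of order |a| x ^ (alpha - 1 - m)
    ([phase_bounds]).  Differencing a phase with shift s multiplies the order of
    its derivative by s / x; after enough differencing the derivative is below
    1/2 and the Kusmin-Landau inequality applies ([kusmin_landau],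
    [van_der_corput]).  With theta = 3 - alpha and H about N ^ (theta / 13), one
    differencing step suffices for alpha <= 8/5 and two for alpha > 8/5 (one step
    fewer when a + b = 0), giving
      B = O(N log N (N ^ (- theta / 13) + N ^ (1 - alpha))).

    Conclusion.  Together with the terms n < N ^ (6/7), which are discarded so
    that derivatives are under control from above, and the chord error, the
    relative error is O(N ^ (- theta / 14) + N ^ (- (2 - alpha) / 2)
    + N ^ (- (alpha - 1) / 2)): the powers of the logarithm are absorbed by the
    room between the exponents.  This is at most the stated rate on each of the
    three ranges of alpha ([raw_error_le]). *)

(** * The circle *)

Section Circle.
Variable R : realType.
Implicit Types (x y t : R) (z w : R[i]).

Definition cexp t : R[i] := Complex (cos (2 * pi * t)) (sin (2 * pi * t)).

Arguments cexp : simpl never.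

Definition cmod z : R := Normc.normc z.
Arguments cmod : simpl never.

Lemma cmod_ge0 z : 0 <= cmod z.
Proof. by case: z => a b; exact: sqrtr_ge0. Qed.

Lemma cmodD z w : cmod (z + w) <= cmod z + cmod w.
Proof. exact: le_normcD. Qed.

Lemma cmodN z : cmod (- z) = cmod z.
Proof. exact: normcN. Qed.

Lemma cmodB z w : cmod (z - w) <= cmod z + cmod w.
Proof. by rewrite -(cmodN w) cmodD. Qed.

Lemma cmodM z w : cmod (z * w) = cmod z * cmod w.
Proof. exact: Normc.normcM. Qed.

Lemma cmodV z : cmod z^-1 = (cmod z)^-1.
Proof. exact: Normc.normcV. Qed.

Lemma cmod0 : cmod (0 : R[i]) = 0.
Proof. exact: Normc.normc0. Qed.

Lemma cmod_real x : cmod x%:C%C = `|x|.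
Proof. by rewrite /cmod /= expr0n /= addr0 sqrtr_sqr. Qed.

Lemma cmod_conj z : cmod z^*%C = cmod z.
Proof. by case: z => a b; rewrite /cmod /= sqrrN. Qed.

Lemma cmod_nat (n : nat) : cmod (n%:R : R[i]) = n%:R.
Proof. by rewrite -(rmorph_nat (real_complex R)) cmod_real ger0_norm. Qed.

Lemma cmod_sqr z : ((cmod z) ^+ 2)%:C%C = z * z^*%C.
Proof. by rewrite -sqr_normc rmorphXn. Qed.

Lemma cmod_sum (I : Type) (r : seq I) (P : pred I) (F : I -> R[i]) :
  cmod (\sum_(i <- r | P i) F i) <= \sum_(i <- r | P i) cmod (F i).
Proof.
elim/big_ind2: _ => [|x1 y1 x2 y2 h1 h2|//]; first by rewrite cmod0.
by rewrite (le_trans (cmodD _ _)) ?lerD.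
Qed.

Lemma conjc_sum (I : Type) (r : seq I) (P : pred I) (F : I -> R[i]) :
  (\sum_(i <- r | P i) F i)^*%C = \sum_(i <- r | P i) (F i)^*%C.
Proof. exact: rmorph_sum. Qed.

Lemma conjcM z w : (z * w)^*%C = z^*%C * w^*%C.
Proof. exact: rmorphM. Qed.

Lemma cexp0 : cexp 0 = 1.
Proof. by rewrite /cexp mulr0 cos0 sin0. Qed.

Lemma cexpD x y : cexp (x + y) = cexp x * cexp y.
Proof.
rewrite /cexp mulrDr cosD sinD; apply/eqP; rewrite eq_complex /=.
by rewrite eqxx /= addrC mulrC [X in _ + X]mulrC addrC eqxx.
Qed.

Lemma cexpN x : cexp (- x) = (cexp x)^*%C.
Proof. by rewrite /cexp mulrN cosN sinN. Qed.

Lemma cmod_cexp x : cmod (cexp x) = 1.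
Proof. by rewrite /cmod /= cos2Dsin2 sqrtr1. Qed.

Lemma cexpB x y : cexp (x - y) = cexp x * (cexp y)^*%C.
Proof. by rewrite cexpD cexpN. Qed.

Lemma cexp1 : cexp 1 = 1.
Proof.
rewrite /cexp mulr1 mulr_natl mulr2n -[pi + pi]mulr2n cos2pi.
by rewrite sin_mulr2n sinpi mulr0 mul0rn.
Qed.

Lemma cexpMn x (n : nat) : cexp (x *+ n) = cexp x ^+ n.
Proof.
elim: n => [|n IH]; first by rewrite mulr0n expr0 cexp0.
by rewrite mulrS exprS cexpD IH.
Qed.

Lemma cexp_int (m : int) : cexp m%:~R = 1.
Proof.
case: m => n; first by rewrite -[_%:~R]/(1 *+ n) cexpMn cexp1 expr1n.
by rewrite NegzE mulrNz cexpN -[_%:~R]/(1 *+ n.+1) cexpMn cexp1 expr1n conjc1.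
Qed.

Lemma cexpDint x (m : int) : cexp (x + m%:~R) = cexp x.
Proof. by rewrite cexpD cexp_int mulr1. Qed.

Lemma sin_le_id x : 0 <= x -> sin x <= x.
Proof.
move=> x0.
have [|c _] := @MVT_segment R sin cos 0 x x0 (fun y _ => is_derive_sin y).
  by apply: continuous_subspaceT => y; exact: continuous_sin.
rewrite sin0 !subr0 => ->; rewrite -[leRHS]mul1r.
by rewrite ler_wpM2r// cos_le1.
Qed.

(** Writing sin x = 2 sin (x/2) cos (x/2) and bounding both factors with
    cos (x/2) >= cos (pi/4) avoids the concavity argument of the usual
    2x/pi bound. *)
Lemma sin_ge_half x : 0 <= x <= pi / 2 -> x / 2 <= sin x.
Proof.
move=> /andP[x0 xpi].
have pi0 : 0 < pi :> R by exact: pi_gt0.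
pose y := x / 2.
have y0 : 0 <= y by rewrite /y; lra.
have ypi : y <= pi / 4 by rewrite /y; lra.
have cosmono c : 0 <= c <= y -> cos y <= cos c.
  move=> /andP[c0 cy]; have [->//|ne] := eqVneq c y.
  by apply: ltW; rewrite ltr_cos ?in_itv/= ?lt_neqAle ?ne ?cy //; lra.
have cosy0 : 0 <= cos y by apply: cos_ge0_pihalf; lra.
have cos2 : 1 / 2 <= cos y ^+ 2.
  have /eqP := cos_mulr2n y; rewrite eq_sym subr_eq => /eqP.
  have : 0 <= cos (y *+ 2) by apply: cos_ge0_pihalf; rewrite -mulr_natl /y; lra.
  rewrite -mulr_natl; lra.
have siny : y * cos y <= sin y.
  have [|c] := @MVT_segment R sin cos 0 y y0 (fun y _ => is_derive_sin y).
    by apply: continuous_subspaceT => z; exact: continuous_sin.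
  rewrite in_itv /= sin0 !subr0 => /cosmono h ->; rewrite mulrC.
  by rewrite ler_wpM2r.
have -> : x = y *+ 2 by rewrite -mulr_natl /y; lra.
rewrite sin_mulr2n -[y *+ 2]mulr_natl -[cos y * _ *+ 2]mulr_natl.
have := ler_wpM2l cosy0 siny; have := ler_wpM2l y0 cos2; nra.
Qed.

Lemma cmod_cexp_sub1 x : cmod (cexp x - 1) = 2 * `|sin (pi * x)|.
Proof.
have -> : 2 * `|sin (pi * x)| = Num.sqrt ((2 * sin (pi * x)) ^+ 2).
  by rewrite sqrtr_sqr normrM ger0_norm.
rewrite /cexp /cmod /=; congr Num.sqrt.
have -> : 2 * pi * x = (pi * x) *+ 2 :> R by rewrite -[RHS]mulr_natl mulrA.
rewrite cos_mulr2n sin_mulr2n oppr0 addr0 -[cos _ ^+ 2 *+ 2]mulr_natl -[cos _ * _ *+ 2]mulr_natl.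
have := cos2Dsin2 (pi * x); set c := cos _; set s := sin _ => h.
have hs : s ^+ 2 = 1 - c ^+ 2 by rewrite -h addrAC subrr add0r.
ring: hs.
Qed.

Lemma cmod_cexp_sub1_le x : cmod (cexp x - 1) <= 8 * `|x|.
Proof.
rewrite cmod_cexp_sub1.
have pi4 : pi <= 4 :> R by have := @pihalf_lt2 R; lra.
have pi0 : 0 < pi :> R by exact: pi_gt0.
wlog x0 : x / 0 <= x => [hw|].
  have [/hw//|/ltW x0] := leP 0 x.
  by rewrite -(normrN x) -(normrN (sin _)) -sinN -mulrN hw // oppr_ge0.
have sp : `|sin (pi * x)| <= pi * x.
  have px : 0 <= pi * x by rewrite mulr_ge0 // ltW.
  have [p1|p1] := leP (pi * x) pi.
    by rewrite ger0_norm ?sin_le_id ?sin_ge0_pi ?px.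
  by rewrite (le_trans (sin_max _)) // (le_trans _ (ltW p1)) //; have := @pi_ge2 R; lra.
rewrite (ger0_norm x0); have := ler_wpM2r x0 pi4; lra.
Qed.

Lemma cmod_cexp_subl x y : cmod (cexp x - cexp y) <= 8 * `|x - y|.
Proof.
have -> : cexp x - cexp y = cexp y * (cexp (x - y) - 1).
  by rewrite mulrBr -cexpD mulr1 addrCA subrr addr0.
by rewrite cmodM cmod_cexp mul1r cmod_cexp_sub1_le.
Qed.

Lemma cmod_cexp_sub1_ge x : `|x| <= 1 / 2 -> 2 * `|x| <= cmod (cexp x - 1).
Proof.
rewrite cmod_cexp_sub1 ler_pM2l //.
have pi2 : 2 <= pi :> R by exact: pi_ge2.
wlog x0 : x / 0 <= x => [hw|].
  have [/hw//|/ltW x0] := leP 0 x.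
  by rewrite -(normrN x) -(normrN (sin _)) -sinN -mulrN; apply: hw; rewrite oppr_ge0.
rewrite (ger0_norm x0) => x1.
have h : 0 <= pi * x <= pi / 2 by apply/andP; split; nra.
rewrite (le_trans _ (ler_norm _)) // (le_trans _ (sin_ge_half h)) //.
nra.
Qed.

End Circle.

Arguments cexp {R} t : simpl never.
Arguments cmod {R} z : simpl never.

(** * Kusmin-Landau and van der Corput *)

Section ExponentialSums.
Variable R : realType.

(** With d_n the increments of g one has u_n = (u_{n+1} - u_n) / (e(d_n) - 1) for
    u_n = e(g(n)).  Summing by parts, the variation of the coefficients
    1 / (e(d_n) - 1) is dominated by that of 1 / d_n, which telescopes because
    the d_n are monotone. *)
Lemma kusmin_landau_pos (g : nat -> R) (L : nat) (delta : R) (e2 : bool) :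
  0 < delta ->
  (forall n, (n < L)%N -> delta <= g n.+1 - g n <= 1 / 2) ->
  (forall n, (n.+1 < L)%N ->
    0 <= (-1) ^+ e2 * ((g n.+2 - g n.+1) - (g n.+1 - g n))) ->
  cmod (\sum_(0 <= n < L) cexp (g n)) <= 3 / delta.
Proof.
move=> d0 hd hmono.
case: L hd hmono => [|L] hd hmono.
  by rewrite big_geq // cmod0 divr_ge0 // ltW.
pose d n := g n.+1 - g n.
pose c n := (cexp (d n) - 1)^-1.
have dlb n : (n <= L)%N -> delta <= d n by move=> h; have /andP[] := hd n h.
have dpos n : (n <= L)%N -> 0 < d n.
  by move=> h; exact: lt_le_trans d0 (dlb n h).
have dlow n : (n <= L)%N -> 2 * d n <= cmod (cexp (d n) - 1).
  move=> h; have := dpos n h; have /andP[_ h2] := hd n h => /ltW h0.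
  by rewrite -{1}(ger0_norm h0) cmod_cexp_sub1_ge // ger0_norm.
have cne n : (n <= L)%N -> cexp (d n) - 1 != 0.
  move=> h; apply/eqP => h0; have := dlow n h; rewrite h0 cmod0.
  by have := dpos n h; lra.
have clb n : (n <= L)%N -> cmod (c n) <= (2 * delta)^-1.
  move=> h; rewrite /c cmodV lef_pV2 ?posrE; last 2 first.
  - by rewrite (lt_le_trans _ (dlow n h)) // mulr_gt0 // dpos.
  - by rewrite mulr_gt0.
  by rewrite (le_trans _ (dlow n h)) // ler_pM2l // dlb.
have ustep n : (n <= L)%N -> cexp (g n) = c n * (cexp (g n.+1) - cexp (g n)).
  move=> h; have -> : cexp (g n.+1) = cexp (g n) * cexp (d n).
    by rewrite -cexpD /d addrC subrK.
  by rewrite -{3}[cexp (g n)]mulr1 -mulrBr /c mulrCA mulVf ?mulr1 // cne.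
have cstep n : (n < L)%N ->
    cmod (c n - c n.+1) <= 2 * ((-1) ^+ e2 * ((d n)^-1 - (d n.+1)^-1)).
  move=> h; have h' := ltnW h.
  have -> : c n - c n.+1 = (cexp (d n.+1) - cexp (d n)) * (c n * c n.+1).
    by rewrite /c; field; rewrite !cne.
  have -> : (d n)^-1 - (d n.+1)^-1 = (d n.+1 - d n) / (d n * d n.+1).
    by field; rewrite !gt_eqF ?dpos.
  rewrite !cmodM.
  have h1 : cmod (cexp (d n.+1) - cexp (d n)) <= 8 * ((-1) ^+ e2 * (d n.+1 - d n)).
    have m0 : 0 <= (-1) ^+ e2 * (d n.+1 - d n) := hmono n h.
    by rewrite -(ger0_norm m0) normrM normr_sign mul1r cmod_cexp_subl.
  have h2 : cmod (c n) * cmod (c n.+1) <= (4 * (d n * d n.+1))^-1.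
    have -> : 4 * (d n * d n.+1) = (2 * d n) * (2 * d n.+1) by ring.
    rewrite invfM; apply: ler_pM; rewrite ?cmod_ge0 // /c cmodV lef_pV2 ?posrE ?dlow //.
    - by rewrite (lt_le_trans _ (dlow n h')) // mulr_gt0 // dpos.
    - by rewrite mulr_gt0 // dpos.
    - by rewrite (lt_le_trans _ (dlow n.+1 h)) // mulr_gt0 // dpos.
    - by rewrite mulr_gt0 // dpos.
  apply: (le_trans (ler_pM (cmod_ge0 _) (mulr_ge0 (cmod_ge0 _) (cmod_ge0 _)) h1 h2)).
  rewrite le_eqVlt; apply/orP; left; apply/eqP.
  by field; rewrite !gt_eqF ?dpos.
have key n : (n <= L)%N ->
    cmod (\sum_(0 <= i < n.+1) cexp (g i) - c n * cexp (g n.+1)) <=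
    cmod (c 0%N) + 2 * ((-1) ^+ e2 * ((d 0%N)^-1 - (d n)^-1)).
  elim: n => [|n IH] h.
    rewrite big_nat1 subrr !mulr0 addr0 {1}ustep //.
    by rewrite mulrBr addrAC subrr add0r cmodN cmodM cmod_cexp mulr1.
  rewrite big_nat_recr //=.
  have -> : \sum_(0 <= i < n.+1) cexp (g i) + cexp (g n.+1) - c n.+1 * cexp (g n.+2) =
     (\sum_(0 <= i < n.+1) cexp (g i) - c n * cexp (g n.+1))
      + (c n - c n.+1) * cexp (g n.+1).
    have e : c n.+1 * cexp (g n.+2) = cexp (g n.+1) + c n.+1 * cexp (g n.+1).
      by rewrite [X in X + _]ustep //; ring.
    by rewrite e; ring.
  rewrite (le_trans (cmodD _ _)) // cmodM cmod_cexp mulr1.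
  have := IH (ltnW h); have := cstep n h.
  by rewrite !mulrBr; set sg := (-1) ^+ _; lra.
have := key L (leqnn L).
set S := \sum_(0 <= i < _) _ => hS.
have : cmod S <= cmod (S - c L * cexp (g L.+1)) + cmod (c L * cexp (g L.+1)).
  by rewrite -{1}(subrK (c L * cexp (g L.+1)) S) cmodD.
rewrite cmodM cmod_cexp mulr1.
have := clb 0%N (leq0n _); have := clb L (leqnn _).
have i0 : 0 <= (d 0%N)^-1 <= delta^-1.
  by rewrite invr_ge0 ltW ?dpos //= lef_pV2 ?posrE ?dpos ?dlb.
have iL : 0 <= (d L)^-1 <= delta^-1.
  by rewrite invr_ge0 ltW ?dpos //= lef_pV2 ?posrE ?dpos ?dlb.
have hs : (-1) ^+ e2 * ((d 0%N)^-1 - (d L)^-1) <= delta^-1.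
  by case: (e2); rewrite ?expr1 ?expr0; lra.
rewrite invfM; lra.
Qed.

(** The bits e1 and e2 carry the sign of the increments and the direction in
    which they vary; conjugating the sum flips both. *)
Lemma kusmin_landau (g : nat -> R) (L : nat) (delta : R) (e1 e2 : bool) :
  0 < delta ->
  (forall n, (n < L)%N -> delta <= (-1) ^+ e1 * (g n.+1 - g n) <= 1 / 2) ->
  (forall n, (n.+1 < L)%N ->
    0 <= (-1) ^+ e2 * ((g n.+2 - g n.+1) - (g n.+1 - g n))) ->
  cmod (\sum_(0 <= n < L) cexp (g n)) <= 3 / delta.
Proof.
case: e1 => d0 hd hmono; last first.
  by apply: kusmin_landau_pos hmono => // n /hd; rewrite expr0 mul1r.
rewrite -cmod_conj conjc_sum.
under eq_bigr do rewrite -cexpN.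
apply: (@kusmin_landau_pos (fun n => - g n) L delta (~~ e2)) => // n h.
  by have := hd n h; rewrite expr1 => /andP[h1 h2]; apply/andP; split; lra.
by have := hmono n h; case: (e2); rewrite /= ?expr0 ?expr1; lra.
Qed.

Lemma sum_nat_widen (B : nat -> R) (a m n : nat) : (forall s, 0 <= B s) ->
  (m <= n)%N -> \sum_(a <= s < m) B s <= \sum_(a <= s < n) B s.
Proof.
move=> B0 mn; have [am|am] := leqP a m; last by rewrite big_geq ?sumr_ge0 // ltnW.
by rewrite (big_cat_nat am mn) /= lerDl sumr_ge0.
Qed.

Lemma sum_distn (B : nat -> R) (Q : nat) : (forall s, 0 <= B s) ->
  \sum_(0 <= q < Q) \sum_(0 <= p < Q) B ((q - p) + (p - q))%N <=
  Q%:R * (B 0%N + 2 * \sum_(1 <= s < Q) B s).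
Proof.
move=> B0.
have -> : Q%:R * (B 0%N + 2 * \sum_(1 <= s < Q) B s) =
   \sum_(0 <= q < Q) (B 0%N + 2 * \sum_(1 <= s < Q) B s).
  by rewrite sumr_const_nat subn0 mulr_natl.
rewrite [leLHS]big_nat [leRHS]big_nat; apply: ler_sum => q /andP[_ qQ].
rewrite (big_cat_nat (leq0n q) (ltnW qQ)) /=.
have -> : \sum_(0 <= p < q) B (q - p + (p - q))%N = \sum_(1 <= s < q.+1) B s.
  rewrite big_nat_rev big_add1 /= !big_nat; apply: eq_bigr => i /andP[_ iq].
  by congr B; lia.
have -> : \sum_(q <= p < Q) B (q - p + (p - q))%N =
    B 0%N + \sum_(1 <= s < (Q - q)%N) B s.
  rewrite -{1}(add0n q) big_addn [LHS]big_nat_cond.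
  rewrite (eq_bigr (fun i => B i)); last first.
    by move=> i /andP[/andP[_ iq] _]; congr B; lia.
  by rewrite -big_nat_cond big_ltn // subn_gt0.
have := @sum_nat_widen B 1 q.+1 Q B0 qQ.
have := @sum_nat_widen B 1 (Q - q) Q B0 (leq_subr _ _).
lra.
Qed.

Lemma sqr_sum_le (a : nat -> R) (n : nat) :
  (\sum_(0 <= i < n) a i) ^+ 2 <= n%:R * \sum_(0 <= i < n) a i ^+ 2.
Proof.
elim: n => [|n IH]; first by rewrite !big_geq // expr0n mul0r.
rewrite !big_nat_recr //=.
move: IH; set A := \sum_(0 <= i < n) a i; set S := \sum_(0 <= i < n) _ => IH.
case: n @A @S IH => [|n] A S IH.
  by rewrite /A /S !big_geq // !add0r mul1r.
have n0 : 0 < n.+1%:R :> R by [].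
rewrite -(ler_pM2l n0) -[n.+2%:R]natr1.
move: IH n0; set x := n.+1%:R; set b := a _ => IH n0.
have h1 : 0 <= x * (x * S - A ^+ 2) by apply: mulr_ge0; [exact: ltW|rewrite subr_ge0].
have h2 : 0 <= (A - x * b) ^+ 2 by rewrite sqr_ge0.
lra.
Qed.

(** Averaging the sum over the shifts q < Q, and extending u by zero, makes
    every shifted copy complete; Cauchy-Schwarz then leaves only the
    correlations of u with its translates. *)
Lemma van_der_corput (u : nat -> R[i]) (L Q : nat) (B : nat -> R) :
  (forall n, cmod (u n) <= 1) -> (0 < Q <= L)%N -> (forall s, 0 <= B s) ->
  (forall s, (0 < s < Q)%N ->
     cmod (\sum_(0 <= n < L - s) u (n + s)%N * (u n)^*%C) <= B s) ->
  cmod (\sum_(0 <= n < L) u n) ^+ 2 <=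
    2 * L%:R / Q%:R * (L%:R + 2 * \sum_(1 <= s < Q) B s).
Proof.
move=> u1 /andP[Q0 QL] B0 hB.
pose v i := if (Q <= i < L + Q)%N then u (i - Q)%N else 0.
pose w i := \sum_(0 <= q < Q) v (i + q)%N.
set S := \sum_(0 <= n < L) u n.
have shift q : (q < Q)%N -> \sum_(0 <= i < L + Q) v (i + q)%N = S.
  move=> qQ.
  have -> : \sum_(0 <= i < L + Q) v (i + q)%N = \sum_(q <= j < L + Q + q) v j.
    by rewrite -{2}(add0n q) big_addn addnK.
  rewrite (@big_cat_nat _ _ _ Q) /=; [|lia|lia].
  rewrite [X in X + _]big1_seq ?add0r; last first.
    by move=> i /=; rewrite mem_index_iota /v => h; case: ifP => // h2; lia.
  rewrite (@big_cat_nat _ _ _ (L + Q)%N) /=; [|lia|lia].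
  rewrite [X in _ + X]big1_seq ?addr0; last first.
    by move=> i /=; rewrite mem_index_iota /v => h; case: ifP => // h2; lia.
  rewrite -{1}(add0n Q) big_addn addnK /S !big_nat; apply: eq_bigr => i /andP[_ iL].
  by rewrite /v ifT ?addnK //; lia.
have QS : Q%:R * S = \sum_(0 <= i < L + Q) w i.
  rewrite /w exchange_big /= big_nat (eq_bigr (fun=> S)).
    by rewrite -big_nat sumr_const_nat subn0 mulr_natl.
  by move=> q /andP[_ qQ]; rewrite shift.
have corr q p : (p <= q < Q)%N ->
    \sum_(0 <= i < L + Q) v (i + q)%N * (v (i + p)%N)^*%C =
    \sum_(0 <= n < L - (q - p)) u (n + (q - p))%N * (u n)^*%C.
  move=> /andP[pq qQ].
  have -> : \sum_(0 <= i < L + Q) v (i + q)%N * (v (i + p)%N)^*%C =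
     \sum_(p <= j < L + Q + p) v (j + (q - p))%N * (v j)^*%C.
    rewrite -{2}(add0n p) big_addn addnK; apply: eq_bigr => i _.
    by rewrite -addnA subnKC.
  rewrite (@big_cat_nat _ _ _ Q) /=; [|lia|lia].
  rewrite [X in X + _]big1_seq ?add0r; last first.
    move=> i /=; rewrite mem_index_iota => h; rewrite [v i]/v ifF ?rmorph0 ?mulr0 //.
    lia.
  rewrite (@big_cat_nat _ _ _ (L - (q - p) + Q)%N) /=; [|lia|lia].
  rewrite [X in _ + X]big1_seq ?addr0; last first.
    move=> i /=; rewrite mem_index_iota => h; rewrite {1}/v ifF ?mul0r //.
    lia.
  rewrite -{1}(add0n Q) big_addn addnK !big_nat; apply: eq_bigr => i /andP[_ iL].
  rewrite /v !ifT; [|lia|lia].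
  by rewrite addnK; congr (u _ * _); lia.
pose B' s := if s is 0%N then L%:R else B s.
have B'0 s : 0 <= B' s by case: s => [|s]; [exact: ler0n|exact: B0].
have corrB q p : (q < Q)%N -> (p < Q)%N ->
    cmod (\sum_(0 <= i < L + Q) v (i + q)%N * (v (i + p)%N)^*%C) <=
    B' ((q - p) + (p - q))%N.
  wlog pq : q p / (p <= q)%N => [hw|] qQ pQ.
    have [/hw|/ltnW pq] := leqP p q; first exact.
    rewrite -cmod_conj conjc_sum [(q - p + _)%N]addnC.
    under eq_bigr do rewrite conjcM conjcK mulrC.
    exact: hw.
  rewrite corr ?pq //; have -> : (p - q = 0)%N by lia.
  rewrite addn0; case E : (q - p)%N => [|s]; last by apply: hB; lia.
  rewrite /B' subn0 (le_trans (cmod_sum _ _ _)) //.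
  have -> : L%:R = \sum_(0 <= i < L) 1 :> R by rewrite sumr_const_nat subn0.
  apply: ler_sum => i _; rewrite addn0 cmodM cmod_conj.
  by rewrite mulr_ile1 ?cmod_ge0.
have sqw : \sum_(0 <= i < L + Q) cmod (w i) ^+ 2 <=
   Q%:R * (L%:R + 2 * \sum_(1 <= s < Q) B s).
  apply: (@le_trans _ _ (\sum_(0 <= q < Q) \sum_(0 <= p < Q) B' ((q - p) + (p - q))%N)); last first.
    rewrite (le_trans (sum_distn Q B'0)) //= ler_wpM2l // lerD2l ler_wpM2l //.
    rewrite le_eqVlt; apply/orP; left; apply/eqP.
    rewrite !big_nat; apply: eq_bigr => i; by case: i.
  have -> : \sum_(0 <= i < L + Q) cmod (w i) ^+ 2 =
     cmod (\sum_(0 <= q < Q) \sum_(0 <= p < Q)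
        \sum_(0 <= i < L + Q) v (i + q)%N * (v (i + p)%N)^*%C).
    rewrite -[LHS]ger0_norm; last by rewrite sumr_ge0 // => i _; rewrite exprn_ge0 // cmod_ge0.
    rewrite -cmod_real; congr cmod.
    rewrite rmorph_sum /=.
    under eq_bigr => i _.
      rewrite cmod_sqr /w conjc_sum mulr_suml.
      under eq_bigr do rewrite mulr_sumr.
      over.
    rewrite exchange_big; apply: eq_bigr => q _.
    by rewrite exchange_big.
  rewrite (le_trans (cmod_sum _ _ _)) // !big_nat; apply: ler_sum => q /andP[_ qQ].
  rewrite (le_trans (cmod_sum _ _ _)) // !big_nat; apply: ler_sum => p /andP[_ pQ].
  exact: corrB.
have Qpos : 0 < Q%:R :> R by rewrite ltr0n.
have LQ : (L + Q)%:R <= 2 * L%:R :> R.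
  by rewrite -natrM ler_nat; lia.
have h1 : (Q%:R * cmod S) ^+ 2 <= (L + Q)%:R * \sum_(0 <= i < L + Q) cmod (w i) ^+ 2.
  rewrite -cmod_nat -cmodM QS (le_trans _ (sqr_sum_le _ _)) //.
  by rewrite lerXn2r ?nnegrE ?cmod_ge0 ?sumr_ge0 ?cmod_sum // => *; rewrite cmod_ge0.
set T := L%:R + _ in sqw *.
have T0 : 0 <= T by rewrite /T addr_ge0 // mulr_ge0 // sumr_ge0.
have h2 : (L + Q)%:R * \sum_(0 <= i < L + Q) cmod (w i) ^+ 2 <= 2 * L%:R * (Q%:R * T).
  apply: ler_pM => //; rewrite sumr_ge0 // => i _; by rewrite exprn_ge0 // cmod_ge0.
rewrite mulrAC ler_pdivlMr //.
rewrite -(ler_pM2l Qpos).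
have := le_trans h1 h2; set c := cmod S; set l := L%:R; set r := Q%:R => h.
have -> : r * (c ^+ 2 * r) = (r * c) ^+ 2 by ring.
by rewrite (le_trans h) // le_eqVlt; apply/orP; left; apply/eqP; ring.
Qed.

Lemma harmonic_le (n : nat) : \sum_(1 <= s < n.+1) s%:R^-1 <= 1 + ln n%:R :> R.
Proof.
case: n => [|n]; first by rewrite big_geq // mulr0n ln0 // addr0.
elim: n => [|n IH]; first by rewrite big_nat1 ln1 invr1 addr0.
rewrite big_nat_recr //=.
have n0 : 0 < n.+1%:R :> R by [].
have n1 : 0 < n.+2%:R :> R by [].
have h : n.+2%:R^-1 <= ln n.+2%:R - ln n.+1%:R :> R.
  rewrite -ln_div ?posrE //.
  have e : (n.+1%:R / n.+2%:R) = 1 + - n.+2%:R^-1 :> R.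
    rewrite -[n.+2%:R]natr1; field.
    by rewrite gt_eqF // addrAC addrC ltr_wpDl.
  have -> : n.+2%:R / n.+1%:R = (n.+1%:R / n.+2%:R)^-1 :> R by rewrite invf_div.
  rewrite lnV ?posrE ?divr_gt0 // e lerNr.
  by apply: le_ln1Dx; rewrite ltrN2 invf_lt1 // ltr1n.
rewrite (le_trans (lerD IH h)) //.
by rewrite -addrA lerD2l addrC subrK.
Qed.

End ExponentialSums.

(** * Exponential sums from bounds on derivatives *)

Section FiniteDifferences.
Variable R : realType.

Definition dif (S : seq nat) (f : R -> R) : R -> R :=
  foldr (fun s F x => F (x + s%:R) - F x) f S.

Definition prodn (S : seq nat) : nat := foldr muln 1%N S.

Definition derivatives (g : nat -> R -> R) : Prop :=
  forall (m : nat) (x : R), 0 < x -> is_derive x 1 (g m) (g m.+1 x).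

Variable g : nat -> R -> R.
Hypothesis dg : derivatives g.

Lemma is_derive_dif (S : seq nat) (m : nat) (x : R) : 0 < x -> is_derive x 1 (dif S (g m)) (dif S (g m.+1) x).
Proof.
elim: S x => [|s S IH] x x0 /=; first exact: dg.
have xs0 : 0 < x + s%:R by rewrite ltr_wpDr.
have h : is_derive x 1 (fun y => dif S (g m) (y + s%:R)) (dif S (g m.+1) (x + s%:R)).
  have := @is_derive1_comp R (dif S (g m)) (fun y => y + s%:R) x
    (dif S (g m.+1) (x + s%:R)) 1 (IH _ xs0).
  rewrite mulr1; apply.
  exact: is_derive_shift.
have := IH x x0.
exact: (is_deriveB h).
Qed.

(** Differencing commutes with differentiation, so the mean value theorem can be
    used once for each shift. *)
Lemma dif_mvt (S : seq nat) (m : nat) (x : R) : 0 < x ->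
  exists2 y, x <= y <= x + (sumn S)%:R &
    dif S (g m) x = (prodn S)%:R * g (m + size S)%N y.
Proof.
elim: S m x => [|s S IH] m x x0 /=.
  by exists x; rewrite ?addr0 ?lexx // mul1r addn0.
have [|||y] := @MVT_segment R (dif S (g m)) (dif S (g m.+1)) x (x + s%:R).
- by rewrite lerDl.
- move=> y; rewrite in_itv /= => /andP[xy _]; apply: is_derive_dif.
  exact: lt_trans xy.
- apply: derivable_within_continuous => y; rewrite in_itv /= => /andP[xy _].
  have [] // := is_derive_dif S m (lt_le_trans x0 xy).
rewrite in_itv /= => /andP[xy ys] ->.
have [z /andP[yz zs] ->] := IH m.+1 y (lt_le_trans x0 xy).
exists z; first by rewrite (le_trans xy yz) natrD addrA (le_trans zs) // lerD2r.
by rewrite natrM addnS addSn; ring.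
Qed.

(** Adjoining a shift to S differentiates the phase once more, so a sum whose
    phase is the difference along S is governed by the derivative of order
    size S + 1. *)
Lemma expsum_dif0 (S : seq nat) (X L : nat) (lo hi : R) (e1 e2 : bool) :
  (0 < X)%N -> (0 < prodn S)%N -> 0 < lo ->
  (forall x, X%:R <= x <= (X + L + sumn S)%:R ->
    lo <= (-1) ^+ e1 * g (size S).+1 x <= hi) ->
  (forall x, X%:R <= x <= (X + L + sumn S)%:R ->
    0 <= (-1) ^+ e2 * g (size S).+2 x) ->
  (prodn S)%:R * hi <= 1 / 2 ->
  cmod (\sum_(0 <= n < L) cexp (dif S (g 0%N) (X + n)%:R)) <=
    3 / ((prodn S)%:R * lo).
Proof.
move=> X0 S0 lo0 h1 h2 h3.
have P0 : 0 < (prodn S)%:R :> R by rewrite ltr0n.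
have step n : dif S (g 0%N) (X + n.+1)%:R - dif S (g 0%N) (X + n)%:R =
    dif (1%N :: S) (g 0%N) (X + n)%:R by rewrite /= -natrD -addnA addn1.
have xpos n : 0 < (X + n)%:R :> R by rewrite ltr0n addn_gt0 X0.
apply: (kusmin_landau (e1 := e1) (e2 := e2)); first by rewrite mulr_gt0.
- move=> n nL; rewrite step.
  have [y /andP[y1 y2] ->] := dif_mvt (1%N :: S) 0 (xpos n).
  rewrite /= mul1n add0n mulrCA.
  have yin : X%:R <= y <= (X + L + sumn S)%:R.
    rewrite (le_trans _ y1) ?ler_nat ?leq_addr //=.
    by rewrite (le_trans y2) //= -natrD ler_nat; lia.
  have /andP[l1 l2] := h1 _ yin; apply/andP; split; first by rewrite ler_pM2l.
  by rewrite (le_trans _ h3) // ler_pM2l.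
- move=> n nL; rewrite !step.
  have -> : dif (1%N :: S) (g 0%N) (X + n.+1)%:R - dif (1%N :: S) (g 0%N) (X + n)%:R =
    dif [:: 1%N, 1%N & S] (g 0%N) (X + n)%:R.
    by have -> : (X + n.+1)%:R = (X + n)%:R + 1%:R :> R by rewrite addnS natr1.
  have [y /andP[y1 y2] ->] := dif_mvt [:: 1%N, 1%N & S] 0 (xpos n).
  rewrite /= !mul1n add0n mulrCA mulr_ge0 ?h2 ?ler0n //.
  rewrite (le_trans _ y1) ?ler_nat ?leq_addr //=.
  by rewrite (le_trans y2) //= -natrD ler_nat; lia.
Qed.

Lemma ln_nat_ge0 n : 0 <= ln n%:R :> R.
Proof. by case: n => [|n]; [rewrite ln0|rewrite ln_ge0 // ler1n]. Qed.

(** One van der Corput step: the correlation of the summand with its translate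
    by s is the same kind of sum with s adjoined to S, and the bounds 1 / s
    add up to a logarithm. *)
Lemma expsum_dif1 (S : seq nat) (X L Q : nat) (lo hi : R) (e1 e2 : bool) :
  (0 < X)%N -> (0 < prodn S)%N -> 0 < lo -> (0 < Q <= L)%N ->
  (forall x, X%:R <= x <= (X + L + sumn S)%:R ->
    lo <= (-1) ^+ e1 * g (size S).+2 x <= hi) ->
  (forall x, X%:R <= x <= (X + L + sumn S)%:R ->
    0 <= (-1) ^+ e2 * g (size S).+3 x) ->
  Q%:R * (prodn S)%:R * hi <= 1 / 2 ->
  cmod (\sum_(0 <= n < L) cexp (dif S (g 0%N) (X + n)%:R)) ^+ 2 <=
    2 * L%:R / Q%:R * (L%:R + 6 * (1 + ln Q%:R) / ((prodn S)%:R * lo)).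
Proof.
move=> X0 S0 lo0 /andP[Q0 QL] h1 h2 h3.
have P0 : 0 < (prodn S)%:R :> R by rewrite ltr0n.
have hi0 : 0 <= hi.
  have /andP[l1 l2] : lo <= (-1) ^+ e1 * g (size S).+2 X%:R <= hi.
    by apply: h1; rewrite lexx ler_nat; lia.
  by rewrite (le_trans (ltW lo0)) // (le_trans l1).
pose B s : R := 3 / ((prodn S)%:R * lo) * s%:R^-1.
have c0 : 0 <= 3 / ((prodn S)%:R * lo) by rewrite divr_ge0 // mulr_ge0 // ltW.
have B0 s : 0 <= B s by rewrite mulr_ge0 // invr_ge0.
have := @van_der_corput R (fun n => cexp (dif S (g 0%N) (X + n)%:R)) L Q B.
move=> /(_ _ _ B0) hv; apply: (le_trans (hv _ _ _)).
- by move=> n; rewrite cmod_cexp.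
- by rewrite Q0.
- move=> s /andP[s0 sQ].
  under eq_bigr => n _.
    rewrite -cexpB.
    have -> : dif S (g 0%N) (X + (n + s))%:R - dif S (g 0%N) (X + n)%:R =
      dif (s :: S) (g 0%N) (X + n)%:R by rewrite /= -natrD addnA.
    over.
  apply: (le_trans (@expsum_dif0 (s :: S) X (L - s) lo hi e1 e2 _ _ _ _ _ _)) => //=.
  + by rewrite muln_gt0 s0.
  + move=> x /andP[x1 x2]; apply: h1; rewrite x1 (le_trans x2) // ler_nat; lia.
  + move=> x /andP[x1 x2]; apply: h2; rewrite x1 (le_trans x2) // ler_nat; lia.
  + rewrite (le_trans _ h3) // ler_wpM2r // natrM ler_wpM2r // ler_nat ltnW //.
  + have sne : s%:R != 0 :> R by rewrite pnatr_eq0 -lt0n.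
    have -> : 3 / ((s * prodn S)%:R * lo) = B s; last exact: lexx.
    by rewrite /B natrM; field; rewrite sne !gt_eqF.
rewrite ler_wpM2l ?divr_ge0 ?mulr_ge0 // lerD2l /B -mulr_sumr.
have hh : \sum_(1 <= s < Q) s%:R^-1 <= 1 + ln Q%:R :> R.
  rewrite (le_trans _ (harmonic_le R Q)) //.
  by apply: sum_nat_widen => // s; rewrite invr_ge0.
have -> : 6 * (1 + ln Q%:R) / ((prodn S)%:R * lo) =
    2 * (3 / ((prodn S)%:R * lo) * (1 + ln Q%:R)) by field; rewrite !gt_eqF.
by rewrite ler_pM2l // ler_wpM2l.
Qed.

(** Two van der Corput steps, with P shifts in the first and Q in the second.
    The inner bound is used uniformly in the first shift, at the value s = 1
    where it is weakest. *)
Lemma expsum_dif2 (X L P Q : nat) (lo hi : R) (e1 e2 : bool) :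
  (0 < X)%N -> 0 < lo -> (0 < P)%N -> (0 < Q)%N -> (P + Q <= L)%N ->
  (forall x, X%:R <= x <= (X + L)%:R -> lo <= (-1) ^+ e1 * g 3 x <= hi) ->
  (forall x, X%:R <= x <= (X + L)%:R -> 0 <= (-1) ^+ e2 * g 4 x) ->
  Q%:R * P%:R * hi <= 1 / 2 ->
  cmod (\sum_(0 <= n < L) cexp (g 0%N (X + n)%:R)) ^+ 2 <=
    2 * L%:R / P%:R * (L%:R + 2 * P%:R *
      Num.sqrt (2 * L%:R / Q%:R * (L%:R + 6 * (1 + ln Q%:R) / lo))).
Proof.
move=> X0 lo0 P0 Q0 PQ h1 h2 h3.
have hi0 : 0 <= hi.
  have /andP[l1 l2] : lo <= (-1) ^+ e1 * g 3 X%:R <= hi.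
    by apply: h1; rewrite lexx ler_nat; lia.
  by rewrite (le_trans (ltW lo0)) // (le_trans l1).
have lnQ := ln_nat_ge0 Q.
set T := Num.sqrt _.
have T0 : 0 <= T by exact: sqrtr_ge0.
have arg0 : 0 <= 6 * (1 + ln Q%:R) / lo by rewrite divr_ge0 ?mulr_ge0 ?addr_ge0 // ltW.
have PL : (0 < P <= L)%N by lia.
apply: (le_trans (@van_der_corput R (fun n => cexp (g 0%N (X + n)%:R)) L P (fun=> T) _ PL _ _)) => //.
- by move=> n; rewrite cmod_cexp.
- move=> s /andP[s0 sP].
  under eq_bigr => n _.
    rewrite -cexpB.
    have -> : g 0%N (X + (n + s))%:R - g 0%N (X + n)%:R =
      dif [:: s] (g 0%N) (X + n)%:R by rewrite /= -natrD addnA.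
    over.
  have sL : (s <= L)%N by case/andP: PL => _; apply: leq_trans; exact: ltnW.
  have sR : 1 <= s%:R :> R by rewrite ler1n.
  have LsR : (L - s)%:R <= L%:R :> R by rewrite ler_nat leq_subr.
  rewrite -[leLHS]ger0_norm ?cmod_ge0 // -sqrtr_sqr ler_wsqrtr //.
  apply: (le_trans (@expsum_dif1 [:: s] X (L - s) Q lo hi e1 e2 X0 _ lo0 _ _ _ _)).
  + by rewrite /= muln1.
  + by rewrite Q0 leq_subRL // (leq_trans _ PQ) // leq_add2r ltnW.
  + by move=> x; rewrite /= addn0 -addnA subnK //; exact: h1.
  + by move=> x; rewrite /= addn0 -addnA subnK //; exact: h2.
  + rewrite /= muln1 (le_trans _ h3) // ler_wpM2r // ler_wpM2l // ler_nat ltnW //.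
  rewrite /= muln1; apply: ler_pM.
  + by rewrite divr_ge0 ?mulr_ge0.
  + by rewrite addr_ge0 // divr_ge0 ?mulr_ge0 ?addr_ge0 // ltW.
  + by rewrite ler_wpM2r ?invr_ge0 // ler_wpM2l.
  + rewrite lerD // ler_wpM2l ?mulr_ge0 ?addr_ge0 // lef_pV2 ?posrE ?mulr_gt0 //.
      by rewrite -[leLHS]mul1r ler_wpM2r // ltW.
    by rewrite (lt_le_trans ltr01).
rewrite sumr_const_nat ler_wpM2l ?divr_ge0 ?mulr_ge0 // lerD2l -mulrA ler_wpM2l //.
by rewrite -[T *+ _]mulr_natl ler_wpM2r // ler_nat leq_subr.
Qed.

End FiniteDifferences.

(** * The phases *)

Section Phases.
Variable R : realType.
Variables (alpha : R) (K rho : nat) (a b : int).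
Hypothesis halpha : 1 < alpha < 2.
Hypotheses (K0 : (0 < K)%N) (rho0 : (0 < rho)%N).

Definition ffalling (m : nat) : R := \prod_(i < m) (alpha - i%:R).

(** The derivative of order m of x |-> (a x ^ alpha + b (x + rho) ^ alpha) / K. *)
Definition phase (m : nat) (x : R) : R :=
  K%:R^-1 * (ffalling m * (a%:~R * x `^ (alpha - m%:R)
                         + b%:~R * (x + rho%:R) `^ (alpha - m%:R))).

Lemma ffallingS m : ffalling m.+1 = ffalling m * (alpha - m%:R).
Proof. by rewrite /ffalling big_ord_recr. Qed.

Lemma ffalling_bounds m : (2 <= m <= 5)%N ->
  (alpha - 1) * (2 - alpha) <= `|ffalling m| <= 12.
Proof.
move=> hm; have /andP[a1 a2] := halpha.
have F2 : ffalling 2 = alpha * (alpha - 1).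
  by rewrite /ffalling !big_ord_recr big_ord0 /= subr0 mul1r.
have h2 : 0 < ffalling 2 <= 2 /\ (alpha - 1) * (2 - alpha) <= ffalling 2.
  by rewrite F2; split; [apply/andP; split|]; nra.
have [/andP[h20 h22] h2l] := h2.
have F3 : `|ffalling 3| = ffalling 2 * (2 - alpha).
  by rewrite ffallingS normrM gtr0_norm // distrC ger0_norm // subr_ge0 ltW.
have F4 : `|ffalling 4| = `|ffalling 3| * (3 - alpha).
  by rewrite [in LHS]ffallingS normrM distrC [X in _ * X = _]ger0_norm //; lra.
have F5 : `|ffalling 5| = `|ffalling 4| * (4 - alpha).
  by rewrite [in LHS]ffallingS normrM distrC [X in _ * X = _]ger0_norm //; lra.
have h3 : (alpha - 1) * (2 - alpha) <= `|ffalling 3| <= 2.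
  by rewrite F3 F2; apply/andP; split; nra.
have h4 : (alpha - 1) * (2 - alpha) <= `|ffalling 4| <= 4.
  have c0 : 0 <= (alpha - 1) * (2 - alpha) by nra.
  by rewrite F4; case/andP: h3 => h31 h32; apply/andP; split; nra.
have h5 : (alpha - 1) * (2 - alpha) <= `|ffalling 5| <= 12.
  have c0 : 0 <= (alpha - 1) * (2 - alpha) by nra.
  by rewrite F5; case/andP: h4 => h41 h42; apply/andP; split; nra.
case: m hm => [|[|[|[|[|[|m]]]]]] // _.
- by rewrite gtr0_norm // h2l /=; lra.
- by case/andP: h3 => -> /=; lra.
- by case/andP: h4 => -> /=; lra.
Qed.

Lemma derivatives_phase : derivatives phase.
Proof.
move=> m x x0.
have xr0 : 0 < x + rho%:R by rewrite ltr_wpDr.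
pose be := alpha - m%:R.
have d1 : is_derive x 1 (fun y : R => y `^ be) (be * x `^ (be - 1)).
  exact: is_derive1_powR.
have d2 : is_derive x 1 (fun y : R => (y + rho%:R) `^ be)
    (be * (x + rho%:R) `^ (be - 1)).
  have := @is_derive1_comp R (fun y => y `^ be) (shift rho%:R) x
    (be * (x + rho%:R) `^ (be - 1)) 1 (is_derive1_powR be xr0).
  by rewrite mulr1; apply; exact: is_derive_shift.
have h := is_deriveZ (K%:R^-1 : R) (is_deriveZ (ffalling m)
  (is_deriveD (is_deriveZ (a%:~R : R) d1) (is_deriveZ (b%:~R : R) d2))).
have e : phase m.+1 x = K%:R^-1 *: (ffalling m *: (a%:~R *: (be * x `^ (be - 1))
   + b%:~R *: (be * (x + rho%:R) `^ (be - 1)))).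
  rewrite /phase ffallingS.
  have -> : alpha - m.+1%:R = be - 1 by rewrite /be -natr1; ring.
  by rewrite /GRing.scale /= /be; ring.
by rewrite e; exact: h.
Qed.

Lemma powR_shift_mvt (be x : R) : 0 < x ->
  exists2 y, x <= y <= x + rho%:R &
    (x + rho%:R) `^ be - x `^ be = be * y `^ (be - 1) * rho%:R.
Proof.
move=> x0.
have [|||y] := @MVT_segment R (fun y => y `^ be) (fun y => be * y `^ (be - 1))
   x (x + rho%:R).
- by rewrite lerDl.
- move=> y; rewrite in_itv /= => /andP[xy _]; apply: is_derive1_powR.
  exact: lt_trans xy.
- apply: derivable_within_continuous => y; rewrite in_itv /= => /andP[xy _].
  by have [] := is_derive1_powR be (lt_le_trans x0 xy).
rewrite in_itv /= => xy ->.
by exists y => //; congr (_ * _); rewrite addrAC subrr add0r.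
Qed.

Lemma le0_powR_anti (c x y : R) : c <= 0 -> 0 < x -> x <= y -> y `^ c <= x `^ c.
Proof.
move=> c0 x0 xy; have y0 : 0 < y := lt_le_trans x0 xy.
rewrite -[c]opprK (powRN y) (powRN x) lef_pV2 ?posrE ?powR_gt0 //.
have nc : 0 <= - c by rewrite oppr_ge0.
by apply: (ge0_ler_powR nc) => //; rewrite nnegrE ltW.
Qed.

Lemma intr_norm_ge1 (z : int) : z != 0 -> 1 <= `|z%:~R| :> R.
Proof. by move=> z0; rewrite -intr_norm -[leLHS]/(1%:~R) ler_int -gtz0_ge1 normr_gt0. Qed.

(** When a + b != 0 the two powers differ by a relatively small amount and
    the phase behaves like (a + b) x ^ alpha; when a + b = 0 it is a single
    difference and behaves like x ^ (alpha - 1).  In the second case every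
    derivative is one order smaller, which is what d records. *)
Lemma phase_bounds (X Y H : R) : (a != 0) || (b != 0) ->
  `|a%:~R| <= H -> `|b%:~R| <= H -> 0 < X -> X <= Y -> 8 * H * rho%:R <= X ->
  exists d : bool, forall m, (2 <= m + d <= 5)%N -> exists e : bool,
    forall x, X <= x <= Y ->
    (alpha - 1) * (2 - alpha) / (2 * K%:R) * (2 * Y) `^ (alpha - (m + d)%:R)
      <= (-1) ^+ e * phase m x
      <= 36 * rho%:R * H * X `^ (alpha - (m + d)%:R).
Proof.
move=> ab aH bH X0 XY HX; have /andP[al1 al2] := halpha.
set c := (alpha - 1) * (2 - alpha).
have c0 : 0 < c by rewrite /c mulr_gt0 // subr_gt0.
have c0' := ltW c0.
have KR : 1 <= K%:R :> R by rewrite ler1n.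
have rR : 1 <= rho%:R :> R by rewrite ler1n.
have Ki0 : 0 < K%:R^-1 :> R by rewrite invr_gt0; lra.
have Ki1 : K%:R^-1 <= 1 :> R by rewrite invf_le1; lra.
have H0 : 0 <= H by rewrite (le_trans _ aH).
(* Turns bounds on the modulus of a factored value into the signed form. *)
have signed (u v l h : R) (e := (u < 0)) : l <= `|u| * v -> `|u| * v <= h ->
    l <= (-1) ^+ e * (u * v) <= h.
  by rewrite /e mulrA -normrEsign => -> ->.
have xin x : X <= x <= Y -> [/\ 0 < x, X <= x, x <= Y & x <= 2 * Y].
  by move=> /andP[h1 h2]; split=> //; lra.
have [sum0|sum0] := eqVneq (a + b) 0.
  have ea : a = - b by rewrite -(addr0_eq sum0) opprK.
  have b0 : b != 0 by move: ab; rewrite ea oppr_eq0 orbb.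
  have be : a%:~R = - b%:~R :> R by rewrite ea mulrNz.
  exists true => m hm.
  exists (ffalling m.+1 * b%:~R < 0) => x /xin[x0 Xx xY x2Y].
  have [y /andP[xy yx] hy] := powR_shift_mvt (alpha - m%:R) x0.
  have y0 := lt_le_trans x0 xy.
  have -> : phase m x =
      ffalling m.+1 * b%:~R * (K%:R^-1 * rho%:R * y `^ (alpha - (m + true)%:R)).
    rewrite /phase be mulNr addrC -mulrBr hy ffallingS.
    have -> : alpha - (m + true)%:R = alpha - m%:R - 1.
      by rewrite addn1 -natr1; ring.
    by ring.
  have rX : rho%:R <= X.
    have : 1 <= `|b%:~R| :> R by exact: intr_norm_ge1.
    by nra.
  have yY : y <= 2 * Y by lra.
  have g0 : alpha - (m + true)%:R <= 0.
    have : 2 <= (m + true)%:R :> R by rewrite ler_nat; case/andP: hm.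
    by lra.
  have p1 := le0_powR_anti g0 y0 yY.
  have p2 := le0_powR_anti g0 X0 (le_trans Xx xy).
  have p0 : 0 <= (2 * Y) `^ (alpha - (m + true)%:R) by exact: powR_ge0.
  move: p1 p2 p0; set yp := y `^ _; set Yp := (2 * Y) `^ _; set Xp := X `^ _.
  move=> p1 p2 p0; have yp0 := le_trans p0 p1.
  have /andP[F1 F2] : c <= `|ffalling m.+1| <= 12.
    by apply: ffalling_bounds; move: hm; rewrite addn1.
  have b1 := intr_norm_ge1 b0.
  apply: signed; rewrite normrM.
    have h1 : c <= `|ffalling m.+1| * `|b%:~R|.
      by rewrite -[c]mulr1; apply: ler_pM; rewrite // ltW.
    have h2 : K%:R^-1 / 2 * Yp <= K%:R^-1 * rho%:R * yp.
      apply: ler_pM => //.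
      by rewrite ler_pM2l // (le_trans _ rR) // invf_le1 ?ler1n.
    have -> : c / (2 * K%:R) * Yp = c * (K%:R^-1 / 2 * Yp).
      by rewrite invfM; ring.
    by apply: ler_pM => //; rewrite mulr_ge0.
  have h1 : `|ffalling m.+1| * `|b%:~R| <= 36 * H.
    by apply: ler_pM => //; lra.
  have h2 : K%:R^-1 * rho%:R * yp <= rho%:R * Xp.
    by apply: ler_pM => //; rewrite -[leRHS]mul1r ler_wpM2r.
  have -> : 36 * rho%:R * H * Xp = 36 * H * (rho%:R * Xp) by ring.
  by apply: ler_pM => //; rewrite mulr_ge0.
exists false => m; rewrite addn0 => hm.
exists (ffalling m * (a + b)%:~R < 0) => x /xin[x0 Xx xY x2Y].
have sR := intr_norm_ge1 sum0.
have sH : `|(a + b)%:~R| <= 2 * H :> R.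
  by rewrite intrD (le_trans (ler_normD _ _)) //; lra.
have g0 : alpha - m%:R <= 0.
  have : 2 <= m%:R :> R by rewrite ler_nat; case/andP: hm.
  by lra.
have m5 : m%:R <= 5 :> R by rewrite ler_nat; case/andP: hm.
set be := alpha - m%:R in g0 *.
have [y /andP[xy yx] hy] := powR_shift_mvt be x0.
have y0 := lt_le_trans x0 xy.
(* The relative perturbation caused by the shift rho. *)
pose ep : R := b%:~R / (a + b)%:~R * (be * (y `^ (be - 1) / x `^ be) * rho%:R).
have xp0 : 0 < x `^ be by rewrite powR_gt0.
have sne : (a + b)%:~R != 0 :> R by rewrite intr_eq0.
have -> : phase m x = ffalling m * (a + b)%:~R * (K%:R^-1 * x `^ be * (1 + ep)).
  rewrite /phase -/be.
  have -> : (x + rho%:R) `^ be = x `^ be + be * y `^ (be - 1) * rho%:R.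
    by rewrite -hy [RHS]addrC subrK.
  rewrite /ep intrD; field.
  by rewrite (gt_eqF xp0) -intrD sne pnatr_eq0 -lt0n K0.
have epb : `|ep| <= 1 / 2.
  rewrite /ep 3!normrM normfV normrM.
  have q1 : `|b%:~R| / `|(a + b)%:~R| <= H.
    rewrite ler_pdivrMr; last by rewrite (lt_le_trans _ sR).
    by rewrite (le_trans bH) // -[leLHS]mulr1 ler_wpM2l.
  have q2 : `|be| <= 4 by rewrite ler_norml; apply/andP; split; [rewrite /be|]; lra.
  have q3 : `|y `^ (be - 1) / x `^ be| <= x^-1.
    rewrite ger0_norm; last by rewrite divr_ge0 ?powR_ge0.
    rewrite ler_pdivrMr //.
    have -> : x^-1 * x `^ be = x `^ (be - 1).
      by rewrite powRD ?(gt_eqF x0) ?implybT // powR_inv1 ?ltW // mulrC.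
    by apply: le0_powR_anti => //; lra.
  have xi0 : 0 < x^-1 by rewrite invr_gt0.
  have bnd : H * (4 * x^-1 * rho%:R) <= 1 / 2.
    have -> : H * (4 * x^-1 * rho%:R) = 8 * H * rho%:R / 2 / x.
      by field; rewrite gt_eqF.
    by rewrite ler_pdivrMr //; lra.
  rewrite (le_trans _ bnd) //.
  apply: ler_pM => //.
  rewrite [X in _ * X <= _]ger0_norm // ler_wpM2r //.
  by apply: ler_pM.
have := epb; rewrite ler_norml => /andP[ep1 ep2].
have p1 := le0_powR_anti g0 x0 x2Y.
have p2 := le0_powR_anti g0 X0 Xx.
have p0 : 0 <= (2 * Y) `^ be by exact: powR_ge0.
move: p1 p2 p0 xp0; set xp := x `^ _; set Yp := (2 * Y) `^ _; set Xp := X `^ _.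
move=> p1 p2 p0 xp0.
have /andP[F1 F2] : c <= `|ffalling m| <= 12 by exact: ffalling_bounds.
apply: signed; rewrite normrM.
  have h1 : c <= `|ffalling m| * `|(a + b)%:~R|.
    by rewrite -[c]mulr1; apply: ler_pM; rewrite // ltW.
  have h2 : K%:R^-1 * Yp / 2 <= K%:R^-1 * xp * (1 + ep).
    apply: ler_pM; rewrite ?mulr_ge0 ?(ltW Ki0) ?ler_pM2l //; lra.
  have -> : c / (2 * K%:R) * Yp = c * (K%:R^-1 * Yp / 2).
    by rewrite invfM; ring.
  by apply: ler_pM => //; rewrite divr_ge0 // mulr_ge0 // ltW.
have h1 : `|ffalling m| * `|(a + b)%:~R| <= 24 * H.
  have -> : 24 * H = 12 * (2 * H) by ring.
  by apply: ler_pM.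
have h2 : K%:R^-1 * xp * (1 + ep) <= rho%:R * Xp * (3 / 2).
  apply: ler_pM; rewrite ?mulr_ge0 ?(ltW Ki0) ?(ltW xp0) //; [lra| |lra].
  apply: ler_pM; rewrite ?(ltW Ki0) ?(ltW xp0) //; lra.
have -> : 36 * rho%:R * H * Xp = 24 * H * (rho%:R * Xp * (3 / 2)) by field.
by apply: ler_pM => //; rewrite !mulr_ge0 ?(ltW Ki0) ?(ltW xp0) //; lra.
Qed.

End Phases.

(** * Fejer kernels *)

Section Fejer.
Variable R : realType.
Implicit Types (s t d : R).

(** Distance from t to the nearest integer, up to constant factors, in a form
    that interacts with exponentials by algebra alone. *)
Definition chord t : R := cmod (cexp t - 1).

Lemma chord_ge0 t : 0 <= chord t.
Proof. exact: cmod_ge0. Qed.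

Lemma chordN t : chord (- t) = chord t.
Proof. by rewrite /chord !cmod_cexp_sub1 mulrN sinN normrN. Qed.

Lemma chordDint t (m : int) : chord (t + m%:~R) = chord t.
Proof. by rewrite /chord cexpDint. Qed.

Lemma chord_ge t : `|t| <= 1 -> 2 * Num.min `|t| (1 - `|t|) <= chord t.
Proof.
wlog t0 : t / 0 <= t => [hw|].
  have [/hw//|/ltW t0] := leP 0 t.
  by rewrite -(normrN t) -chordN; apply: hw; rewrite oppr_ge0.
rewrite ger0_norm // => t1.
have [ts|tl] := leP t (1 / 2).
  apply: le_trans (cmod_cexp_sub1_ge _); rewrite ger0_norm //.
  by rewrite ler_pM2l // ge_min lexx.
rewrite -(chordDint t (-1)); apply: le_trans (cmod_cexp_sub1_ge _).
- by rewrite ler_pM2l // ge_min ler0_norm ?opprB ?lexx ?orbT // subr_le0.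
- by rewrite ler0_norm ?subr_le0 // opprB; lra.
Qed.

Definition dirichlet (H : nat) t : R[i] := \sum_(0 <= j < H) cexp (j%:R * t).

Definition fejer (H : nat) t : R := cmod (dirichlet H t) ^+ 2 / H%:R.

Lemma fejer_ge0 H t : 0 <= fejer H t.
Proof. by rewrite divr_ge0 // exprn_ge0 // cmod_ge0. Qed.

Lemma fejerDint H t (m : int) : fejer H (t + m%:~R) = fejer H t.
Proof.
rewrite /fejer /dirichlet; congr (cmod _ ^+ 2 / _); apply: eq_bigr => j _.
by rewrite mulrDr -[j%:R]/((j%:Z)%:~R) -intrM cexpDint.
Qed.

(** Multiplication by e(t) - 1 makes the sum telescope. *)
Lemma geometric_block t (p q : nat) :
  cmod (\sum_(p <= j < q) cexp (j%:R * t)) * chord t <= 2.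
Proof.
have [pq|qp] := leqP p q; last by rewrite big_geq ?cmod0 ?mul0r // ltnW.
rewrite /chord -cmodM mulr_suml.
have -> : \sum_(p <= j < q) cexp (j%:R * t) * (cexp t - 1) =
    \sum_(p <= j < q) (cexp (j.+1%:R * t) - cexp (j%:R * t)).
  apply: eq_bigr => j _; rewrite mulrBr mulr1 -cexpD; congr (cexp _ - _).
  by rewrite -natr1 mulrDl mul1r.
rewrite telescope_sumr //.
by rewrite (le_trans (cmodB _ _)) // !cmod_cexp.
Qed.

Lemma fejer_le H t : 0 < chord t -> fejer H t <= 4 / (H%:R * chord t ^+ 2).
Proof.
move=> c0; rewrite /fejer invfM mulrA [leRHS]mulrAC ler_wpM2r ?invr_ge0 //.
rewrite ler_pdivlMr ?exprn_gt0 // -exprMn.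
have -> : (4 : R) = 2 ^+ 2 by rewrite expr2; ring.
rewrite lerXn2r ?nnegrE ?mulr_ge0 ?cmod_ge0 ?chord_ge0 //.
exact: geometric_block.
Qed.

Lemma chord_mulrn t (n : nat) : chord (n%:R * t) <= n%:R * chord t.
Proof.
elim: n => [|n IH]; first by rewrite !mul0r /chord cexp0 subrr cmod0.
have -> : n.+1%:R * t = n%:R * t + t by rewrite -natr1 mulrDl mul1r.
rewrite /chord cexpD.
have -> : cexp (n%:R * t) * cexp t - 1 =
  cexp t * (cexp (n%:R * t) - 1) + (cexp t - 1) by ring.
rewrite (le_trans (cmodD _ _)) // cmodM cmod_cexp mul1r -natr1 mulrDl mul1r.
by rewrite lerD2r.
Qed.

(** Near 0 all the terms of the Dirichlet kernel are close to 1: the j-th one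
    differs from 1 by at most j chord t. *)
Lemma fejer_ge H t : (0 < H)%N -> chord t <= H%:R^-1 -> H%:R / 4 <= fejer H t.
Proof.
move=> H0 ct; have HR : 0 < H%:R :> R by rewrite ltr0n.
have lowd : H%:R / 2 <= cmod (dirichlet H t).
  have e : dirichlet H t = H%:R + \sum_(0 <= j < H) (cexp (j%:R * t) - 1).
    by rewrite sumrB sumr_const_nat subn0 addrC subrK.
  have b : cmod (\sum_(0 <= j < H) (cexp (j%:R * t) - 1)) <= H%:R / 2.
    rewrite (le_trans (cmod_sum _ _ _)) //.
    apply: (@le_trans _ _ (\sum_(0 <= j < H) j%:R * H%:R^-1)).
      by apply: ler_sum => j _; rewrite (le_trans (chord_mulrn _ _)) // ler_wpM2l.
    rewrite -mulr_suml -natr_sum ler_pdivrMr //.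
    have : (\sum_(0 <= j < H) j <= H * H %/ 2)%N.
      rewrite big_mkord; elim: (H) => [|n IH]; first by rewrite big_ord0.
      rewrite big_ord_recr /=.
      have -> : (n.+1 * n.+1 = n * n + n * 2 + 1)%N by rewrite mulSn mulnS; lia.
      by move: IH; set q := (n * n)%N; set u := (\sum_(i < n) i)%N; lia.
    rewrite -(ler_nat R) => /le_trans; apply.
    have : (H * H %/ 2 * 2 <= H * H)%N by rewrite leq_divM.
    by rewrite -(ler_nat R) !natrM; lra.
  have h : H%:R <= cmod (dirichlet H t) + cmod (\sum_(0 <= j < H) (cexp (j%:R * t) - 1)).
    by rewrite -{1}(cmod_nat R H) -[H%:R](addrK (\sum_(0 <= j < H) (cexp (j%:R * t) - 1))) -e cmodB.
  by lra.
rewrite /fejer ler_pdivlMr // expr2.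
have -> : H%:R / 4 * H%:R = (H%:R / 2) * (H%:R / 2) :> R by field.
by apply: ler_pM.
Qed.

Lemma fejerE H t : (fejer H t)%:C%C =
  \sum_(0 <= j < H) \sum_(0 <= l < H) H%:R^-1 * cexp ((j%:R - l%:R) * t).
Proof.
rewrite /fejer rmorphM /= cmod_sqr /dirichlet conjc_sum mulr_suml mulr_suml.
apply: eq_bigr => j _; rewrite mulr_sumr mulr_suml; apply: eq_bigr => l _.
rewrite mulrC -cexpB -mulrBl; congr (_ * _).
by rewrite fmorphV rmorph_nat.
Qed.

Lemma cexp_root_sum (M : nat) (h : int) : (0 < M)%N -> h != 0 -> `|h%:~R| < M%:R :> R ->
  \sum_(0 <= m < M) cexp (m%:R * (h%:~R / M%:R : R)) = 0.
Proof.
move=> M0 h0 hM; have MR : 0 < M%:R :> R by rewrite ltr0n.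
set t := h%:~R / M%:R.
have ne : cexp t - 1 != 0.
  apply/eqP => e.
  have tn : `|t| < 1 by rewrite normrM normfV (ger0_norm (ltW MR)) ltr_pdivrMr // mul1r.
  have t0 : t != 0 by rewrite mulf_neq0 ?invr_neq0 ?intr_eq0 // gt_eqF.
  have := chord_ge (ltW tn); rewrite /chord e cmod0.
  by apply/negP; rewrite -ltNge mulr_gt0 // lt_min normr_gt0 t0 subr_gt0.
apply: (mulIf ne); rewrite mul0r mulr_suml.
have -> : \sum_(0 <= m < M) cexp (m%:R * t) * (cexp t - 1) =
    \sum_(0 <= m < M) (cexp (m.+1%:R * t) - cexp (m%:R * t)).
  apply: eq_bigr => j _; rewrite mulrBr mulr1 -cexpD; congr (cexp _ - _).
  by rewrite -natr1 mulrDl mul1r.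
rewrite telescope_sumr // mul0r /t mulrCA divff ?mulr1 ?gt_eqF //.
by rewrite cexp_int cexp0 subrr.
Qed.

(** The kernel is a trigonometric polynomial of degree less than M with constant
    term 1, and its nonconstant characters sum to 0 over M equally spaced
    points. *)
Lemma fejer_mean (H M : nat) t : (0 < H)%N -> (H <= M)%N ->
  M%:R^-1 * \sum_(0 <= m < M) fejer H (t - m%:R / M%:R) = 1.
Proof.
move=> H0 HM.
have M0 : (0 < M)%N by exact: leq_trans HM.
have MR : M%:R != 0 :> R[i] by rewrite pnatr_eq0 -lt0n.
have HR : H%:R != 0 :> R[i] by rewrite pnatr_eq0 -lt0n.
apply: (@complexI R).
rewrite rmorphM fmorphV rmorph_nat rmorph_sum rmorph1 /=.
under eq_bigr do rewrite fejerE.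
rewrite exchange_big /=.
under eq_bigr => j _ do rewrite exchange_big /=.
have -> : \sum_(0 <= j < H) \sum_(0 <= l < H) \sum_(0 <= m < M)
     H%:R^-1 * cexp ((j%:R - l%:R) * (t - m%:R / M%:R)) =
   \sum_(0 <= j < H) (M%:R / H%:R : R[i]).
  rewrite big_nat [RHS]big_nat; apply: eq_bigr => j /andP[_ jH].
  rewrite (bigD1_seq j) ?mem_index_iota ?iota_uniq //=.
  under eq_bigr do rewrite subrr mul0r cexp0 mulr1.
  rewrite sumr_const_nat subn0 -[_^-1 *+ M]mulr_natl big1_seq ?addr0 // => l.
  rewrite mem_index_iota => /andP[lj /andP[_ lH]].
  have -> : \sum_(0 <= m < M) H%:R^-1 * cexp ((j%:R - l%:R) * (t - m%:R / M%:R)) =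
    H%:R^-1 * cexp ((j%:R - l%:R) * t) *
    \sum_(0 <= m < M) cexp (m%:R * ((l%:Z - j%:Z)%:~R / M%:R)).
    rewrite mulr_sumr; apply: eq_bigr => m _; rewrite -mulrA -cexpD.
    congr (_ * cexp _); rewrite intrB /intmul; ring.
  rewrite cexp_root_sum ?mulr0 //.
    by rewrite subr_eq0; move: lj; apply: contra => /eqP [->].
  rewrite -intr_norm -[M%:R]/((M%:Z)%:~R) ltr_int.
  by lia.
rewrite sumr_const_nat subn0 -[_ / _ *+ H]mulr_natl; field.
by rewrite MR HR.
Qed.

Lemma distn_lt_norm (j l H' : nat) : (j < H')%N -> (l < H')%N ->
  `|(j%:Z - l%:Z)%:~R| < H'%:R :> R.
Proof.
move=> jH lH; rewrite -intr_norm -[H'%:R]/((H'%:Z)%:~R) ltr_int.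
by lia.
Qed.

End Fejer.

Arguments distn_lt_norm R [j l H'].

(** * Counting in boxes *)

Section Boxes.
Variable R : realType.
Variables (x y : nat -> R) (L K H : nat) (B : R).
Hypotheses (K0 : (0 < K)%N) (H0 : (0 < H)%N).
Hypothesis expsumB : forall a b : int, (a != 0) || (b != 0) ->
  `|a%:~R| < H%:R :> R -> `|b%:~R| < H%:R :> R ->
  cmod (\sum_(0 <= n < L) cexp (a%:~R * x n + b%:~R * y n)) <= B.
Hypothesis B0 : 0 <= B.

Let HR : 0 < H%:R :> R. Proof. by rewrite ltr0n. Qed.
Let KR : 0 < K%:R :> R. Proof. by rewrite ltr0n. Qed.

(** The exponential-sum hypothesis for a single sequence; x and y inherit it from
    the pair by taking the other frequency to be 0. *)
Definition coordinate (z : nat -> R) : Prop := forall a : int, a != 0 ->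
  `|a%:~R| < H%:R :> R -> cmod (\sum_(0 <= n < L) cexp (a%:~R * z n)) <= B.

Lemma coordinate_x : coordinate x.
Proof.
move=> a a0 aH; have := @expsumB a 0; rewrite a0 normr0 HR => /(_ isT aH isT).
by under eq_bigr do rewrite mul0r addr0.
Qed.

Lemma coordinate_y : coordinate y.
Proof.
move=> a a0 aH; have := @expsumB 0 a; rewrite a0 orbT normr0 HR => /(_ isT isT aH).
by under eq_bigr do rewrite mul0r add0r.
Qed.

(** A Fejer kernel of degree h is at least h / 4 on the points counted, and its
    average over the sequence is 1 up to exponential sums. *)
Lemma near_count (z : nat -> R) (h : nat) (c : R) : coordinate z -> (0 < h <= H)%N ->
  \sum_(0 <= n < L) (chord (z n - c) <= h%:R^-1)%R%:R <= 4 * (L%:R / h%:R + B).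
Proof.
move=> zc /andP[h0 hH]; have hR : 0 < h%:R :> R by rewrite ltr0n.
have step : \sum_(0 <= n < L) (chord (z n - c) <= h%:R^-1)%R%:R <=
    4 / h%:R * \sum_(0 <= n < L) fejer h (z n - c).
  rewrite mulr_sumr; apply: ler_sum => n _.
  case: (leP (chord (z n - c))) => hc; last by rewrite mulr_ge0 ?fejer_ge0 // divr_ge0.
  have := fejer_ge h0 hc; rewrite -(ler_pM2l (_ : 0 < 4 / h%:R)) ?divr_gt0 //.
  suff -> : 4 / h%:R * (h%:R / 4) = 1 :> R by [].
  by field; rewrite gt_eqF.
apply: le_trans step _.
suff hs : \sum_(0 <= n < L) fejer h (z n - c) <= L%:R + h%:R * B.
  have -> : 4 * (L%:R / h%:R + B) = 4 / h%:R * (L%:R + h%:R * B).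
    by field; rewrite gt_eqF.
  by rewrite ler_wpM2l // divr_ge0.
have -> : \sum_(0 <= n < L) fejer h (z n - c) =
   cmod (\sum_(0 <= j < h) \sum_(0 <= l < h) h%:R^-1 * cexp ((l%:R - j%:R) * c) *
      \sum_(0 <= n < L) cexp ((j%:Z - l%:Z)%:~R * z n)).
  rewrite -[LHS]ger0_norm ?sumr_ge0 // => [|n _]; last exact: fejer_ge0.
  rewrite -cmod_real rmorph_sum /=; congr cmod.
  under eq_bigr do rewrite fejerE.
  rewrite exchange_big; apply: eq_bigr => j _.
  rewrite exchange_big; apply: eq_bigr => l _.
  rewrite mulr_sumr; apply: eq_bigr => n _.
  rewrite -mulrA -cexpD; congr (_ * cexp _).
  by rewrite intrB /intmul; ring.
apply: le_trans (cmod_sum _ _ _) _.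
have bd j l : (j < h)%N -> (l < h)%N -> cmod (h%:R^-1 * cexp ((l%:R - j%:R) * c) *
      \sum_(0 <= n < L) cexp ((j%:Z - l%:Z)%:~R * z n)) <=
    h%:R^-1 * ((j == l)%:R * L%:R + B).
  move=> jh lh; rewrite !cmodM cmod_cexp mulr1 cmodV cmod_nat ler_pM2l ?invr_gt0 //.
  have [->|jl] := eqVneq j l.
    rewrite subrr mul1r (le_trans (cmod_sum _ _ _)) //.
    under eq_bigr do rewrite cmod_cexp.
    by rewrite sumr_const_nat subn0 lerDl.
  rewrite mul0r add0r; apply: zc.
    by rewrite subr_eq0; move: jl; apply: contra => /eqP[->].
  by rewrite (lt_le_trans (distn_lt_norm R jh lh)) // ler_nat.
apply: (@le_trans _ _ (\sum_(0 <= j < h) (h%:R^-1 * (L%:R + h%:R * B)))).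
  rewrite [leLHS]big_nat [leRHS]big_nat; apply: ler_sum => j /andP[_ jh].
  apply: le_trans (cmod_sum _ _ _) _.
  apply: (@le_trans _ _ (\sum_(0 <= l < h) h%:R^-1 * ((j == l)%:R * L%:R + B))).
    by rewrite [leLHS]big_nat [leRHS]big_nat; apply: ler_sum => l /andP[_ lh]; exact: bd.
  rewrite -mulr_sumr ler_pM2l ?invr_gt0 // big_split /=.
  rewrite sumr_const_nat subn0 -[B *+ _]mulr_natl lerD2r.
  rewrite (bigD1_seq j) ?mem_index_iota ?iota_uniq //= eqxx mul1r.
  by rewrite big1 ?addr0 // => l lj; rewrite eq_sym (negPf lj) mul0r.
by rewrite sumr_const_nat subn0 -[_ *+ h]mulr_natl mulrA divff ?mul1r ?gt_eqF.
Qed.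

(** Dominates min (1, 32 / (H s)); written as a sum of indicators so that its
    average over a sequence reduces to counts of terms near a point. *)
Definition margin (s : R) : R :=
  32 / H%:R + 64 / H%:R * \sum_(1 <= h < H.+1) (s <= h%:R^-1)%R%:R.

Lemma margin_ge0 (s : R) : 0 <= margin s.
Proof. by rewrite addr_ge0 ?mulr_ge0 ?divr_ge0 ?sumr_ge0. Qed.

Lemma margin_count (s : R) (m : nat) : 0 <= s -> (m <= H)%N -> m%:R * s <= 1 ->
  m%:R <= \sum_(1 <= h < H.+1) (s <= h%:R^-1)%R%:R :> R.
Proof.
move=> s0 mH ms.
rewrite (@big_cat_nat _ _ _ m.+1) //= -[leLHS]addr0 lerD ?sumr_ge0 //.
have {1}-> : m%:R = \sum_(1 <= h < m.+1) 1 :> R by rewrite sumr_const_nat subn1.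
rewrite [leLHS]big_nat [leRHS]big_nat; apply: ler_sum => h /andP[h1 hm].
have hR : 0 < h%:R :> R by rewrite ltr0n.
have -> : s <= h%:R^-1; last by [].
rewrite -(ler_pM2l hR) divff ?gt_eqF // (le_trans _ ms) // ler_wpM2r //.
by rewrite ler_nat.
Qed.

Lemma margin_ge64 (s : R) : 0 <= s -> s <= H%:R^-1 -> 64 <= margin s.
Proof.
move=> s0 s1; have := margin_count s0 (leqnn H).
rewrite mulrC -ler_pdivlMr // div1r => /(_ s1) h.
have : 64 / H%:R * H%:R <=
    64 / H%:R * \sum_(1 <= h < H.+1) (s <= h%:R^-1)%R%:R :> R.
  by rewrite ler_wpM2l // divr_ge0.
rewrite mulfVK ?gt_eqF // /margin => h2.
by rewrite (le_trans h2) // lerDr divr_ge0.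
Qed.

Lemma margin_ge (s : R) : 0 < s -> (32 / (H%:R * s) <= margin s) || (64 <= margin s).
Proof.
move=> s0.
have [/(margin_ge64 (ltW s0)) ->|s1] := leP s H%:R^-1; first by rewrite orbT.
apply/orP; left; have [s2|s2] := leP s 1; last first.
  rewrite (@le_trans _ _ (32 / H%:R)) //.
    rewrite ler_pM2l // lef_pV2 ?posrE ?mulr_gt0 // -[leLHS]mulr1 ler_pM2l //.
    exact: ltW.
  by rewrite /margin lerDl mulr_ge0 ?divr_ge0 ?sumr_ge0.
have si : 1 <= s^-1 by rewrite invf_ge1.
pose m := Num.trunc s^-1.
have /andP[m1 m2] := truncn_itv (ltW (lt_le_trans ltr01 si)).
have m0 : (0 < m)%N by rewrite truncn_gt0.
have mH : (m <= H)%N.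
  rewrite -(ler_nat R) (le_trans m1) // -[H%:R]invrK lef_pV2 ?posrE ?invr_gt0 //.
  exact: ltW.
have := margin_count (ltW s0) mH; rewrite -ler_pdivlMr // div1r => /(_ m1) h.
rewrite /margin.
have h2 : s^-1 / 2 <= m%:R.
  have : 1 <= m%:R :> R by rewrite ler1n.
  by move: m2; rewrite -/m -natr1; lra.
have : 64 / H%:R * (s^-1 / 2) <= 64 / H%:R * \sum_(1 <= h < H.+1) (s <= h%:R^-1)%R%:R.
  by rewrite ler_wpM2l ?divr_ge0 // (le_trans h2).
have -> : 64 / H%:R * (s^-1 / 2) = 32 / (H%:R * s).
  by field; rewrite !gt_eqF.
by move/le_trans; apply; rewrite lerDr divr_ge0.
Qed.

Lemma margin_ge1 (s : R) : 0 <= s -> s <= 32 / H%:R -> 1 <= margin s.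
Proof.
move=> s0 s1; have [/(margin_ge64 s0)|s2] := leP s H%:R^-1.
  by apply: le_trans; rewrite ler1n.
have sp : 0 < s by rewrite (lt_trans _ s2) // invr_gt0.
have /orP[|] := margin_ge sp; last by apply: le_trans; rewrite ler1n.
apply: le_trans; rewrite ler_pdivlMr ?mulr_gt0 // mul1r mulrC -ler_pdivlMr //.
Qed.

Lemma margin_sum (z : nat -> R) (c : R) : coordinate z ->
  \sum_(0 <= n < L) margin (chord (z n - c)) <=
  288 * (L%:R * (1 + ln H%:R) / H%:R + B).
Proof.
move=> zc; rewrite big_split /= sumr_const_nat subn0 -mulr_sumr exchange_big /=.
have h1 : \sum_(1 <= h < H.+1) \sum_(0 <= n < L) (chord (z n - c) <= h%:R^-1)%R%:R
   <= 4 * (L%:R * (1 + ln H%:R) + H%:R * B).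
  apply: (@le_trans _ _ (\sum_(1 <= h < H.+1) (4 * (L%:R / h%:R + B)))).
    rewrite [leLHS]big_nat [leRHS]big_nat; apply: ler_sum => h /andP[h1 h2].
    by apply: near_count => //; rewrite h1 -ltnS.
  rewrite -mulr_sumr ler_pM2l // big_split /= sumr_const_nat subn1 -[B *+ _]mulr_natl.
  by rewrite lerD2r -mulr_sumr ler_wpM2l // harmonic_le.
have lnH := ln_nat_ge0 R H.
have h2 := ler_wpM2l (_ : 0 <= 64 / H%:R) h1.
apply: le_trans (lerD (lexx _) (h2 _)) _; first by rewrite divr_ge0.
have -> : 32 / H%:R *+ L = 32 * (L%:R / H%:R) :> R.
  by rewrite -[LHS]mulr_natr; ring.
have -> : 64 / H%:R * (4 * (L%:R * (1 + ln H%:R) + H%:R * B)) =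
   256 * (L%:R * (1 + ln H%:R) / H%:R + B) by field; rewrite gt_eqF.
have : L%:R / H%:R <= L%:R * (1 + ln H%:R) / H%:R :> R.
  by rewrite ler_wpM2r ?invr_ge0 // -[leLHS]mulr1 ler_wpM2l // lerDl.
by move: B0; lra.
Qed.

End Boxes.

(** * Smoothed intervals *)

Section SmoothBoxes.
Variable R : realType.
Variables (K H : nat).
Hypotheses (K0 : (0 < K)%N) (H0 : (0 < H)%N).

Let HR : 0 < H%:R :> R. Proof. by rewrite ltr0n. Qed.
Let KR : 0 < K%:R :> R. Proof. by rewrite ltr0n. Qed.

Local Notation M := (K * H.*2)%N.

Let M0 : (0 < M)%N. Proof. by rewrite muln_gt0 K0 double_gt0. Qed.
Let MR : 0 < M%:R :> R. Proof. by rewrite ltr0n. Qed.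

(** Smooth version of the indicator of [c / K, (c + 1) / K) modulo 1: the
    Fejer kernel averaged over the points of a grid lying in that interval.
    With a grid finer than the degree of the kernel the average behaves exactly
    like a convolution, so no integral is needed. *)
Definition box (c : nat) (t : R) : R :=
  M%:R^-1 * \sum_(c * H.*2 <= m < c.+1 * H.*2) fejer H (t - m%:R / M%:R).

Lemma box_ge0 c t : 0 <= box c t.
Proof. by rewrite mulr_ge0 ?invr_ge0 ?sumr_ge0 // => m _; exact: fejer_ge0. Qed.

Lemma boxDint c t (z : int) : box c (t + z%:~R) = box c t.
Proof.
rewrite /box; congr (_ * _); apply: eq_bigr => m _.
by rewrite addrAC fejerDint.
Qed.

Lemma sum_blocks (F : nat -> R) (k N : nat) :
  \sum_(0 <= c < k) \sum_(c * N <= m < c.+1 * N) F m = \sum_(0 <= m < k * N) F m.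
Proof.
elim: k => [|k IH]; first by rewrite mul0n !big_geq.
by rewrite big_nat_recr //= IH -big_cat_nat // leq_mul2r leqnSn orbT.
Qed.

(** On each of the two arcs outside an interval the distances to its endpoints
    grow along the arc, one from the left end and the other from the right. *)
Lemma sum_two_sided (u v : nat -> R) (p q : nat) :
  \sum_(p <= m < q) (u (m - p)%N + v (q.-1 - m)%N) =
  \sum_(0 <= i < q - p) u i + \sum_(0 <= i < q - p) v i.
Proof.
rewrite big_split /=; congr (_ + _).
  rewrite -{1}(add0n p) big_addn.
  by under eq_bigr do rewrite addnK.
rewrite big_nat_rev /= -{1}(add0n p) big_addn [LHS]big_nat [RHS]big_nat.
by apply: eq_bigr => i /andP[_ ih]; congr v; lia.
Qed.

Lemma box_sum t : \sum_(0 <= c < K) box c t = 1.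
Proof.
rewrite -mulr_sumr sum_blocks fejer_mean //.
by rewrite -mul2n mulnA -[leqLHS]mul1n leq_mul2r muln_gt0 K0 orbT.
Qed.

(** Comparison with a telescoping sum; d >= 1 / M keeps consecutive terms within
    a factor 2 of each other. *)
Lemma inv_sqr_sum (d : R) (n : nat) : M%:R^-1 <= d ->
  \sum_(0 <= i < n) (d + i%:R / M%:R) ^- 2 <= 2 * M%:R / d.
Proof.
move=> dM; set e := M%:R^-1 in dM *.
have e0 : 0 < e by rewrite invr_gt0.
have d0 : 0 < d by exact: lt_le_trans dM.
have pos i : 0 < d + i%:R * e by rewrite ltr_pwDl // mulr_ge0 // ltW.
suff h : \sum_(0 <= i < n) (d + i%:R * e) ^- 2 <= 2 / e * (d^-1 - (d + n%:R * e)^-1).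
  by rewrite (le_trans h) // /e invrK ler_wpM2l ?mulr_ge0 // gerBl invr_ge0 ltW.
elim: n => [|n IH]; first by rewrite big_geq // mul0r addr0 subrr mulr0.
rewrite big_nat_recr //=.
have p1 := pos n; have p2 := pos n.+1.
have E : d + n.+1%:R * e = d + n%:R * e + e by rewrite -natr1 mulrDl mul1r addrA.
rewrite E in p2 *.
have ue : e <= d + n%:R * e by rewrite (le_trans dM) // lerDl mulr_ge0 // ltW.
move: IH p1 p2 ue; set u := d + n%:R * e; set S := \sum_(0 <= i < n) _.
move=> IH p1 p2 ue.
have st : u ^- 2 <= 2 / e * (u^-1 - (u + e)^-1).
  have -> : 2 / e * (u^-1 - (u + e)^-1) = 2 / (u * (u + e)).
    by field; rewrite !gt_eqF.
  rewrite ler_pdivlMr ?mulr_gt0 // expr2 mulrC ler_pdivrMr ?mulr_gt0 //.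
  by rewrite mulrCA ler_pM2l //; lra.
by have := lerD IH st; rewrite -mulrDr addrA subrK.
Qed.

Lemma fejer_far (s e1 e2 : R) : 0 < e1 -> e1 <= `|s| -> 0 < e2 -> e2 <= 1 - `|s| ->
  fejer H s <= H%:R^-1 * (e1 ^- 2 + e2 ^- 2).
Proof.
move=> e10 h1 e20 h2.
have s1 : `|s| <= 1 by lra.
have mpos : 0 < Num.min `|s| (1 - `|s|).
  by rewrite lt_min (lt_le_trans e10 h1) (lt_le_trans e20 h2).
have cge := chord_ge s1.
have c0 : 0 < chord s by rewrite (lt_le_trans _ cge) // mulr_gt0.
rewrite (le_trans (fejer_le H c0)) // invfM mulrCA ler_pM2l ?invr_gt0 //.
have : 4 / chord s ^+ 2 <= Num.min `|s| (1 - `|s|) ^- 2.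
  rewrite ler_pdivrMr ?exprn_gt0 // mulrC ler_pdivlMr ?exprn_gt0 //.
  have -> : (4 : R) = 2 ^+ 2 by rewrite expr2; ring.
  by rewrite -exprMn lerXn2r ?nnegrE ?chord_ge0 // mulr_ge0 // ltW.
move=> /le_trans; apply.
have anti (u e : R) : 0 < e -> e <= u -> u ^- 2 <= e ^- 2.
  move=> e0 eu; have u0 := lt_le_trans e0 eu.
  by rewrite lef_pV2 ?posrE ?exprn_gt0 // lerXn2r ?nnegrE // ltW.
have := anti _ _ e10 h1; have := anti _ _ e20 h2.
have : 0 <= e1 ^- 2 by rewrite invr_ge0 exprn_ge0 // ltW.
have : 0 <= e2 ^- 2 by rewrite invr_ge0 exprn_ge0 // ltW.
rewrite minEle; case: ifP => _; lra.
Qed.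

(** The mass of the kernel at distance at least d is O(1 / (H d)); points too
    close to an endpoint are absorbed by the margin. *)
Lemma box_tail (c : nat) (v : R) : (c < K)%N -> 0 <= v < 1 ->
  1 - box c ((c%:R + v) / K%:R) <=
    margin H (chord (v / K%:R)) + margin H (chord ((1 - v) / K%:R)).
Proof.
move=> cK /andP[v0 v1].
set d1 := v / K%:R; set d2 := (1 - v) / K%:R; set t := (c%:R + v) / K%:R.
have m1 := margin_ge0 H (chord d1); have m2 := margin_ge0 H (chord d2).
have b0 := box_ge0 c t.
have d10 : 0 <= d1 by rewrite divr_ge0.
have d20 : 0 < d2 by rewrite divr_gt0 // subr_gt0.
have MH : M%:R^-1 <= 1 / 2 / H%:R :> R.
  have -> : 1 / 2 / H%:R = (2 * H%:R)^-1 :> R by field; rewrite gt_eqF.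
  by rewrite lef_pV2 ?posrE ?mulr_gt0 // -natrM mul2n ler_nat leq_pmull.
have small (d : R) : 0 <= d -> d < M%:R^-1 -> 1 <= margin H (chord d).
  move=> dd dM; apply: margin_ge1; rewrite ?chord_ge0 //.
  have ch : chord d <= 8 * d.
    by have := cmod_cexp_sub1_le d; rewrite ger0_norm.
  have ch2 : chord d <= 8 * (1 / 2 / H%:R).
    by rewrite (le_trans ch) // ler_pM2l // (le_trans (ltW dM)).
  by rewrite (le_trans ch2) // mulrA ler_wpM2r ?invr_ge0 //; lra.
have [dM1|dM1] := ltP d1 M%:R^-1; first by have := small _ d10 dM1; lra.
have [dM2|dM2] := ltP d2 M%:R^-1; first by have := small _ (ltW d20) dM2; lra.
have {}d10 : 0 < d1 by rewrite (lt_le_trans _ dM1) // invr_gt0.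
have K1 : K%:R^-1 <= 1 :> R by rewrite invf_le1 // ler1n.
have dsum : d1 + d2 = K%:R^-1 by rewrite /d1 /d2; field; rewrite gt_eqF.
have far (d : R) : 0 < d -> d < 1 -> (4 / (H%:R * d) <= margin H (chord d)) ||
    (1 <= margin H (chord d)).
  move=> dp dlt.
  have ch0 : 0 < chord d.
    have := @chord_ge _ d; rewrite gtr0_norm // => /(_ (ltW dlt)).
    by apply: lt_le_trans; rewrite mulr_gt0 // lt_min dp subr_gt0.
  have ch8 : chord d <= 8 * d.
    by have := cmod_cexp_sub1_le d; rewrite gtr0_norm.
  have /orP[h|h] := margin_ge H0 ch0; apply/orP; [left|right]; last by lra.
  apply: le_trans h.
  have -> : 4 / (H%:R * d) = 32 / (H%:R * (8 * d)) by field; rewrite !gt_eqF.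
  by rewrite ler_pM2l // lef_pV2 ?posrE ?mulr_gt0 // ler_pM2l.
have d1lt : d1 < 1 by lra.
have d2lt : d2 < 1 by lra.
have /orP[f1|f1] := far d1 d10 d1lt; last by lra.
have /orP[f2|f2] := far d2 d20 d2lt; last by lra.
pose ga (d : R) (i : nat) := (d + i%:R / M%:R) ^- 2.
have piece (p q : nat) (F : nat -> R) : (forall m, (p <= m < q)%N ->
      F m <= H%:R^-1 * (ga d2 (m - p)%N + ga d1 (q.-1 - m)%N)) ->
    \sum_(p <= m < q) F m <= H%:R^-1 * (2 * M%:R / d2 + 2 * M%:R / d1).
  move=> hF.
  apply: (@le_trans _ _ (\sum_(p <= m < q)
      H%:R^-1 * (ga d2 (m - p)%N + ga d1 (q.-1 - m)%N))).
    by rewrite [leLHS]big_nat [leRHS]big_nat; apply: ler_sum.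
  by rewrite -mulr_sumr ler_pM2l ?invr_gt0 // sum_two_sided lerD // inv_sqr_sum.
have gapos (d : R) (i : nat) : 0 < d -> 0 < d + i%:R / M%:R.
  by move=> dp; rewrite ltr_pwDl // divr_ge0.
have Mq (a : nat) : (a * H.*2)%:R / M%:R = a%:R / K%:R :> R.
  rewrite !natrM; field; rewrite gt_eqF //= gt_eqF // ltr0n double_gt0 //.
have left_piece : \sum_(0 <= m < c * H.*2) fejer H (t - m%:R / M%:R) <=
    H%:R^-1 * (2 * M%:R / d2 + 2 * M%:R / d1).
  apply: piece => m /andP[_ mc]; rewrite /ga subn0 [X in _ <= _ * X]addrC.
  have E : t - m%:R / M%:R = d1 + (c * H.*2 - m)%:R / M%:R.
    by rewrite natrB ?(ltnW mc) // mulrBl Mq /t /d1 mulrDl addrCA addrA.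
  have spos : 0 <= t - m%:R / M%:R by rewrite E ltW ?gapos.
  apply: fejer_far; rewrite ?gapos // ger0_norm //.
    by rewrite E lerD2l ler_wpM2r ?invr_ge0 // ler_nat leq_sub2r // leq_pred.
  have : c.+1%:R / K%:R <= 1 :> R by rewrite ler_pdivrMr // mul1r ler_nat.
  have -> : c.+1%:R / K%:R = t + d2.
    by rewrite /t /d2 -natr1; field; rewrite gt_eqF.
  by lra.
have right_piece : \sum_(c.+1 * H.*2 <= m < M) fejer H (t - m%:R / M%:R) <=
    H%:R^-1 * (2 * M%:R / d2 + 2 * M%:R / d1).
  apply: piece => m /andP[cm mM]; rewrite /ga.
  have E : t - m%:R / M%:R = - (d2 + (m - c.+1 * H.*2)%:R / M%:R).
    rewrite natrB // mulrBl Mq -natr1 /t /d2; field.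
    by rewrite !pnatr_eq0 -!lt0n K0 double_gt0.
  have En : `|t - m%:R / M%:R| = d2 + (m - c.+1 * H.*2)%:R / M%:R.
    by rewrite E normrN ger0_norm // ltW ?gapos.
  apply: fejer_far; rewrite ?gapos // En //.
  have -> : 1 - (d2 + (m - c.+1 * H.*2)%:R / M%:R) = 1 + (t - m%:R / M%:R).
    by rewrite E opprD.
  have -> : (M.-1 - m)%:R / M%:R = 1 - m%:R / M%:R - M%:R^-1 :> R.
    rewrite -predn_sub -subnS.
    by rewrite natrB // mulrBl divff ?gt_eqF // -natr1 mulrDl mul1r opprD addrA.
  have : d1 <= t by rewrite /d1 /t ler_wpM2r ?invr_ge0 // lerDr.
  have : 0 < M%:R^-1 :> R by rewrite invr_gt0.
  by lra.
have E1 : 1 = M%:R^-1 * \sum_(0 <= m < M) fejer H (t - m%:R / M%:R).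
  rewrite fejer_mean // -mul2n mulnA -[leqLHS]mul1n leq_mul2r muln_gt0 K0 orbT //.
rewrite {1}E1 (@big_cat_nat _ _ _ (c * H.*2)%N) //=; last first.
  by rewrite leq_mul2r (ltnW cK) orbT.
rewrite [\sum_(c * H.*2 <= i < M) _](@big_cat_nat _ _ _ (c.+1 * H.*2)%N) //=; last 2 first.
- by rewrite leq_mul2r leqnSn orbT.
- by rewrite leq_mul2r cK orbT.
rewrite !mulrDr /box.
have := ler_wpM2l (_ : 0 <= M%:R^-1) left_piece.
have := ler_wpM2l (_ : 0 <= M%:R^-1) right_piece.
rewrite invr_ge0 ler0n => /(_ isT) h1 /(_ isT) h2.
have E2 : M%:R^-1 * (H%:R^-1 * (2 * M%:R / d2 + 2 * M%:R / d1)) =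
    (4 / (H%:R * d1) + 4 / (H%:R * d2)) / 2.
  by field; rewrite !gt_eqF // ltr0n double_gt0.
move: h1 h2; rewrite E2; lra.
Qed.

End SmoothBoxes.

(** * Equidistribution in boxes *)

Section Equidistribution.
Variable R : realType.
Variables (x y : nat -> R) (L K H : nat) (B : R).
Hypotheses (K0 : (0 < K)%N) (H0 : (0 < H)%N).
Hypothesis expsumB : forall a b : int, (a != 0) || (b != 0) ->
  `|a%:~R| < H%:R :> R -> `|b%:~R| < H%:R :> R ->
  cmod (\sum_(0 <= n < L) cexp (a%:~R * x n + b%:~R * y n)) <= B.
Hypothesis B0 : 0 <= B.

Let HR : 0 < H%:R :> R. Proof. by rewrite ltr0n. Qed.
Let KR : 0 < K%:R :> R. Proof. by rewrite ltr0n. Qed.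

Local Notation M := (K * H.*2)%N.

Let MR : 0 < M%:R :> R. Proof. by rewrite ltr0n muln_gt0 K0 double_gt0. Qed.

(** Coefficients of [box] in the expansion indexed by pairs (j, l) with j, l < H,
    the pair standing for the frequency j - l; the Fejer weights
    1 - |j - l| / H arise from the number of pairs with a given difference. *)
Definition weight (c j l : nat) : R[i] :=
  M%:R^-1 * \sum_(c * H.*2 <= m < c.+1 * H.*2)
     (H%:R^-1 * cexp (m%:R * ((l%:R - j%:R) / M%:R) : R)).

Lemma boxE c (t : R) : (box K H c t)%:C%C =
  \sum_(0 <= j < H) \sum_(0 <= l < H) weight c j l * cexp ((j%:Z - l%:Z)%:~R * t).
Proof.
rewrite /box rmorphM fmorphV rmorph_nat rmorph_sum /=.
under eq_bigr do rewrite fejerE.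
rewrite exchange_big mulr_sumr; apply: eq_bigr => j _.
rewrite exchange_big mulr_sumr; apply: eq_bigr => l _.
rewrite /weight -mulrA; congr (_ * _); rewrite mulr_suml; apply: eq_bigr => m _.
rewrite -mulrA -cexpD; congr (_ * cexp _).
by rewrite intrB /intmul; ring.
Qed.

Lemma weight_diag c j : weight c j j = (K%:R * H%:R)^-1.
Proof.
rewrite /weight subrr mul0r.
under eq_bigr do rewrite mulr0 cexp0 mulr1.
rewrite sumr_const_nat -mulnBl subSnn mul1n -[_ *+ _]mulr_natl.
have k0 : K%:R != 0 :> R[i] by rewrite pnatr_eq0 -lt0n.
have h0 : H%:R != 0 :> R[i] by rewrite pnatr_eq0 -lt0n.
have d0 : H.*2%:R != 0 :> R[i] by rewrite pnatr_eq0 -lt0n double_gt0.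
by rewrite natrM; field; rewrite k0 h0 d0.
Qed.

Definition decay (s : nat) : R := if s is 0%N then 1 else s%:R^-1.

(** A geometric sum over a block of the grid, with ratio e((l - j) / M); the
    condition H <= M / 2 keeps the ratio away from 1. *)
Lemma weight_le c j l : (j < H)%N -> (l < H)%N ->
  cmod (weight c j l) <= H%:R^-1 * decay ((j - l) + (l - j))%N.
Proof.
move=> jH lH; have [<-|jl] := eqVneq j l.
  rewrite weight_diag subnn cmodV cmodM !cmod_nat invfM mulrC /decay.
  by rewrite ler_pM2l ?invr_gt0 // invf_le1 // ler1n.
have [s1 sE] : exists s, (j - l + (l - j) = s.+1)%N.
  by exists (j - l + (l - j)).-1; rewrite prednK //; lia.
rewrite sE /decay -sE.
set d := (j - l + (l - j))%N in sE *.
have d0 : (0 < d)%N by rewrite sE.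
have dE : d%:R = `|l%:R - j%:R| :> R.
  have [lj|lj] := leqP l j.
    rewrite distrC ger0_norm ?subr_ge0 ?ler_nat // -natrB //; congr (_%:R).
    by rewrite /d; lia.
  rewrite ger0_norm ?subr_ge0 ?ler_nat ?(ltnW lj) // -natrB ?(ltnW lj) //.
  by congr (_%:R); rewrite /d; lia.
have dR : 0 < d%:R :> R by rewrite ltr0n.
pose t : R := (l%:R - j%:R) / M%:R.
have tE : `|t| = d%:R / M%:R by rewrite normrM normfV -dE (ger0_norm (ltW MR)).
have dM : (d * 2 <= M)%N.
  apply: (@leq_trans (H * 2)); first by rewrite leq_mul2r orbC /d; lia.
  by rewrite muln2 leq_pmull.
have t2 : `|t| <= 1 / 2.
  rewrite tE ler_pdivrMr // mulrAC mul1r ler_pdivlMr //.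
  by rewrite -natrM ler_nat.
have t0 : 0 < `|t| by rewrite tE divr_gt0.
have ch : 2 * `|t| <= chord t.
  apply: le_trans (chord_ge _); last by rewrite (le_trans t2) //; lra.
  by rewrite ler_pM2l // le_min lexx /=; lra.
have := geometric_block t (c * H.*2) (c.+1 * H.*2).
rewrite /weight -mulr_sumr !cmodM !cmodV !cmod_nat -/t.
set S := cmod _ => hS.
have hS2 : S <= M%:R / d%:R.
  have : S * (2 * `|t|) <= 2 by rewrite (le_trans _ hS) // ler_wpM2l // cmod_ge0.
  rewrite mulrCA -[leRHS]mulr1 ler_pM2l // tE -ler_pdivlMr ?divr_gt0 //.
  by rewrite div1r invf_div.
rewrite mulrCA ler_pM2l ?invr_gt0 // mulrC ler_pdivrMr //.
by rewrite mulrC.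
Qed.

Lemma weight_sum c : \sum_(0 <= j < H) \sum_(0 <= l < H) cmod (weight c j l) <=
  3 * (1 + ln H%:R).
Proof.
have lnH := ln_nat_ge0 R H.
apply: (@le_trans _ _ (H%:R^-1 * \sum_(0 <= j < H) \sum_(0 <= l < H)
    decay ((j - l) + (l - j))%N)).
  rewrite mulr_sumr [leLHS]big_nat [leRHS]big_nat; apply: ler_sum => j /andP[_ jH].
  rewrite mulr_sumr [leLHS]big_nat [leRHS]big_nat; apply: ler_sum => l /andP[_ lH].
  exact: weight_le.
have dg s : 0 <= decay s by case: s => [|s] //=; rewrite invr_ge0.
rewrite ler_pdivrMl // (le_trans (sum_distn H dg)) // ler_pM2l //=.
have -> : \sum_(1 <= s < H) decay s = \sum_(1 <= s < H) s%:R^-1.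
  by rewrite big_nat [RHS]big_nat; apply: eq_bigr; case.
have : \sum_(1 <= s < H) s%:R^-1 <= 1 + ln H%:R :> R.
  rewrite (le_trans _ (harmonic_le R H)) //.
  by apply: sum_nat_widen => // s; rewrite invr_ge0.
by lra.
Qed.

(** The pair of zero frequencies gives the main term, every other term carries
    an exponential sum, and the coefficients have total mass O(log H). *)
Lemma box_correlation c :
  `|\sum_(0 <= n < L) box K H c (x n) * box K H c (y n) - L%:R / K%:R ^+ 2| <=
    9 * (1 + ln H%:R) ^+ 2 * B.
Proof.
have lnH := ln_nat_ge0 R H.
pose S (j l j' l' : nat) := \sum_(0 <= n < L)
  cexp ((j%:Z - l%:Z)%:~R * x n + (j'%:Z - l'%:Z)%:~R * y n).
pose D (j l j' l' : nat) : R[i] := ((j == l) && (j' == l'))%:R * L%:R.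
have E1 : (\sum_(0 <= n < L) box K H c (x n) * box K H c (y n))%:C%C =
    \sum_(0 <= j < H) \sum_(0 <= l < H) \sum_(0 <= j' < H) \sum_(0 <= l' < H)
      weight c j l * weight c j' l' * S j l j' l'.
  have pt n : (box K H c (x n) * box K H c (y n))%:C%C =
      \sum_(0 <= j < H) \sum_(0 <= l < H) \sum_(0 <= j' < H) \sum_(0 <= l' < H)
        weight c j l * weight c j' l' *
        cexp ((j%:Z - l%:Z)%:~R * x n + (j'%:Z - l'%:Z)%:~R * y n).
    rewrite rmorphM /= !boxE mulr_suml; apply: eq_bigr => j _.
    rewrite mulr_suml; apply: eq_bigr => l _.
    rewrite mulr_sumr; apply: eq_bigr => j' _.
    rewrite mulr_sumr; apply: eq_bigr => l' _.
    by rewrite cexpD; ring.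
  rewrite rmorph_sum /= (eq_bigr _ (fun n _ => pt n)).
  rewrite exchange_big; apply: eq_bigr => j _.
  rewrite exchange_big; apply: eq_bigr => l _.
  rewrite exchange_big; apply: eq_bigr => j' _.
  rewrite exchange_big; apply: eq_bigr => l' _.
  by rewrite /S mulr_sumr.
have E2 : (L%:R / K%:R ^+ 2 : R)%:C%C =
    \sum_(0 <= j < H) \sum_(0 <= l < H) \sum_(0 <= j' < H) \sum_(0 <= l' < H)
      weight c j l * weight c j' l' * D j l j' l'.
  have k0 : K%:R != 0 :> R[i] by rewrite pnatr_eq0 -lt0n.
  have h0 : H%:R != 0 :> R[i] by rewrite pnatr_eq0 -lt0n.
  have diag (F : nat -> nat -> R[i]) :
      (forall j l, j != l -> F j l = 0) ->
      \sum_(0 <= j < H) \sum_(0 <= l < H) F j l = \sum_(0 <= j < H) F j j.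
    move=> F0; rewrite big_nat [RHS]big_nat; apply: eq_bigr => j /andP[_ jH].
    rewrite (bigD1_seq j) ?mem_index_iota ?iota_uniq //=.
    by rewrite big1 ?addr0 // => l lj; rewrite F0 // eq_sym.
  rewrite diag; last first.
    move=> j l jl; rewrite big1 // => j' _; rewrite big1 // => l' _.
    by rewrite /D (negPf jl) mul0r mulr0.
  rewrite (eq_bigr (fun=> (K%:R * H%:R)^-1 * (K%:R * H%:R)^-1 * L%:R *+ H)); last first.
    move=> j _; rewrite diag; last first.
      by move=> j' l' jl; rewrite /D (negPf jl) andbF mul0r mulr0.
    rewrite (eq_bigr (fun=> (K%:R * H%:R)^-1 * (K%:R * H%:R)^-1 * L%:R)).
      by rewrite sumr_const_nat subn0.
    by move=> j' _; rewrite !weight_diag /D !eqxx mul1r.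
  rewrite sumr_const_nat subn0 -[_ *+ H *+ H]mulr_natl -[_ *+ H]mulr_natl.
  rewrite rmorphM fmorphV rmorphXn !rmorph_nat /=.
  by field; rewrite k0 h0.
have SD j l j' l' : (j < H)%N -> (l < H)%N -> (j' < H)%N -> (l' < H)%N ->
    cmod (S j l j' l' - D j l j' l') <= B.
  move=> jH lH jH' lH'; rewrite /S /D.
  have [/andP[/eqP<- /eqP<-]|ne] := boolP (_ && _).
    under eq_bigr do rewrite !subrr !mul0r addr0 cexp0.
    by rewrite sumr_const_nat subn0 mul1r subrr cmod0.
  rewrite mul0r subr0; have dj := distn_lt_norm R jH lH; have dj' := distn_lt_norm R jH' lH'.
  apply: expsumB => //.
  by case/nandP: ne => ne; apply/orP; [left|right]; rewrite subr_eq0 eqz_nat.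
rewrite -cmod_real rmorphB /= E1 E2 -sumrB.
apply: (@le_trans _ _ (\sum_(0 <= j < H) \sum_(0 <= l < H) \sum_(0 <= j' < H)
   \sum_(0 <= l' < H) cmod (weight c j l) * cmod (weight c j' l') * B)).
  apply: le_trans (cmod_sum _ _ _) _.
  rewrite [leLHS]big_nat [leRHS]big_nat; apply: ler_sum => j /andP[_ jH].
  rewrite -sumrB; apply: le_trans (cmod_sum _ _ _) _.
  rewrite [leLHS]big_nat [leRHS]big_nat; apply: ler_sum => l /andP[_ lH].
  rewrite -sumrB; apply: le_trans (cmod_sum _ _ _) _.
  rewrite [leLHS]big_nat [leRHS]big_nat; apply: ler_sum => j' /andP[_ jH'].
  rewrite -sumrB; apply: le_trans (cmod_sum _ _ _) _.
  rewrite [leLHS]big_nat [leRHS]big_nat; apply: ler_sum => l' /andP[_ lH'].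
  rewrite -mulrBr !cmodM ler_wpM2l ?mulr_ge0 ?cmod_ge0 //.
  exact: SD.
set W := \sum_(0 <= j < H) \sum_(0 <= l < H) cmod (weight c j l).
have -> : \sum_(0 <= j < H) \sum_(0 <= l < H) \sum_(0 <= j' < H)
   \sum_(0 <= l' < H) cmod (weight c j l) * cmod (weight c j' l') * B = W * W * B.
  rewrite {1}/W !mulr_suml; apply: eq_bigr => j _.
  rewrite !mulr_suml; apply: eq_bigr => l _.
  rewrite /W mulr_sumr mulr_suml; apply: eq_bigr => j' _.
  by rewrite mulr_sumr mulr_suml.
have W0 : 0 <= W by rewrite !sumr_ge0 // => j _; rewrite sumr_ge0 // => l _; exact: cmod_ge0.
have WL : W <= 3 * (1 + ln H%:R) by exact: weight_sum.
have -> : 9 * (1 + ln H%:R) ^+ 2 * B = 3 * (1 + ln H%:R) * (3 * (1 + ln H%:R)) * B :> R.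
  by ring.
by rewrite ler_wpM2r //; apply: ler_pM.
Qed.

(** Index c of the interval [c / K, (c + 1) / K) containing t modulo 1. *)
Definition cell (t : R) : nat := `|(Num.floor (K%:R * t)%R %% K)%Z|%N.

Lemma cell_lt t : (cell t < K)%N.
Proof.
rewrite -ltz_nat /cell gez0_abs ?modz_ge0 ?ltz_mod //.
  by rewrite -lt0n.
by rewrite eqz_nat -lt0n.
Qed.

Lemma cellP t : exists z : int, exists2 v : R, 0 <= v < 1 &
  t = (((cell t)%:R + v) / K%:R) + z%:~R.
Proof.
pose f := Num.floor (K%:R * t).
have kz : K%:Z != 0 by rewrite eqz_nat -lt0n.
exists (f %/ K)%Z; exists (K%:R * t - f%:~R).
  have := floor_itv (K%:R * t); rewrite -/f intrD mulr1z => /andP[h1 h2].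
  by rewrite subr_ge0 h1 ltrBlDl h2.
have e : f%:~R = (f %/ K)%Z%:~R * K%:R + (cell t)%:R :> R.
  rewrite {1}(divz_eq f K) intrD intrM; congr (_ + _).
  rewrite /cell -/f -[RHS]/(((`|(f %% K)%Z|%N)%:Z)%:~R) gez0_abs //.
  exact: modz_ge0.
rewrite e; field.
by rewrite gt_eqF.
Qed.

(** The loss at each point is at most the margin at the two endpoints of its
    interval; summing over all endpoints makes the bound independent of which
    interval that is. *)
Lemma box_defect (z : nat -> R) : coordinate L H B z ->
  \sum_(0 <= n < L) (1 - box K H (cell (z n)) (z n)) <=
  576 * K.+1%:R * (L%:R * (1 + ln H%:R) / H%:R + B).
Proof.
move=> zc.
have pt n : 1 - box K H (cell (z n)) (z n) <=
    2 * \sum_(0 <= c < K.+1) margin H (chord (z n - c%:R / K%:R)).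
  have cK := cell_lt (z n).
  have [w [v v01 e]] := cellP (z n).
  set c := cell (z n) in cK e *.
  have := box_tail K0 H0 cK v01; rewrite -(boxDint _ _ _ _ w) -e.
  have -> : chord (v / K%:R) = chord (z n - c%:R / K%:R).
    by rewrite -(chordDint _ w); congr chord; rewrite [in RHS]e mulrDl; ring.
  have -> : chord ((1 - v) / K%:R) = chord (z n - c.+1%:R / K%:R).
    rewrite -chordN -(chordDint _ w); congr chord; rewrite [in RHS]e -natr1 !mulrDl.
    by ring.
  have term (d : nat) : (d < K.+1)%N -> margin H (chord (z n - d%:R / K%:R)) <=
      \sum_(0 <= c < K.+1) margin H (chord (z n - c%:R / K%:R)).
    move=> dK; rewrite (bigD1_seq d) ?mem_index_iota ?iota_uniq //= lerDl.
    by rewrite sumr_ge0 // => i _; exact: margin_ge0.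
  have := term c (leqW cK); have := term c.+1 cK; lra.
apply: (@le_trans _ _ (\sum_(0 <= n < L)
   2 * \sum_(0 <= c < K.+1) margin H (chord (z n - c%:R / K%:R)))).
  by apply: ler_sum => n _; exact: pt.
rewrite -mulr_sumr exchange_big /=.
apply: (@le_trans _ _ (2 * \sum_(0 <= c < K.+1)
   (288 * (L%:R * (1 + ln H%:R) / H%:R + B)))).
  rewrite ler_pM2l //; apply: ler_sum => c _.
  exact: (margin_sum H0).
rewrite sumr_const_nat subn0 -[_ *+ K.+1]mulr_natl.
by rewrite le_eqVlt; apply/orP; left; apply/eqP; ring.
Qed.

(** A product p_c q_c with (c, c) different from (i, j) involves mass of p outside
    i or mass of q outside j. *)
Lemma indicator_dot (p q : nat -> R) (i j : nat) : (i < K)%N -> (j < K)%N ->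
  (forall c, 0 <= p c) -> (forall c, 0 <= q c) ->
  \sum_(0 <= c < K) p c = 1 -> \sum_(0 <= c < K) q c = 1 ->
  `|(i == j)%:R - \sum_(0 <= c < K) p c * q c| <= (1 - p i) + (1 - q j).
Proof.
move=> iK jK p0 q0 p1 q1.
have le1 (r : nat -> R) c : (forall c, 0 <= r c) -> \sum_(0 <= c < K) r c = 1 ->
    (c < K)%N -> r c <= 1.
  move=> r0 <- cK; rewrite (bigD1_seq c) ?mem_index_iota ?iota_uniq //= lerDl.
  by rewrite sumr_ge0.
have pi := le1 p i p0 p1 iK; have qj := le1 q j q0 q1 jK.
have s0 : 0 <= \sum_(0 <= c < K) p c * q c by rewrite sumr_ge0 // => c _; rewrite mulr_ge0.
have s1 : \sum_(0 <= c < K) p c * q c <= 1.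
  rewrite -p1 [leLHS]big_nat [leRHS]big_nat; apply: ler_sum => c /andP[_ cK].
  by rewrite -[leRHS]mulr1 ler_wpM2l // le1.
have split : \sum_(0 <= c < K) p c * q c =
    p i * q i + \sum_(0 <= c < K | c != i) p c * q c.
  by rewrite (bigD1_seq i) ?mem_index_iota ?iota_uniq.
have rest : 0 <= \sum_(0 <= c < K | c != i) p c * q c.
  by rewrite sumr_ge0 // => c _; rewrite mulr_ge0.
have [ij|ij] := eqVneq i j.
  rewrite -ij in qj *.
  rewrite ger0_norm ?subr_ge0 // split.
  have -> : true%:R = 1 :> R by [].
  have : (1 - p i) * (1 - q i) >= 0 by rewrite mulr_ge0 // subr_ge0.
  by lra.
rewrite sub0r normrN ger0_norm // split.
have r1 : \sum_(0 <= c < K | c != i) p c * q c <= 1 - p i.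
  rewrite -p1 [in leRHS](bigD1_seq i) ?mem_index_iota ?iota_uniq //= addrAC subrr add0r.
  rewrite [leLHS]big_nat_cond [leRHS]big_nat_cond; apply: ler_sum => c /andP[/andP[_ cK] _].
  by rewrite -[leRHS]mulr1 ler_wpM2l // le1.
have r2 : q i <= 1 - q j.
  rewrite -q1 (bigD1_seq j) ?mem_index_iota ?iota_uniq //= addrAC subrr add0r.
  rewrite big_mkcond (bigD1_seq i) ?mem_index_iota ?iota_uniq //= ij lerDl.
  by rewrite sumr_ge0 // => c _; case: ifP.
have : p i * q i <= q i by rewrite -[leRHS]mul1r ler_wpM2r.
by lra.
Qed.

Theorem same_cell_count :
  `|\sum_(0 <= n < L) (cell (x n) == cell (y n))%:R - L%:R / K%:R| <=
    1152 * K.+1%:R * (L%:R * (1 + ln H%:R) / H%:R + B)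
    + K%:R * (9 * (1 + ln H%:R) ^+ 2 * B).
Proof.
have dx := box_defect (coordinate_x H0 expsumB).
have dy := box_defect (coordinate_y H0 expsumB).
pose T n := \sum_(0 <= c < K) box K H c (x n) * box K H c (y n).
have -> : \sum_(0 <= n < L) (cell (x n) == cell (y n))%:R - L%:R / K%:R =
   (\sum_(0 <= n < L) ((cell (x n) == cell (y n))%:R - T n)) +
   (\sum_(0 <= n < L) T n - L%:R / K%:R) by rewrite sumrB; ring.
apply: le_trans (ler_normD _ _) _; apply: lerD.
  apply: (@le_trans _ _ (\sum_(0 <= n < L) ((1 - box K H (cell (x n)) (x n)) +
      (1 - box K H (cell (y n)) (y n))))).
    apply: le_trans (ler_norm_sum _ _ _) _; apply: ler_sum => n _.
    by apply: indicator_dot; rewrite ?cell_lt ?box_sum // => c; exact: box_ge0.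
  by rewrite big_split /=; lra.
have -> : \sum_(0 <= n < L) T n - L%:R / K%:R = \sum_(0 <= c < K)
    (\sum_(0 <= n < L) box K H c (x n) * box K H c (y n) - L%:R / K%:R ^+ 2).
  rewrite sumrB /T exchange_big /= sumr_const_nat subn0 -[_ *+ K]mulr_natl.
  by congr (_ - _); field; rewrite gt_eqF.
apply: le_trans (ler_norm_sum _ _ _) _.
apply: (@le_trans _ _ (\sum_(0 <= c < K) (9 * (1 + ln H%:R) ^+ 2 * B))).
  by apply: ler_sum => c _; exact: box_correlation.
by rewrite sumr_const_nat subn0 -[_ *+ K]mulr_natl.
Qed.

End Equidistribution.

(** * Progressions and residues *)

Section Progressions.
Variable R : realType.
Variables (alpha : R) (k r : nat).
Hypotheses (halpha : 1 < alpha < 2) (hk : (3 <= k)%N) (hr : (1 <= r)%N).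

Local Notation K := k.-1.
Local Notation f n := (n%:R `^ alpha : R).

Let K0 : (0 < K)%N. Proof. by case: k hk => [|[|]]. Qed.
Let KR : 0 < K%:R :> R. Proof. by rewrite ltr0n. Qed.

Lemma powR_increment (be : R) (a b : nat) : (0 < a)%N -> (a <= b)%N ->
  exists2 z, a%:R <= z <= b%:R & b%:R `^ be - a%:R `^ be = be * z `^ (be - 1) * (b - a)%:R.
Proof.
move=> a0 ab; have aR : 0 < a%:R :> R by rewrite ltr0n.
have [z] := powR_shift_mvt (b - a) be aR.
by rewrite -natrD subnKC //; exists z.
Qed.

(** The graph of x ^ alpha lies below its chords, by an amount controlled by
    the second derivative. *)
Lemma chord_deficit (n j : nat) : (0 < n)%N -> (j <= K)%N ->
  0 <= (1 - j%:R / K%:R) * f n + j%:R / K%:R * f (n + r * K) - f (n + r * j)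
    <= 2 * (r * K)%:R ^+ 2 * n%:R `^ (alpha - 2).
Proof.
move=> n0 jK; have /andP[a1 a2] := halpha.
have nR : 0 < n%:R :> R by rewrite ltr0n.
have rjK : (n + r * j <= n + r * K)%N by rewrite leq_add2l leq_mul2l jK orbT.
have nj0 : (0 < n + r * j)%N by rewrite addn_gt0 n0.
have [z1 /andP[n1 z1j] e1] := powR_increment alpha n0 (leq_addr (r * j) n).
have [z3 /andP[jz3 z3K] e3] := powR_increment alpha nj0 rjK.
have z10 : 0 < z1 := lt_le_trans nR n1.
have z13 : z1 <= z3 := le_trans z1j jz3.
have [||w] := @MVT_segment R (fun y => y `^ (alpha - 1))
   (fun y => (alpha - 1) * y `^ (alpha - 1 - 1)) z1 z3 z13.
- move=> y; rewrite in_itv /= => /andP[zy _]; apply: is_derive1_powR.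
  exact: lt_trans zy.
- apply: derivable_within_continuous => y; rewrite in_itv /= => /andP[zy _].
  by have [] := is_derive1_powR (alpha - 1) (lt_le_trans z10 zy).
rewrite in_itv /= => /andP[zw _] e.
have wle : w `^ (alpha - 1 - 1) <= n%:R `^ (alpha - 2).
  have -> : alpha - 1 - 1 = alpha - 2 by ring.
  by apply: le0_powR_anti => //; [rewrite subr_le0 ltW|exact: le_trans zw].
have w0 : 0 <= w `^ (alpha - 1 - 1) by exact: powR_ge0.
pose c : R := j%:R * (K - j)%:R * r%:R / K%:R.
have E : (1 - j%:R / K%:R) * f n + j%:R / K%:R * f (n + r * K) - f (n + r * j) =
   c * (alpha * ((alpha - 1) * w `^ (alpha - 1 - 1) * (z3 - z1))).
  rewrite -e.
  have -> : f (n + r * K) = f (n + r * j) +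
      alpha * z3 `^ (alpha - 1) * (n + r * K - (n + r * j))%:R.
    by rewrite -e3 addrC subrK.
  have -> : f (n + r * j) = f n + alpha * z1 `^ (alpha - 1) * (n + r * j - n)%:R.
    by rewrite -e1 addrC subrK.
  rewrite subnDl -mulnBr addKn /c !natrM natrB //; field.
  by rewrite gt_eqF.
rewrite E.
have c0 : 0 <= c by rewrite /c divr_ge0 // !mulr_ge0.
have dz : 0 <= z3 - z1 by rewrite subr_ge0.
have aa : 0 <= alpha * (alpha - 1) <= 2 by apply/andP; split; nra.
have cle : c <= (r * K)%:R.
  rewrite /c ler_pdivrMr // natrM.
  have j1 : j%:R <= K%:R :> R by rewrite ler_nat.
  have j2 : (K - j)%:R <= K%:R :> R by rewrite ler_nat leq_subr.
  have -> : j%:R * (K - j)%:R * r%:R = r%:R * (j%:R * (K - j)%:R) :> R by ring.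
  by rewrite -mulrA ler_wpM2l // ler_pM.
have dle : z3 - z1 <= (r * K)%:R.
  by move: z3K n1; rewrite natrD; lra.
have -> : c * (alpha * ((alpha - 1) * w `^ (alpha - 1 - 1) * (z3 - z1))) =
   (alpha * (alpha - 1)) * (c * (z3 - z1)) * w `^ (alpha - 1 - 1) by ring.
have /andP[aa1 aa2] := aa.
have cd0 : 0 <= c * (z3 - z1) by rewrite mulr_ge0.
apply/andP; split; first by apply: mulr_ge0 => //; apply: mulr_ge0.
apply: ler_pM => //; first exact: mulr_ge0.
by apply: ler_pM => //; rewrite expr2; apply: ler_pM.
Qed.

Lemma arith_prog_floor n : (0 < n)%N -> floor_powers alpha r n \in arith_prog k ->
  exists d : int, Num.floor (f (n + r * K)) = Num.floor (f n) + d * K%:Z.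
Proof.
move=> n0; rewrite inE => -[b [d [b0 d0 hj]]].
have k0 : (0 < k)%N by case: k hk.
have kK : (K < k)%N by case: k k0.
have := hj (Ordinal k0); have := hj (Ordinal kK).
rewrite /floor_powers /= muln0 addn0 mulr0 addr0 => -> ->.
by exists d.
Qed.

(** Between the endpoints the values stay within the margin of the chord, so
    their integer parts follow the arithmetic progression that the integer
    parts of the two endpoints determine. *)
Lemma floor_arith_prog n (d : int) (ep : R) : (0 < n)%N ->
  2 * (r * K)%:R ^+ 2 * n%:R `^ (alpha - 2) <= ep ->
  Num.floor (f (n + r * K)) = Num.floor (f n) + d * K%:Z ->
  ep <= f n - (Num.floor (f n))%:~R ->
  ep <= f (n + r * K) - (Num.floor (f (n + r * K)))%:~R ->
  floor_powers alpha r n \in arith_prog k.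
Proof.
move=> n0 hep hd h1 h2; have /andP[a1 a2] := halpha.
have nR : 1 <= n%:R :> R by rewrite ler1n.
have n0R : 0 < n%:R :> R by rewrite ltr0n.
rewrite inE; exists (Num.floor (f n)), d; split.
- rewrite gtz0_ge1 floor_ge_int.
  have : n%:R `^ 0 <= n%:R `^ alpha :> R by rewrite ler_powR //; lra.
  by rewrite powRr0.
- have rK : (0 < r * K)%N by rewrite muln_gt0 hr K0.
  have [z /andP[nz zK] e] := powR_increment alpha n0 (leq_addr (r * K) n).
  have z1 : 1 <= z `^ (alpha - 1).
    have : z `^ 0 <= z `^ (alpha - 1) by rewrite ler_powR ?(le_trans nR nz) //; lra.
    by rewrite powRr0.
  have big : f n + 1 <= f (n + r * K).
    rewrite addKn in e.
    have : 1 <= (r * K)%:R :> R by rewrite ler1n.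
    have : 1 <= alpha * z `^ (alpha - 1) by nra.
    by move: e; nra.
  have fl : Num.floor (f n) < Num.floor (f (n + r * K)).
    have h := floor_itv (f n); have h' := floor_itv (f (n + r * K)).
    rewrite -(ltr_int R).
    by move: h h'; rewrite !intrD !mulr1z => /andP[l1 u1] /andP[l2 u2]; lra.
  by move: fl; rewrite hd ltrDl pmulr_lgt0 // ltz_nat.
move=> j; rewrite /floor_powers.
have jK : (j <= K)%N by rewrite -ltnS prednK ?ltn_ord //; case: k hk.
have /andP[c1 c2] := chord_deficit n0 jK.
apply: floor_def.
have h := floor_itv (f n); have h' := floor_itv (f (n + r * K)).
move: h h'; rewrite hd in h2 *; rewrite !intrD !intrM !mulr1z => /andP[l1 u1] /andP[l2 u2].
rewrite !intrD !intrM in h2.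
set F := (Num.floor (f n))%:~R in h1 h2 l1 u1 l2 u2 *.
set D : R := d%:~R in h2 l2 u2 *.
rewrite -[(K%:Z)%:~R]/(K%:R) in h2 l2 u2.
rewrite -[(j%:Z)%:~R]/(j%:R).
set fn := f n in h1 l1 u1 c1 c2 *; set fK := f (n + r * K) in h2 l2 u2 c1 c2 *.
set fj := f (n + r * j) in c1 c2 *.
pose q : R := j%:R / K%:R.
have q0 : 0 <= q by rewrite divr_ge0.
have q1 : q <= 1 by rewrite ler_pdivrMr // mul1r ler_nat.
have jq : j%:R = q * K%:R by rewrite /q mulfVK // gt_eqF.
rewrite -/q in c1 c2; rewrite jq.
have b1 : (1 - q) * ep <= (1 - q) * (fn - F) by rewrite ler_wpM2l // subr_ge0.
have b2 : q * ep <= q * (fK - (F + D * K%:R)) by rewrite ler_wpM2l.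
have q1' : 0 <= 1 - q by rewrite subr_ge0.
have t1 : (1 - q) * (fn - F) + q * (fK - (F + D * K%:R)) < 1.
  have [->|qn] := eqVneq q 0; first by lra.
  have qp : 0 < q by rewrite lt_neqAle eq_sym qn.
  have : (1 - q) * (fn - F) <= (1 - q) * 1 by rewrite ler_wpM2l //; lra.
  have : q * (fK - (F + D * K%:R)) < q * 1 by rewrite ltr_pM2l //; lra.
  by lra.
by apply/andP; split; lra.
Qed.

Lemma cell_powR n : cell K (f n / K%:R) = `|(Num.floor (f n) %% K)%Z|%N.
Proof. by rewrite /cell mulrC mulfVK // gt_eqF. Qed.

Lemma chord_cell (t : R) :
  chord (t - (cell K t)%:R / K%:R) <= 8 * (K%:R * t - (Num.floor (K%:R * t))%:~R).
Proof.
have kz : K%:Z != 0 by rewrite eqz_nat -lt0n.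
set g := Num.floor (K%:R * t).
have := floor_itv (K%:R * t); rewrite -/g intrD mulr1z => /andP[h1 h2].
set v := K%:R * t - g%:~R.
have v0 : 0 <= v by rewrite subr_ge0.
have e : g%:~R = (g %/ K)%Z%:~R * K%:R + (cell K t)%:R :> R.
  rewrite {1}(divz_eq g K) intrD intrM; congr (_ + _).
  rewrite /cell -/g -[RHS]/(((`|(g %% K)%Z|%N)%:Z)%:~R) gez0_abs //.
  exact: modz_ge0.
have -> : t - (cell K t)%:R / K%:R = v / K%:R + (g %/ K)%Z%:~R.
  by rewrite /v e; field; rewrite gt_eqF.
rewrite chordDint (le_trans (cmod_cexp_sub1_le _)) // ler_pM2l //.
rewrite ger0_norm ?divr_ge0 // ler_pdivrMr // -[leLHS]mulr1 ler_wpM2l //.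
by rewrite ler1n.
Qed.

Section Count.
Variables (N0 L h H : nat) (B : R).
Let x (n : nat) : R := f (N0 + n) / K%:R.
Let y (n : nat) : R := f (N0 + n + r * K) / K%:R.
Hypotheses (N00 : (0 < N0)%N) (hH : (0 < h <= H)%N) (B0 : 0 <= B).
Hypothesis expsumB : forall a b : int, (a != 0) || (b != 0) ->
  `|a%:~R| < H%:R :> R -> `|b%:~R| < H%:R :> R ->
  cmod (\sum_(0 <= n < L) cexp (a%:~R * x n + b%:~R * y n)) <= B.
Hypothesis small : 2 * (r * K)%:R ^+ 2 * N0%:R `^ (alpha - 2) <= (8 * h%:R)^-1 :> R.

Let H0 : (0 < H)%N. Proof. by case/andP: hH => /leq_trans; apply. Qed.
Let hR : 0 < h%:R :> R. Proof. by case/andP: hH => h0 _; rewrite ltr0n. Qed.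

(** Number of endpoints c / K within 1 / h of z n, so at least 1 at the points
    where the integer parts may fail to follow the chord. *)
Definition near (z : nat -> R) (n : nat) : R :=
  \sum_(0 <= c < K) (chord (z n - c%:R / K%:R) <= h%:R^-1)%R%:R.

Lemma near_ge0 z n : 0 <= near z n.
Proof. by rewrite sumr_ge0. Qed.

Lemma near_ge1 (z : nat -> R) n :
  K%:R * z n - (Num.floor (K%:R * z n))%:~R < (8 * h%:R)^-1 -> 1 <= near z n.
Proof.
move=> hz; have cK := cell_lt K0 (z n).
rewrite /near (bigD1_seq (cell K (z n))) ?mem_index_iota ?iota_uniq //=.
have -> : chord (z n - (cell K (z n))%:R / K%:R) <= h%:R^-1.
  rewrite (le_trans (chord_cell _)) // -ler_pdivlMl // -invfM.
  exact: ltW.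
by rewrite lerDl sumr_ge0.
Qed.

Lemma near_sum (z : nat -> R) : coordinate L H B z ->
  \sum_(0 <= n < L) near z n <= K%:R * (4 * (L%:R / h%:R + B)).
Proof.
move=> zc; rewrite exchange_big /=.
apply: (@le_trans _ _ (\sum_(0 <= c < K) (4 * (L%:R / h%:R + B)))).
  by apply: ler_sum => c _; apply: (near_count (H := H)).
by rewrite sumr_const_nat subn0 -[_ *+ K]mulr_natl.
Qed.

Lemma progression_defect n :
  `|(floor_powers alpha r (N0 + n) \in arith_prog k)%:R
     - (cell K (x n) == cell K (y n))%:R| <= near x n + near y n.
Proof.
have n0 : (0 < N0 + n)%N by rewrite addn_gt0 N00.
have nx := near_ge0 x n; have ny := near_ge0 y n.
have kz : K%:Z != 0 by rewrite eqz_nat -lt0n.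
have KxE : K%:R * x n = f (N0 + n) by rewrite /x mulrC mulfVK // gt_eqF.
have KyE : K%:R * y n = f (N0 + n + r * K) by rewrite /y mulrC mulfVK // gt_eqF.
have [ap|nap] := boolP (_ \in _).
  have [d hd] := arith_prog_floor n0 ap.
  rewrite /x /y !cell_powR hd.
  by rewrite [_ + d * _]addrC modzMDl eqxx subrr normr0 addr_ge0.
have [ceq|_] := eqVneq (cell K (x n)) (cell K (y n)); last first.
  by rewrite subrr normr0 addr_ge0.
rewrite sub0r normrN normr1.
have [d hd] : exists d : int, Num.floor (f (N0 + n + r * K)) =
    Num.floor (f (N0 + n)) + d * K%:Z.
  move: ceq; rewrite /x /y !cell_powR => ceq.
  have {}ceq : (Num.floor (f (N0 + n)) %% K = Num.floor (f (N0 + n + r * K)) %% K)%Z.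
    have := congr1 Posz ceq; rewrite !gez0_abs ?modz_ge0 //.
  set u := Num.floor _ in ceq *; set w := Num.floor _ in ceq *.
  exists ((w %/ K)%Z - (u %/ K)%Z).
  by rewrite {1}(divz_eq w K) {1}(divz_eq u K) -ceq; ring.
have smalln : 2 * (r * K)%:R ^+ 2 * (N0 + n)%:R `^ (alpha - 2) <= (8 * h%:R)^-1 :> R.
  apply: le_trans small; rewrite ler_wpM2l ?mulr_ge0 ?exprn_ge0 //.
  have /andP[_ a2] := halpha.
  apply: le0_powR_anti; rewrite ?subr_le0 ?(ltW a2) ?ltr0n ?ler_nat ?leq_addr //.
have [gx|lx] := ltP (K%:R * x n - (Num.floor (K%:R * x n))%:~R) (8 * h%:R)^-1.
  by have := near_ge1 gx; lra.
have [gy|ly] := ltP (K%:R * y n - (Num.floor (K%:R * y n))%:~R) (8 * h%:R)^-1.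
  by have := near_ge1 gy; lra.
rewrite KxE in lx; rewrite KyE in ly.
by rewrite (floor_arith_prog n0 smalln hd) in nap.
Qed.

(** Progressions are counted by the points with equal cells, up to the points
    near an endpoint in one of the two coordinates. *)
Lemma progression_count :
  `|\sum_(0 <= n < L) (floor_powers alpha r (N0 + n) \in arith_prog k)%:R
     - L%:R / K%:R : R| <=
  1152 * k%:R * (L%:R * (1 + ln H%:R) / H%:R + B) + K%:R * (9 * (1 + ln H%:R) ^+ 2 * B)
  + 8 * K%:R * (L%:R / h%:R + B).
Proof.
have main := same_cell_count K0 H0 expsumB B0.
rewrite prednK in main; last by case: k hk.
have nx := near_sum (coordinate_x H0 expsumB).
have ny := near_sum (coordinate_y H0 expsumB).
have -> : \sum_(0 <= n < L) (floor_powers alpha r (N0 + n) \in arith_prog k)%:R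
     - L%:R / K%:R =
  (\sum_(0 <= n < L) (cell K (x n) == cell K (y n))%:R - L%:R / K%:R) +
  \sum_(0 <= n < L) ((floor_powers alpha r (N0 + n) \in arith_prog k)%:R
     - (cell K (x n) == cell K (y n))%:R) :> R by rewrite sumrB; ring.
apply: le_trans (ler_normD _ _) _; apply: lerD; first exact: main.
apply: le_trans (ler_norm_sum _ _ _) _.
apply: (@le_trans _ _ (\sum_(0 <= n < L) (near x n + near y n))).
  by apply: ler_sum => n _; exact: progression_defect.
by rewrite big_split /=; lra.
Qed.

End Count.
End Progressions.

(** * Exponential sums of the pair *)

Section PairSums.
Variable R : realType.
Variables (alpha : R) (K rho : nat) (X L : nat) (H : R) (a b : int).
Hypothesis halpha : 1 < alpha < 2.
Hypotheses (K0 : (0 < K)%N) (rho0 : (0 < rho)%N) (X0 : (0 < X)%N).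
Hypotheses (ab : (a != 0) || (b != 0)) (aH : `|a%:~R| <= H) (bH : `|b%:~R| <= H).
Hypothesis HX : 8 * H * rho%:R <= X%:R.

Local Notation S := (\sum_(0 <= n < L) cexp (phase alpha K rho a b 0 (X + n)%:R)).

(** Lower bound for the derivative whose natural size is x ^ (alpha - m). *)
Definition derivative_lo (m : nat) : R :=
  (alpha - 1) * (2 - alpha) / (2 * K%:R) * (2 * (X + L)%:R) `^ (alpha - m%:R).

Lemma derivative_lo_gt0 m : 0 < derivative_lo m.
Proof.
have /andP[a1 a2] := halpha; have KR : 0 < K%:R :> R by rewrite ltr0n.
have XL : 0 < (X + L)%:R :> R by rewrite ltr0n addn_gt0 X0.
apply: mulr_gt0; last by rewrite powR_gt0 // mulr_gt0.
by rewrite divr_gt0 ?mulr_gt0 ?subr_gt0.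
Qed.

Lemma phase_bounds_nat : exists d : bool, forall m, (2 <= m + d <= 5)%N ->
  exists e : bool, forall x, X%:R <= x <= (X + L)%:R ->
    derivative_lo (m + d) <= (-1) ^+ e * phase alpha K rho a b m x
      <= 36 * rho%:R * H * X%:R `^ (alpha - (m + d)%:R).
Proof.
by apply: phase_bounds => //; rewrite ?ltr0n ?ler_nat ?leq_addr.
Qed.

(** The two alternatives correspond to a + b = 0, where no differencing is
    needed, and to a + b != 0, where one step brings the derivative below 1/2. *)
Lemma pair_sum_low (Q : nat) : (0 < Q <= L)%N ->
  Q%:R * (36 * rho%:R * H * X%:R `^ (alpha - 2)) <= 1 / 2 ->
  cmod S <= 3 / derivative_lo 2 \/
  cmod S ^+ 2 <= 2 * L%:R / Q%:R * (L%:R + 6 * (1 + ln Q%:R) / derivative_lo 2).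
Proof.
move=> QL hQ; have [d hd] := phase_bounds_nat.
have dg := @derivatives_phase R alpha K rho a b.
have lo0 := derivative_lo_gt0 2.
case: d hd => hd.
  left; have [e1 h1] := hd 1%N isT; have [e2 h2] := hd 2%N isT.
  have := @expsum_dif0 R _ dg [::] X L _
    (36 * rho%:R * H * X%:R `^ (alpha - 2)) e1 e2 X0 isT lo0.
  rewrite /= addn0 ?mulr1 !mul1r; apply.
  - exact: h1.
  - move=> x hx; have /andP[+ _] := h2 x hx.
    by apply: le_trans; exact: ltW (derivative_lo_gt0 3).
  - rewrite -[2^-1]mul1r (le_trans _ hQ) // -[leLHS]mul1r; apply: ler_wpM2r.
      by rewrite !mulr_ge0 ?powR_ge0 // (le_trans _ aH).
    by rewrite ler1n; case/andP: QL.
right; have [e1 h1] := hd 2%N isT; have [e2 h2] := hd 3%N isT.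
have := @expsum_dif1 R _ dg [::] X L Q _
  (36 * rho%:R * H * X%:R `^ (alpha - 2)) e1 e2 X0 isT lo0 QL.
rewrite /= addn0 ?mulr1 !mul1r; apply.
- exact: h1.
- move=> x hx; have /andP[+ _] := h2 x hx.
  by apply: le_trans; exact: ltW (derivative_lo_gt0 3).
- by rewrite -[2^-1]mul1r.
Qed.

(** Same alternatives as before, with one more differencing step in each. *)
Lemma pair_sum_high (P Q : nat) : (0 < P)%N -> (0 < Q)%N -> (P + Q <= L)%N ->
  Q%:R * P%:R * (36 * rho%:R * H * X%:R `^ (alpha - 3)) <= 1 / 2 ->
  cmod S ^+ 2 <= 2 * L%:R / Q%:R * (L%:R + 6 * (1 + ln Q%:R) / derivative_lo 3) \/
  cmod S ^+ 2 <= 2 * L%:R / P%:R * (L%:R + 2 * P%:R *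
    Num.sqrt (2 * L%:R / Q%:R * (L%:R + 6 * (1 + ln Q%:R) / derivative_lo 3))).
Proof.
move=> P0 Q0 PQ hQ; have [d hd] := phase_bounds_nat.
have dg := @derivatives_phase R alpha K rho a b.
have lo0 := derivative_lo_gt0 3.
case: d hd => hd.
  left; have [e1 h1] := hd 2%N isT; have [e2 h2] := hd 3%N isT.
  have QL : (0 < Q <= L)%N by rewrite Q0 (leq_trans _ PQ) // leq_addl.
  have := @expsum_dif1 R _ dg [::] X L Q _
    (36 * rho%:R * H * X%:R `^ (alpha - 3)) e1 e2 X0 isT lo0 QL.
  rewrite /= addn0 ?mulr1 !mul1r; apply.
  - exact: h1.
  - move=> x hx; have /andP[+ _] := h2 x hx.
    by apply: le_trans; exact: ltW (derivative_lo_gt0 4).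
  - rewrite -[2^-1]mul1r (le_trans _ hQ) // ler_wpM2r //.
      by rewrite !mulr_ge0 ?powR_ge0 // (le_trans _ aH).
    by rewrite -[leLHS]mulr1 ler_wpM2l // ler1n.
right; have [e1 h1] := hd 3%N isT; have [e2 h2] := hd 4%N isT.
apply: (@expsum_dif2 R _ dg X L P Q _ _ e1 e2 X0 lo0 P0 Q0 PQ _ _ hQ).
- exact: h1.
- move=> x hx; have /andP[+ _] := h2 x hx.
  by apply: le_trans; exact: ltW (derivative_lo_gt0 4).
Qed.

End PairSums.

(** * Choice of parameters *)

Section Powers.
Variable R : realType.
Implicit Types (n e : R).

Lemma powRD1 n e1 e2 : 1 <= n -> n `^ e1 * n `^ e2 = n `^ (e1 + e2).
Proof.
move=> n1; rewrite powRD // (_ : (n == 0) = false) ?implybT //.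
by rewrite gt_eqF // (lt_le_trans ltr01).
Qed.

Lemma powR_gt0' n e : 1 <= n -> 0 < n `^ e.
Proof. by move=> n1; rewrite powR_gt0 // (lt_le_trans ltr01). Qed.

Lemma powR_ge1 n e : 1 <= n -> 0 <= e -> 1 <= n `^ e.
Proof. by move=> n1 e0; rewrite -(powRr0 n) ler_powR. Qed.

Lemma trunc_powR n e : 1 <= n -> 0 <= e ->
  [/\ (0 < Num.trunc (n `^ e))%N, (Num.trunc (n `^ e))%:R <= n `^ e &
      n `^ e / 2 <= (Num.trunc (n `^ e))%:R].
Proof.
move=> n1 e0; have p1 := powR_ge1 n1 e0.
have p0 : 0 <= n `^ e by exact: powR_ge0.
have /andP[h1 h2] := truncn_itv p0.
have t0 : (0 < Num.trunc (n `^ e))%N by rewrite truncn_gt0.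
split=> //.
have : 1 <= (Num.trunc (n `^ e))%:R :> R by rewrite ler1n.
by move: h2; rewrite -natr1; lra.
Qed.

Lemma powR_small (e c : R) : e < 0 -> 0 < c ->
  \forall N \near \oo, N%:R `^ e <= c.
Proof.
move=> e0 c0; near=> N.
have hN : c `^ e^-1 <= N%:R by near: N; exact: nbhs_infty_ger.
have c1 : 0 < c `^ e^-1 by rewrite powR_gt0.
have := le0_powR_anti (ltW e0) c1 hN.
by rewrite -powRrM mulVf ?lt_eqF // powRr1 // ltW.
Unshelve. all: by end_near. Qed.

Lemma ln_le_powR n (de : R) : 1 <= n -> 0 < de -> 1 + ln n <= (1 + de^-1) * n `^ de.
Proof.
move=> n1 d0; have p1 := powR_ge1 n1 (ltW d0).
have p0 : 0 < n `^ de by exact: powR_gt0'.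
have h : ln (n `^ de) <= n `^ de.
  have -> : n `^ de = 1 + (n `^ de - 1) by rewrite addrC subrK.
  by rewrite (le_trans (le_ln1Dx _)) //; lra.
rewrite ln_powR in h.
have : ln n <= de^-1 * n `^ de by rewrite -ler_pdivrMl ?invr_gt0 // invrK.
by rewrite mulrDl mul1r; lra.
Qed.

End Powers.

Section Scales.
Variable R : realType.
Variables (alpha : R) (k r : nat).
Hypotheses (halpha : 1 < alpha < 2) (hk : (3 <= k)%N) (hr : (1 <= r)%N).

Local Notation K := k.-1.
Local Notation rho := (r * k.-1)%N.
Local Notation th := (3 - alpha).

Let K0 : (0 < K)%N. Proof. by case: k hk => [|[|]]. Qed.
Let rho0 : (0 < rho)%N. Proof. by rewrite muln_gt0 hr K0. Qed.
Let KR : 0 < K%:R :> R. Proof. by rewrite ltr0n. Qed.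
Let a1 : 1 < alpha. Proof. by case/andP: halpha. Qed.
Let a2 : alpha < 2. Proof. by case/andP: halpha. Qed.

(** What the choice of parameters below requires of N.  Every exponent is
    negative; for the two that decide whether derivatives drop below 1/2,
    3 theta / 13 < 6 (2 - alpha) / 7 holds because alpha <= 8/5, and
    1/13 + 2/13 + 8/13 - 6/7 = - 1/91. *)
Definition large (N : nat) : Prop := let n : R := N%:R in
  [/\ (3 <= N)%N, n `^ (- (1 / 7)) <= 1 / 8 &
  [/\ n `^ (2 * th / 13 - 1) <= 1 / 4,
      8 * rho%:R * n `^ (th / 13 - 6 / 7) <= 1 &
      16 * rho%:R ^+ 2 * n `^ (- (5 / 14) * (2 - alpha)) <= 1] /\
  (alpha <= 8 / 5 -> 36 * rho%:R * n `^ (3 * th / 13 - 6 / 7 * (2 - alpha)) <= 1 / 2) /\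
  (8 / 5 < alpha -> 36 * rho%:R * n `^ (- (th / 91)) <= 1 / 2 /\
                    n `^ (8 * th / 13 - 1) <= 1 / 4)].

Lemma large_near : \forall N \near \oo, large N.
Proof.
have rR : 0 < rho%:R :> R by rewrite ltr0n.
have scaled (c e d : R) : 0 < c -> e < 0 -> 0 < d ->
    \forall N \near \oo, c * N%:R `^ e <= d.
  move=> c0 e0 d0; near=> N.
  rewrite mulrC -ler_pdivlMr //; near: N.
  by apply: powR_small => //; rewrite divr_gt0.
have low : \forall N \near \oo, alpha <= 8 / 5 ->
    36 * rho%:R * N%:R `^ (3 * th / 13 - 6 / 7 * (2 - alpha)) <= 1 / 2.
  have [al|al] := leP alpha (8 / 5); last by near=> N.
  near=> N => _; near: N; apply: scaled; rewrite ?mulr_gt0 //; move: a1 a2; lra.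
have high : \forall N \near \oo, 8 / 5 < alpha ->
    36 * rho%:R * N%:R `^ (- (th / 91)) <= 1 / 2 /\
    N%:R `^ (8 * th / 13 - 1) <= 1 / 4.
  have [al|al] := leP alpha (8 / 5); first by near=> N.
  near=> N => _; split; near: N; first by apply: scaled; rewrite ?mulr_gt0 //; move: a1 a2; lra.
  by apply: powR_small => //; move: a1 a2; lra.
near=> N; split.
- by near: N; exact: nbhs_infty_ge.
- by near: N; apply: powR_small => //; move: a1 a2; lra.
split; [split|split; by near: N]; near: N.
- by apply: powR_small => //; move: a1 a2; lra.
- by apply: scaled; rewrite ?mulr_gt0 //; move: a1 a2; lra.
- apply: scaled; rewrite ?mulr_gt0 ?exprn_gt0 //.
  by rewrite mulNr oppr_lt0 mulr_gt0 // subr_gt0.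
Unshelve. all: by end_near. Qed.

Section LargeN.
Variable N : nat.
Hypothesis hN : large N.

Local Notation n := (N%:R : R).

(** The frequencies are below N ^ (theta / 13), and the first differencing step
    uses N ^ (2 theta / 13) shifts so that its diagonal term is of the matching
    size.  The second step takes as many shifts as the derivative allows, namely
    N ^ (8 theta / 13): the loss N ^ (theta - 1) from the Kusmin-Landau
    inequality must be recovered there. *)
Definition start : nat := (Num.trunc (n `^ (6 / 7))).+1.
Definition span : nat := (N.+1 - start)%N.
Definition cutoff : nat := Num.trunc (n `^ (th / 13)).
Definition shift1 : nat := Num.trunc (n `^ (2 * th / 13)).
Definition shift2 : nat := Num.trunc (n `^ (8 * th / 13)).
Definition logN : R := 1 + ln n.

Let n3 : 3 <= n. Proof. by case: hN => h _ _; rewrite ler_nat. Qed.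
Let n1 : 1 <= n. Proof. by move: n3; lra. Qed.
Let n0 : 0 < n. Proof. by move: n3; lra. Qed.

Lemma logN_ge1 : 1 <= logN.
Proof. by rewrite lerDl ln_ge0. Qed.

Lemma start_bounds : [/\ n `^ (6 / 7) <= start%:R, start%:R <= 2 * n `^ (6 / 7)
   & start%:R <= n / 4].
Proof.
have e0 : 0 <= 6 / 7 :> R by lra.
have [t0 t1 t2] := trunc_powR n1 e0.
have p1 := powR_ge1 n1 e0.
have h : start%:R <= 2 * n `^ (6 / 7) by rewrite /start -natr1; lra.
split=> //; first by rewrite /start ltW // truncnS_gt.
rewrite (le_trans h) //.
have [_ h7 _] := hN.
have -> : n `^ (6 / 7) = n * n `^ (- (1 / 7)).
  by rewrite -{2}(powRr1 (ltW n0)) powRD1 //; congr (_ `^ _); lra.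
have := ler_wpM2l (ltW n0) h7; lra.
Qed.

Lemma start_span : (start + span = N.+1)%N.
Proof.
rewrite /span subnKC // ltnW // ltnS -(ler_nat R).
by have [_ _ h] := start_bounds; move: n0; lra.
Qed.

Lemma span_le : (span <= N)%N.
Proof. by rewrite /span /start subSS leq_subr. Qed.

Lemma span_ge : n / 2 <= span%:R.
Proof.
have [_ _ h] := start_bounds.
have := congr1 (fun m => m%:R : R) start_span; rewrite natrD -natr1.
by move: n0; lra.
Qed.

Definition lo_const : R := 32 * K%:R / ((alpha - 1) * (2 - alpha)).

Local Notation D := lo_const.

Let D0 : 0 < D.
Proof. by rewrite divr_gt0 ?mulr_gt0 // subr_gt0. Qed.

Lemma derivative_lo_inv (m : nat) : (2 <= m <= 3)%N ->
  (derivative_lo alpha K start span m)^-1 <=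
    D * n `^ (m%:R - alpha).
Proof.
rewrite /lo_const => /andP[m2 m3].
have c0 : 0 < (alpha - 1) * (2 - alpha) by rewrite mulr_gt0 // subr_gt0.
have m2R : 2 <= m%:R :> R by rewrite ler_nat.
have m3R : m%:R <= 3 :> R by rewrite ler_nat.
have -> : m%:R - alpha = - (alpha - m%:R) by ring.
set g := alpha - m%:R.
have g0 : g <= 0 by rewrite /g; move: a2; lra.
have g2 : - 2 <= g by rewrite /g; move: a1; lra.
have q : 16^-1 * n `^ g <= (2 * N.+1%:R) `^ g.
  have N1 : 2 * N.+1%:R <= 4 * n by rewrite -natr1; move: n1; lra.
  apply: le_trans (le0_powR_anti g0 _ N1); last by rewrite mulr_gt0.
  rewrite powRM ?(ltW n0) // ler_wpM2r ?powR_ge0 //.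
  have -> : 16^-1 = 4 `^ (- 2) :> R.
    rewrite powRN powR_mulrn //; congr _^-1.
    by rewrite expr2; ring.
  by rewrite ler_powR // ler1n.
have ng : 0 < n `^ g by exact: powR_gt0'.
rewrite powRN /derivative_lo start_span -/g.
have -> : 32 * K%:R / ((alpha - 1) * (2 - alpha)) * (n `^ g)^-1 =
   ((alpha - 1) * (2 - alpha) / (2 * K%:R) * (16^-1 * n `^ g))^-1.
  by field; rewrite !gt_eqF // ?subr_gt0.
have d0 : 0 < (alpha - 1) * (2 - alpha) / (2 * K%:R) by rewrite divr_gt0 // mulr_gt0.
have N0 : 0 < (2 * N.+1%:R) `^ g by rewrite powR_gt0 // mulr_gt0.
by rewrite lef_pV2 ?posrE ?ler_pM2l //; apply: mulr_gt0 => //; apply: mulr_gt0.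
Qed.

Definition sum_const : R := 20 * (1 + 6 * D).

Lemma differencing_le (Q m : nat) (e : R) : (2 <= m <= 3)%N ->
  0 <= e <= 1 -> Q = Num.trunc (n `^ e) ->
  2 * span%:R / Q%:R * (span%:R + 6 * (1 + ln Q%:R) / derivative_lo alpha K start span m)
  <= 4 * n `^ (1 - e) * (n + 6 * logN * (D * n `^ (m%:R - alpha))).
Proof.
move=> hm /andP[e0 e1] QE.
have [Q0 Qu Ql] := trunc_powR n1 e0; rewrite -QE in Q0 Qu Ql.
have QR : 0 < Q%:R :> R by rewrite ltr0n.
have sn : span%:R <= n by rewrite ler_nat span_le.
have p0 : 0 < n `^ e by exact: powR_gt0'.
have Qn : Q%:R <= n by rewrite (le_trans Qu) // -{2}(powRr1 (ltW n0)) ler_powR.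
have lQ : 1 + ln Q%:R <= logN by rewrite lerD2l ler_ln ?posrE.
have lQ0 : 0 <= 1 + ln Q%:R :> R by rewrite addr_ge0 // ln_nat_ge0.
have st0 : (0 < start)%N by [].
have lo0 := derivative_lo_gt0 span halpha K0 st0 m.
apply: ler_pM.
- by rewrite divr_ge0 ?mulr_ge0.
- by apply: addr_ge0 => //; apply: divr_ge0; [exact: mulr_ge0|exact: ltW].
- have -> : 4 * n `^ (1 - e) = 2 * n * (n `^ e / 2)^-1.
    rewrite -[n `^ (1 - e)]powRD1 // powRr1 ?(ltW n0) // powRN invf_div.
    by field; rewrite gt_eqF.
  apply: ler_pM; rewrite ?mulr_ge0 ?invr_ge0 ?ler_pM2l //.
  by rewrite lef_pV2 ?posrE ?divr_gt0.
- apply: lerD => //; apply: ler_pM; rewrite ?mulr_ge0 ?invr_ge0 ?ler_pM2l ?(ltW lo0) //.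
  exact: derivative_lo_inv.
Qed.

Let pp (e : R) : 0 < n `^ e. Proof. exact: powR_gt0'. Qed.
Let D6 : 1 <= 1 + 6 * D. Proof. by rewrite lerDl mulr_ge0 // ltW. Qed.

Lemma sum_const_ge1 : 1 <= sum_const.
Proof. by rewrite /sum_const; move: D6; lra. Qed.

Lemma cutoffP : [/\ (0 < cutoff)%N, cutoff%:R <= n `^ (th / 13) &
  n `^ (th / 13) / 2 <= cutoff%:R].
Proof. by apply: trunc_powR => //; move: a2; lra. Qed.

Lemma shift1P : [/\ (0 < shift1)%N, shift1%:R <= n `^ (2 * th / 13) &
  n `^ (2 * th / 13) / 2 <= shift1%:R].
Proof. by apply: trunc_powR => //; move: a2; lra. Qed.

Lemma shift2P : [/\ (0 < shift2)%N, shift2%:R <= n `^ (8 * th / 13) &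
  n `^ (8 * th / 13) / 2 <= shift2%:R].
Proof. by apply: trunc_powR => //; move: a2; lra. Qed.

Lemma start_powR_le (g : R) : g <= 0 -> start%:R `^ g <= n `^ (6 / 7 * g).
Proof.
by move=> g0; rewrite powRrM; apply: le0_powR_anti => //; case: start_bounds.
Qed.

Lemma cutoff_start : 8 * cutoff%:R * rho%:R <= start%:R :> R.
Proof.
have [_ Hu _] := cutoffP; have [_ _ [[_ n8 _] _]] := hN; have [sl _ _] := start_bounds.
apply: le_trans sl.
have rR : 0 < rho%:R :> R by rewrite ltr0n.
apply: (@le_trans _ _ (8 * n `^ (th / 13) * rho%:R)).
  by rewrite ler_pM2r // ler_pM2l.
have -> : n `^ (th / 13) = n `^ (th / 13 - 6 / 7) * n `^ (6 / 7).
  by rewrite powRD1 // subrK.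
have -> : 8 * (n `^ (th / 13 - 6 / 7) * n `^ (6 / 7)) * rho%:R =
   8 * rho%:R * n `^ (th / 13 - 6 / 7) * n `^ (6 / 7) by ring.
by rewrite -[leRHS]mul1r ler_pM2r.
Qed.

Lemma quarter (e : R) : n `^ (e - 1) <= 1 / 4 -> n `^ e <= n / 4.
Proof.
move=> h; rewrite -[e](subrK 1) -powRD1 // powRr1 ?(ltW n0) //.
by rewrite mulrC ler_pM2l // -div1r.
Qed.

Lemma shift1_le : shift1%:R <= n / 4.
Proof.
have [_ Pu _] := shift1P; have [_ _ [[n2 _ _] _]] := hN.
exact: le_trans Pu (quarter n2).
Qed.

Lemma shift2_le : 8 / 5 < alpha -> shift2%:R <= n / 4.
Proof.
move=> al; have [_ Qu _] := shift2P; have [_ _ [_ [_ nhigh]]] := hN.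
by have [_ h] := nhigh al; exact: le_trans Qu (quarter h).
Qed.

Lemma low_scale : alpha <= 8 / 5 ->
  shift1%:R * (36 * rho%:R * cutoff%:R * start%:R `^ (alpha - 2)) <= 1 / 2 :> R.
Proof.
move=> al; have [_ _ [_ [nlow _]]] := hN; apply: le_trans (nlow al).
have [_ Hu _] := cutoffP; have [_ Pu _] := shift1P.
have -> : n `^ (3 * th / 13 - 6 / 7 * (2 - alpha)) =
    n `^ (2 * th / 13) * (n `^ (th / 13) * n `^ (6 / 7 * (alpha - 2))).
  by rewrite !powRD1 //; congr (_ `^ _); ring.
have -> : shift1%:R * (36 * rho%:R * cutoff%:R * start%:R `^ (alpha - 2)) =
    36 * rho%:R * (shift1%:R * (cutoff%:R * start%:R `^ (alpha - 2))) by ring.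
have rR : 0 < rho%:R :> R by rewrite ltr0n.
rewrite ler_pM2l ?mulr_gt0 //.
apply: ler_pM => //; apply: ler_pM => //.
by apply: start_powR_le; rewrite subr_le0 ltW.
Qed.

Lemma high_scale : 8 / 5 < alpha -> shift2%:R * shift1%:R *
  (36 * rho%:R * cutoff%:R * start%:R `^ (alpha - 3)) <= 1 / 2 :> R.
Proof.
move=> al; have [_ _ [_ [_ nhigh]]] := hN; have [h _] := nhigh al; apply: le_trans h.
have [_ Hu _] := cutoffP; have [_ Pu _] := shift1P; have [_ Qu _] := shift2P.
have -> : n `^ (- (th / 91)) = n `^ (8 * th / 13) * n `^ (2 * th / 13) *
   (n `^ (th / 13) * n `^ (6 / 7 * (alpha - 3))).
  by rewrite !powRD1 //; congr (_ `^ _); field.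
have -> : shift2%:R * shift1%:R * (36 * rho%:R * cutoff%:R * start%:R `^ (alpha - 3)) =
    36 * rho%:R * (shift2%:R * shift1%:R * (cutoff%:R * start%:R `^ (alpha - 3))).
  by ring.
have rR : 0 < rho%:R :> R by rewrite ltr0n.
rewrite ler_pM2l ?mulr_gt0 //; apply: ler_pM => //; first exact: ler_pM.
apply: ler_pM => //.
by apply: start_powR_le; move: a2; lra.
Qed.

(** Taking the square root costs nothing because the constant and the logarithm
    are at least 1. *)
Lemma bound_of_sqr (S : R) : 0 <= S ->
  S ^+ 2 <= sum_const * logN * n `^ (2 - 2 * th / 13) ->
  S <= sum_const * logN * (n `^ (1 - th / 13) + n `^ (2 - alpha)).
Proof.
move=> S0 hS; have l1 := logN_ge1; have cc1 := sum_const_ge1.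
have sc0 : 0 <= sum_const by exact: le_trans cc1.
have l0 : 0 <= logN by exact: le_trans l1.
have scl0 : 0 <= sum_const * logN by exact: mulr_ge0.
apply: (@le_trans _ _ (sum_const * logN * n `^ (1 - th / 13))); last first.
  by rewrite ler_wpM2l // lerDl powR_ge0.
rewrite -(@ler_pXn2r _ 2) ?nnegrE //; last by rewrite mulr_ge0 // powR_ge0.
apply: le_trans hS _; rewrite exprMn -[X in _ <= _ * X]powR_mulrn ?(ltW (pp _)) //.
rewrite -powRrM.
have -> : (1 - th / 13) * 2%:R = 2 - 2 * th / 13 by ring.
rewrite ler_pM2r // exprMn; apply: ler_pM => //.
  by rewrite expr2 -[leLHS]mulr1 ler_wpM2l.
by rewrite expr2 -[leLHS]mulr1 ler_wpM2l.
Qed.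

Section Frequencies.
Variables a b : int.
Hypotheses (ab : (a != 0) || (b != 0)).
Hypotheses (aH : `|a%:~R| <= cutoff%:R :> R) (bH : `|b%:~R| <= cutoff%:R :> R).

Local Notation S :=
  (cmod (\sum_(0 <= i < span) cexp (phase alpha K rho a b 0 (start + i)%:R))).
Local Notation bound := (sum_const * logN * (n `^ (1 - th / 13) + n `^ (2 - alpha))).

(** Here N ^ (2 - alpha) <= N, so the Kusmin-Landau term is of lower order. *)
Lemma pair_sum_le_low : alpha <= 8 / 5 -> S <= bound.
Proof.
move=> al; have [P0 _ _] := shift1P.
have l1 := logN_ge1; have l0 : 0 <= logN by exact: le_trans l1.
have st0 : (0 < start)%N by [].
have QL : (0 < shift1 <= span)%N.
  rewrite P0 -(ler_nat R) (le_trans shift1_le) // (le_trans _ span_ge) //.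
  by rewrite ler_pM2l // lef_pV2 ?posrE // ler_nat.
have [hs|hs] := pair_sum_low halpha K0 rho0 st0 ab aH bH cutoff_start QL (low_scale al).
  apply: le_trans hs _.
  apply: (@le_trans _ _ (3 * (D * n `^ (2%:R - alpha)))).
    by rewrite ler_pM2l // derivative_lo_inv.
  have sc0 : 0 <= sum_const by exact: le_trans sum_const_ge1.
  apply: (@le_trans _ _ (sum_const * logN * n `^ (2 - alpha))); last first.
    by apply: ler_wpM2l; [exact: mulr_ge0|rewrite lerDr powR_ge0].
  rewrite mulrA ler_pM2r //.
  apply: (@le_trans _ _ (sum_const * 1)); last by rewrite ler_wpM2l.
  by rewrite /sum_const; move: D0; lra.
apply: bound_of_sqr; first exact: cmod_ge0.
apply: le_trans hs _.
have e01 : 0 <= 2 * th / 13 <= 1 by move: a1 a2; lra.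
apply: le_trans (differencing_le _ e01 erefl) _ => //.
have n2a : n `^ (2%:R - alpha) <= n.
  by rewrite -{2}(powRr1 (ltW n0)) ler_powR //; move: a1; lra.
have -> : sum_const * logN * n `^ (2 - 2 * th / 13) =
   4 * n `^ (1 - 2 * th / 13) * (5 * (1 + 6 * D) * logN * n).
  have -> : n `^ (2 - 2 * th / 13) = n `^ (1 - 2 * th / 13) * n.
    by rewrite -{3}(powRr1 (ltW n0)) powRD1 //; congr (_ `^ _); ring.
  by rewrite /sum_const; ring.
rewrite ler_pM2l ?mulr_gt0 //.
apply: (@le_trans _ _ (1 * ((1 + 6 * D) * logN * n))); last first.
  have -> : 5 * (1 + 6 * D) * logN * n = 5 * ((1 + 6 * D) * logN * n) by ring.
  have d0 : 0 <= 1 + 6 * D by exact: le_trans D6.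
  by rewrite ler_wpM2r ?ler1n // mulr_ge0 // mulr_ge0.
have -> : 1 * ((1 + 6 * D) * logN * n) = logN * n + 6 * logN * (D * n) by ring.
apply: lerD; first by rewrite -[leLHS]mul1r ler_pM2r.
by rewrite ler_wpM2l ?mulr_ge0 // ler_pM2l.
Qed.

(** The inner square root is O(log N * N ^ ((1 + 5 theta / 13) / 2)), which is
    below N ^ (1 - 2 theta / 13) because theta <= 13/9. *)
Lemma pair_sum_le_high : 8 / 5 < alpha -> S <= bound.
Proof.
move=> al; have [P0 Pu Pl] := shift1P; have [Q0 Qu Ql] := shift2P.
have l1 := logN_ge1; have l0 : 0 <= logN by exact: le_trans l1.
have d0 : 0 <= 1 + 6 * D by exact: le_trans D6.
have dl0 : 0 <= (1 + 6 * D) * logN by exact: mulr_ge0.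
have st0 : (0 < start)%N by [].
have PQ : (shift1 + shift2 <= span)%N.
  rewrite -(ler_nat R) natrD (le_trans _ span_ge) //.
  have -> : n / 2 = n / 4 + n / 4 by field.
  by apply: lerD; [exact: shift1_le|exact: shift2_le].
have e01 : 0 <= 8 * th / 13 <= 1 by move: al a2; lra.
have := differencing_le (isT : 2 <= 3 <= 3)%N e01 erefl; rewrite -/shift2 => hW.
(* N <= N ^ theta because alpha < 2. *)
have W : 4 * n `^ (1 - 8 * th / 13) * (n + 6 * logN * (D * n `^ (3%:R - alpha))) <=
    4 * ((1 + 6 * D) * logN) * n `^ (1 + 5 * th / 13).
  have nth : n <= n `^ (3%:R - alpha).
    by rewrite -{1}(powRr1 (ltW n0)) ler_powR //; move: a2; lra.
  have -> : 4 * ((1 + 6 * D) * logN) * n `^ (1 + 5 * th / 13) =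
     4 * n `^ (1 - 8 * th / 13) * (logN * n `^ (3%:R - alpha)
        + 6 * logN * (D * n `^ (3%:R - alpha))).
    have -> : n `^ (1 + 5 * th / 13) = n `^ (1 - 8 * th / 13) * n `^ (3%:R - alpha).
      by rewrite powRD1 //; congr (_ `^ _); field.
    by ring.
  rewrite ler_pM2l ?mulr_gt0 // lerD2r (le_trans nth) //.
  by rewrite -[leLHS]mul1r ler_pM2r.
have {W}hW := le_trans hW W.
apply: bound_of_sqr; first exact: cmod_ge0.
have scE : sum_const * logN = 20 * ((1 + 6 * D) * logN) by rewrite /sum_const; ring.
have [hs|hs] := pair_sum_high halpha K0 rho0 st0 ab aH bH cutoff_start P0 Q0 PQ
    (high_scale al).
  apply: le_trans hs (le_trans hW _); rewrite scE.
  apply: ler_pM => //; first by rewrite mulr_ge0.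
    by rewrite ler_wpM2r // ler_nat.
  by rewrite ler_powR //; move: al; lra.
apply: le_trans hs _.
set u := (1 + 6 * D) * logN in dl0 hW scE *.
have u1 : 1 <= u by rewrite -[leLHS]mulr1; apply: ler_pM.
have T : Num.sqrt (2 * span%:R / shift2%:R * (span%:R + 6 * (1 + ln shift2%:R) /
    derivative_lo alpha K start span 3)) <= 4 * u * n `^ (1 - 2 * th / 13).
  apply: le_trans (ler_wsqrtr hW) _.
  have -> : 4 * u * n `^ (1 - 2 * th / 13) =
     Num.sqrt ((4 * u * n `^ (1 - 2 * th / 13)) ^+ 2).
    by rewrite sqrtr_sqr ger0_norm // mulr_ge0 // mulr_ge0.
  apply: ler_wsqrtr; rewrite exprMn.
  have u4 : 1 <= 4 * u by rewrite -[leLHS]mulr1; apply: ler_pM => //; rewrite ler1n.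
  have c0 := le_trans ler01 u4.
  apply: ler_pM => //; first by rewrite expr2 -[leLHS]mulr1 ler_wpM2l.
  rewrite -[leRHS]powR_mulrn ?powR_ge0 // -powRrM ler_powR //.
  by move: al; lra.
set T' := Num.sqrt _ in T *.
have T0 : 0 <= T' by exact: sqrtr_ge0.
have PR : 0 < shift1%:R :> R by rewrite ltr0n.
have sn : span%:R <= n by rewrite ler_nat span_le.
have -> : 2 * span%:R / shift1%:R * (span%:R + 2 * shift1%:R * T') =
  2 * span%:R ^+ 2 / shift1%:R + 4 * span%:R * T' by field; rewrite gt_eqF.
have t1 : 2 * span%:R ^+ 2 / shift1%:R <= 4 * n `^ (2 - 2 * th / 13).
  have -> : 4 * n `^ (2 - 2 * th / 13) = 2 * n ^+ 2 * (n `^ (2 * th / 13) / 2)^-1.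
    have -> : n `^ (2 - 2 * th / 13) = n `^ 2%:R * n `^ (- (2 * th / 13)).
      by rewrite powRD1.
    rewrite powR_mulrn ?(ltW n0) // powRN invf_div.
    by field; rewrite gt_eqF.
  apply: ler_pM; rewrite ?mulr_ge0 ?exprn_ge0 ?invr_ge0 //.
    by rewrite ler_pM2l // lerXn2r ?nnegrE // ltW.
  by rewrite lef_pV2 ?posrE ?divr_gt0.
have t2 : 4 * span%:R * T' <= 16 * u * n `^ (2 - 2 * th / 13).
  have -> : 16 * u * n `^ (2 - 2 * th / 13) =
     4 * n * (4 * u * n `^ (1 - 2 * th / 13)).
    have -> : n `^ (2 - 2 * th / 13) = n * n `^ (1 - 2 * th / 13).
      by rewrite -{2}(powRr1 (ltW n0)) powRD1 //; congr (_ `^ _); ring.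
    by ring.
  by apply: ler_pM; rewrite ?mulr_ge0 ?ler_pM2l.
have -> : sum_const * logN * n `^ (2 - 2 * th / 13) =
  4 * u * n `^ (2 - 2 * th / 13) + 16 * u * n `^ (2 - 2 * th / 13) by rewrite scE; ring.
apply: lerD => //; apply: le_trans t1 _.
by rewrite ler_pM2r // -[leLHS]mulr1 ler_wpM2l.
Qed.

Lemma pair_sum_le : S <= bound.
Proof.
by have [al|al] := leP alpha (8 / 5); [exact: pair_sum_le_low|exact: pair_sum_le_high].
Qed.

End Frequencies.
End LargeN.
End Scales.

(** * The error term *)

Lemma combine_errors (R : realType) (u v w s V G A B C D : R) :
  0 <= u -> 0 <= v -> 0 <= w -> 0 <= s -> 0 <= V -> 0 <= G ->
  A <= 2 * V -> B <= s * V -> C <= s * V -> D <= 2 * V + 2 * G ->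
  u * (A + B) + v * C + w * (D + B) <=
  (u * (2 + s) + v * s + w * (4 + s)) * (V + G).
Proof.
move=> u0 v0 w0 s0 V0 G0 hA hB hC hD.
have sG : 0 <= s * G by exact: mulr_ge0.
have -> : (u * (2 + s) + v * s + w * (4 + s)) * (V + G) =
    u * (2 * V + s * V + (2 * G + s * G)) + v * (s * V + s * G) +
    w * ((2 * V + 2 * G + s * V) + (2 * V + 2 * G + s * G)) by ring.
by apply: lerD; [apply: lerD|]; apply: ler_wpM2l => //; lra.
Qed.

Section ErrorTerm.
Variable R : realType.
Variables (alpha : R) (k r : nat).
Hypotheses (halpha : 1 < alpha < 2) (hk : (3 <= k)%N) (hr : (1 <= r)%N).

Local Notation K := k.-1.
Local Notation rho := (r * k.-1)%N.
Local Notation th := (3 - alpha).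

Let K0 : (0 < K)%N. Proof. by case: k hk => [|[|]]. Qed.
Let rho0 : (0 < rho)%N. Proof. by rewrite muln_gt0 hr K0. Qed.
Let KR : 0 < K%:R :> R. Proof. by rewrite ltr0n. Qed.
Let a1 : 1 < alpha. Proof. by case/andP: halpha. Qed.
Let a2 : alpha < 2. Proof. by case/andP: halpha. Qed.

(** The three sources of error: exponential sums with a + b != 0, the margin
    by which powers fall below their chords, and exponential sums with
    a + b = 0. *)
Definition raw_error (n : R) : R :=
  n `^ (- (th / 14)) + n `^ (- ((2 - alpha) / 2)) + n `^ (- ((alpha - 1) / 2)).

(** The three exponents are compared range by range; (2 - alpha) / 2 and
    (3 - alpha) / 14 coincide at alpha = 11/6, and (alpha - 1) / 2 and
    (3 - alpha) / 14 at alpha = 5/4. *)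
Lemma raw_error_le (n : R) : expR 1 <= n -> raw_error n <= 3 * error_rate alpha n.
Proof.
move=> ne; have e1 : 1 <= expR 1 :> R by have := @expR_ge1Dx R 1; lra.
have n1 : 1 <= n by exact: le_trans ne.
have n0 : 0 < n by exact: lt_le_trans n1.
have l1 : 1 <= ln n by rewrite -[leLHS]expRK ler_ln ?posrE ?expR_gt0.
have ll : 1 <= ln n `^ (1 / 2) by apply: powR_ge1 => //; lra.
have mono (u v : R) : u <= v -> n `^ u <= n `^ v by move=> uv; rewrite ler_powR.
have weak (u v : R) : u <= v -> n `^ u <= n `^ v * ln n `^ (1 / 2).
  move=> uv; rewrite (le_trans (mono _ _ uv)) // -[leLHS]mulr1 ler_wpM2l //.
  exact: powR_ge0.
have sum3 (u v w z : R) : u <= z -> v <= z -> w <= z -> u + v + w <= 3 * z by lra.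
move: a1 a2 => b1 b2.
rewrite /error_rate /raw_error; case: ltP => al1.
  by apply: sum3; apply: mono; lra.
by case: ltP => al2; apply: sum3; apply: weak; lra.
Qed.

Lemma sum_const_ge0 : 0 <= sum_const alpha k.
Proof.
rewrite /sum_const /lo_const mulr_ge0 // addr_ge0 // mulr_ge0 // divr_ge0 ?mulr_ge0 //.
  by move: a1; lra.
by move: a2; lra.
Qed.

Definition main_const : R := 1152 * k%:R * (2 + sum_const alpha k)
  + 9 * K%:R * sum_const alpha k + 8 * K%:R * (4 + sum_const alpha k).

Lemma main_const_ge0 : 0 <= main_const.
Proof.
rewrite /main_const; have s0 := sum_const_ge0.
have h1 : 0 <= 1152 * k%:R :> R by exact: mulr_ge0 (ler0n _ _) (ler0n _ _).
have h2 : 0 <= 9 * K%:R :> R by exact: mulr_ge0 (ler0n _ _) (ler0n _ _).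
have h3 : 0 <= 8 * K%:R :> R by exact: mulr_ge0 (ler0n _ _) (ler0n _ _).
move: (1152 * _) (9 * _) (8 * _) h1 h2 h3 => u v w u0 v0 w0.
by apply: addr_ge0; [apply: addr_ge0|]; apply: mulr_ge0 => //; exact: addr_ge0.
Qed.

Section LargeN.
Variable N : nat.
Hypothesis hN : large alpha k r N.

Local Notation n := (N%:R : R).
Local Notation l := (logN R N).
Local Notation sc := (sum_const alpha k).

Let n3 : 3 <= n. Proof. by case: hN => h _ _; rewrite ler_nat. Qed.
Let n1 : 1 <= n. Proof. by move: n3; lra. Qed.
Let n0 : 0 < n. Proof. by move: n3; lra. Qed.

Definition sum_bound : R := sc * l * (n `^ (1 - th / 13) + n `^ (2 - alpha)).

(** Scale of the neighbourhoods of the endpoints: not finer than the cutoff, nor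
    than the distance between the graph and its chords. *)
Definition near_scale : nat :=
  minn (cutoff alpha N) (Num.trunc (n `^ ((2 - alpha) / 2))).

Lemma tail_count :
  `|\sum_(0 <= i < span R N) (floor_powers alpha r (start R N + i) \in arith_prog k)%:R
     - (span R N)%:R / K%:R : R| <=
  1152 * k%:R * ((span R N)%:R * (1 + ln (cutoff alpha N)%:R) / (cutoff alpha N)%:R
       + sum_bound)
  + K%:R * (9 * (1 + ln (cutoff alpha N)%:R) ^+ 2 * sum_bound)
  + 8 * K%:R * ((span R N)%:R / near_scale%:R + sum_bound).
Proof.
have th0 : 0 <= th / 13 by move: a2; lra.
have e0 : 0 <= (2 - alpha) / 2 by move: a2; lra.
have [H0 _ _] := trunc_powR n1 th0.
have [T0 Tu _] := trunc_powR n1 e0.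
have h0 : (0 < near_scale)%N by rewrite /near_scale leq_min T0 H0.
have B0 : 0 <= sum_bound.
  rewrite /sum_bound mulr_ge0 ?addr_ge0 ?powR_ge0 // mulr_ge0 ?sum_const_ge0 //.
  by rewrite (le_trans ler01) // (logN_ge1 hN).
apply: progression_count => //.
- by rewrite h0 geq_minl.
- move=> a b ab aH bH.
  have := pair_sum_le halpha hk hr hN ab (ltW aH) (ltW bH).
  suff -> : \sum_(0 <= i < span R N) cexp (phase alpha K rho a b 0 (start R N + i)%:R) =
     \sum_(0 <= i < span R N) cexp (a%:~R * ((start R N + i)%:R `^ alpha / K%:R) +
        b%:~R * ((start R N + i + rho)%:R `^ alpha / K%:R)) by [].
  apply: eq_bigr => i _; congr cexp.
  by rewrite /phase /ffalling big_ord0 subr0 -natrD; ring.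
have hR : 0 < near_scale%:R :> R by rewrite ltr0n.
have [_ _ [[_ _ hs] _]] := hN.
have [sl _ _] := start_bounds hN.
have g0 : alpha - 2 <= 0 by move: a2; lra.
have sp : (start R N)%:R `^ (alpha - 2) <= n `^ (6 / 7 * (alpha - 2)).
  by rewrite powRrM; apply: le0_powR_anti => //; exact: powR_gt0'.
have hle : near_scale%:R <= n `^ ((2 - alpha) / 2).
  by rewrite (le_trans _ Tu) // ler_nat geq_minr.
rewrite -[leRHS]mul1r ler_pdivlMr ?mulr_gt0 //.
apply: le_trans hs.
have -> : n `^ (- (5 / 14) * (2 - alpha)) =
    n `^ (6 / 7 * (alpha - 2)) * n `^ ((2 - alpha) / 2).
  by rewrite powRD1 //; congr (_ `^ _); field.
have -> : 2 * rho%:R ^+ 2 * (start R N)%:R `^ (alpha - 2) * (8 * near_scale%:R) =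
   16 * rho%:R ^+ 2 * ((start R N)%:R `^ (alpha - 2) * near_scale%:R) by ring.
rewrite ler_wpM2l ?mulr_ge0 ?exprn_ge0 //.
by apply: ler_pM => //; exact: powR_ge0.
Qed.

Lemma count_progsE : (count_progs alpha k r N)%:R =
  \sum_(1 <= m < start R N) (floor_powers alpha r m \in arith_prog k)%:R +
  \sum_(0 <= i < span R N) (floor_powers alpha r (start R N + i) \in arith_prog k)%:R :> R.
Proof.
have -> : (count_progs alpha k r N)%:R =
   \sum_(1 <= m < N.+1) (floor_powers alpha r m \in arith_prog k)%:R :> R.
  rewrite /count_progs -sum1_count natr_sum big_mkcond /=.
  by apply: eq_bigr => m _; case: ifP.
have sN : (start R N <= N.+1)%N by rewrite -(start_span hN) leq_addr.
rewrite (@big_cat_nat _ _ _ (start R N)) //=; congr (_ + _).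
rewrite -{1}(add0n (start R N)) big_addn.
by apply: eq_bigr => i _; rewrite addnC.
Qed.

Lemma density_le :
  `|n^-1 * (count_progs alpha k r N)%:R - (k%:R - 1)^-1| <=
   4 * n `^ (- (1 / 7)) + main_const *
    (l ^+ 3 * (n `^ (- (th / 13)) + n `^ (1 - alpha)) + n `^ (- ((2 - alpha) / 2))).
Proof.
have kK : k%:R - 1 = K%:R :> R by rewrite -{1}(prednK (_ : 0 < k)%N) -?natr1 ?addrK //; case: k hk.
have pp e : 0 < n `^ e by exact: powR_gt0'.
have l1 : 1 <= l by exact: (logN_ge1 hN).
have sc0 := sum_const_ge0.
have th0 : 0 <= th / 13 by move: a2; lra.
have e0 : 0 <= (2 - alpha) / 2 by move: a2; lra.
have [H0 Hu Hl] := trunc_powR n1 th0.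
have [T0 Tu Tl] := trunc_powR n1 e0.
rewrite -/(cutoff alpha N) in H0 Hu Hl.
have [_ su _] := start_bounds hN.
have K1 : 1 <= K%:R :> R by rewrite ler1n.
have sn : (span R N)%:R <= n by rewrite ler_nat span_le.
have sE : (start R N)%:R + (span R N)%:R = n + 1.
  by rewrite -natrD (start_span hN) natr1.
rewrite kK count_progsE.
set S1 := \sum_(1 <= m < _) _; set S2 := \sum_(0 <= i < _) _.
have tc := tail_count; rewrite -/S2 in tc.
have S1b : `|S1| <= (start R N)%:R.
  rewrite ger0_norm ?sumr_ge0 //.
  apply: (@le_trans _ _ (\sum_(1 <= m < start R N) 1)).
    by apply: ler_sum => m _; case: (_ \in _).
  by rewrite sumr_const_nat ler_nat leq_subr.
set E := 1152 * k%:R * _ + _ + _ in tc.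
have step : `|n^-1 * (S1 + S2) - K%:R^-1| <= n^-1 * (2 * (start R N)%:R) + n^-1 * E.
  have -> : n^-1 * (S1 + S2) - K%:R^-1 = n^-1 * (S1 + ((span R N)%:R - n) / K%:R
      + (S2 - (span R N)%:R / K%:R)) by field; rewrite !gt_eqF.
  rewrite -mulrDr normrM (ger0_norm (_ : 0 <= n^-1)) ?invr_ge0 ?(ltW n0) //.
  rewrite ler_pM2l ?invr_gt0 // (le_trans (ler_normD _ _)) // lerD //.
  rewrite (le_trans (ler_normD _ _)) //.
  suff : `|((span R N)%:R - n) / K%:R| <= (start R N)%:R by move: S1b; lra.
  rewrite normrM normfV (ger0_norm (ltW KR)) ler_pdivrMr //.
  rewrite distrC ger0_norm ?subr_ge0 //.
  apply: (@le_trans _ _ (start R N)%:R); first by move: sE; lra.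
  by rewrite -[leLHS]mulr1 ler_wpM2l.
apply: le_trans step _; apply: lerD.
  have -> : n `^ (- (1 / 7)) = n^-1 * n `^ (6 / 7).
    by rewrite -(powR_inv1 (ltW n0)) powRD1 //; congr (_ `^ _); field.
  by rewrite [leRHS]mulrCA ler_pM2l ?invr_gt0 //; lra.
set V := l ^+ 3 * _; set G2 := n `^ (- ((2 - alpha) / 2)).
have G20 : 0 <= G2 by exact: powR_ge0.
have HR : 0 < (cutoff alpha N)%:R :> R by rewrite ltr0n.
have lH : 1 + ln (cutoff alpha N)%:R <= l.
  rewrite lerD2l ler_ln ?posrE // (le_trans Hu) //.
  by rewrite -{2}(powRr1 (ltW n0)) ler_powR //; move: a1; lra.
have lH0 : 0 <= 1 + ln (cutoff alpha N)%:R :> R by rewrite addr_ge0 // ln_nat_ge0.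
set q := n `^ (- (th / 13)); set p := n `^ (1 - alpha).
have q0 : 0 < q by exact: pp.
have p0 : 0 < p by exact: pp.
have l0 : 0 <= l by lra.
have l13 : l <= l ^+ 3 by rewrite exprS -[leLHS]mulr1 ler_wpM2l // exprn_ege1.
have l3 : 1 <= l ^+ 3 by rewrite exprn_ege1.
have VE : V = l ^+ 3 * q + l ^+ 3 * p by rewrite /V mulrDr.
have V0 : 0 <= V by rewrite VE addr_ge0 // mulr_ge0 ?exprn_ge0 // ltW.
have V1 : l * q <= V.
  by rewrite VE (@le_trans _ _ (l ^+ 3 * q)) ?ler_wpM2r ?(ltW q0) // lerDl mulr_ge0 ?exprn_ge0 ?(ltW p0).
have V2 : q <= V.
  by apply: le_trans V1; rewrite -[leLHS]mul1r ler_wpM2r // ltW.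
have Hinv : (cutoff alpha N)%:R^-1 <= 2 * q.
  have -> : 2 * q = (n `^ (th / 13) / 2)^-1 by rewrite /q powRN invf_div.
  by rewrite lef_pV2 ?posrE ?divr_gt0.
have hinv : near_scale%:R^-1 <= 2 * q + 2 * G2.
  rewrite /near_scale /minn; case: ifP => _; first by rewrite (le_trans Hinv) // lerDl mulr_ge0.
  have -> : 2 * G2 = (n `^ ((2 - alpha) / 2) / 2)^-1 by rewrite /G2 powRN invf_div.
  rewrite -[leLHS]add0r lerD ?mulr_ge0 ?(ltW q0) // lef_pV2 ?posrE ?divr_gt0 // ltr0n //.
have nB : n^-1 * sum_bound = sc * (l * (q + p)).
  have -> : n^-1 * sum_bound =
      sc * (l * (n^-1 * n `^ (1 - th / 13) + n^-1 * n `^ (2 - alpha))).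
    by rewrite /sum_bound; ring.
  rewrite -(powR_inv1 (ltW n0)) !powRD1 //.
  by congr (_ * (_ * (_ `^ _ + _ `^ _))); ring.
have lqp : l * (q + p) <= V by rewrite /V ler_wpM2r // addr_ge0 // ltW.
have nBV : n^-1 * sum_bound <= sc * V by rewrite nB ler_wpM2l.
have B0 : 0 <= n^-1 * sum_bound.
  rewrite nB; apply: mulr_ge0 => //; apply: mulr_ge0 => //.
  by apply: addr_ge0; exact: ltW.
have T1 : n^-1 * ((span R N)%:R * (1 + ln (cutoff alpha N)%:R) / (cutoff alpha N)%:R) <= 2 * V.
  apply: (@le_trans _ _ (1 * (l * (2 * q)))).
    have -> : n^-1 * ((span R N)%:R * (1 + ln (cutoff alpha N)%:R) / (cutoff alpha N)%:R)
       = (n^-1 * (span R N)%:R) * ((1 + ln (cutoff alpha N)%:R) * (cutoff alpha N)%:R^-1).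
      by ring.
    apply: ler_pM.
    - by rewrite mulr_ge0 // invr_ge0.
    - by rewrite mulr_ge0 // invr_ge0.
    - by rewrite mulrC ler_pdivrMr // mul1r.
    - by apply: ler_pM; rewrite ?invr_ge0.
  by rewrite mul1r; move: V1; lra.
have T2 : n^-1 * ((span R N)%:R / near_scale%:R) <= 2 * V + 2 * G2.
  apply: (@le_trans _ _ (1 * (2 * q + 2 * G2))).
    rewrite mulrA; apply: ler_pM; rewrite ?mulr_ge0 ?invr_ge0 //.
    by rewrite mulrC ler_pdivrMr // mul1r.
  by rewrite mul1r; move: V2; lra.
have T3 : n^-1 * ((1 + ln (cutoff alpha N)%:R) ^+ 2 * sum_bound) <= sc * V.
  have -> : sc * V = l ^+ 2 * (sc * (l * (q + p))) by rewrite VE; ring.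
  rewrite nB in B0; rewrite mulrCA nB; apply: ler_pM => //; first exact: exprn_ge0.
  by rewrite lerXn2r ?nnegrE.
have EE : n^-1 * E = 1152 * k%:R * (n^-1 * ((span R N)%:R * (1 + ln (cutoff alpha N)%:R)
        / (cutoff alpha N)%:R) + n^-1 * sum_bound)
   + 9 * K%:R * (n^-1 * ((1 + ln (cutoff alpha N)%:R) ^+ 2 * sum_bound))
   + 8 * K%:R * (n^-1 * ((span R N)%:R / near_scale%:R) + n^-1 * sum_bound).
  by rewrite /E; ring.
have c1 : 0 <= 1152 * k%:R :> R by exact: mulr_ge0 (ler0n _ _) (ler0n _ _).
by rewrite EE; apply: combine_errors => //; exact: mulr_ge0 (ler0n _ _) (ler0n _ _).
Qed.

(** Powers of the logarithm are traded for a power N ^ (3 de) so small that it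
    fits between theta / 13 and theta / 14, and between alpha - 1 and its half. *)
Lemma density_raw_error (de := (alpha - 1) / 1000) :
  `|n^-1 * (count_progs alpha k r N)%:R - (k%:R - 1)^-1| <=
   (4 + main_const * ((1 + de^-1) ^+ 3 + 1)) * raw_error n.
Proof.
apply: le_trans density_le _.
have de0 : 0 < de by rewrite /de; move: a1; lra.
have pp e : 0 <= n `^ e by exact: powR_ge0.
have l1 : 1 <= l by exact: (logN_ge1 hN).
have sc0 := sum_const_ge0.
have mc0 := main_const_ge0.
set c := 1 + de^-1.
have c0 : 0 <= c by rewrite /c addr_ge0 // invr_ge0 ltW.
have ld : l ^+ 3 <= c ^+ 3 * n `^ (3 * de).
  have -> : c ^+ 3 * n `^ (3 * de) = (c * n `^ de) ^+ 3.
    by rewrite exprMn -[X in _ = _ * X]powR_mulrn // -powRrM [de * _]mulrC.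
  by rewrite lerXn2r ?nnegrE ?mulr_ge0 ?ln_le_powR //; lra.
have mono (u v : R) : u <= v -> n `^ u <= n `^ v by move=> uv; rewrite ler_powR.
have V : l ^+ 3 * (n `^ (- (th / 13)) + n `^ (1 - alpha)) <=
   c ^+ 3 * (n `^ (- (th / 14)) + n `^ (- ((alpha - 1) / 2))).
  apply: (@le_trans _ _ (c ^+ 3 * n `^ (3 * de) *
     (n `^ (- (th / 13)) + n `^ (1 - alpha)))).
    by rewrite ler_wpM2r // addr_ge0.
  rewrite -mulrA ler_wpM2l ?exprn_ge0 // mulrDr !powRD1 //.
  by apply: lerD; apply: mono; rewrite /de; move: a1 a2; lra.
have A : 4 * n `^ (- (1 / 7)) <= 4 * raw_error n.
  rewrite ler_pM2l // /raw_error -addrA.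
  apply: (@le_trans _ _ (n `^ (- (th / 14)))); first by apply: mono; move: a1; lra.
  by rewrite lerDl addr_ge0.
rewrite [leRHS]mulrDl; apply: lerD => //.
rewrite -[leRHS]mulrA ler_wpM2l // [leRHS]mulrDl mul1r.
have c30 : 0 <= c ^+ 3 by rewrite exprn_ge0.
apply: lerD.
  apply: le_trans V _; rewrite ler_wpM2l // /raw_error.
  by have := pp (- ((2 - alpha) / 2)); lra.
by rewrite /raw_error [leRHS]addrAC lerDr addr_ge0.
Qed.

End LargeN.
End ErrorTerm.

Unset Implicit Arguments.

Theorem theorem2p4 (R : realType) (alpha : R) (k r : nat)
    (halpha : 1 < alpha < 2) (hk : (3 <= k)%N) (hr : (1 <= r)%N) :
  exists2 C : R, 0 < C &
    \forall N \near \oo,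
      `| N%:R^-1 * (count_progs alpha k r N)%:R - (k%:R - 1)^-1 |
        <= C * error_rate alpha N%:R.
Proof.
pose c : R := 4 + main_const alpha k * ((1 + ((alpha - 1) / 1000)^-1) ^+ 3 + 1).
have /andP[a1 a2] := halpha.
have e0 : 0 <= ((alpha - 1) / 1000)^-1.
  by rewrite invr_ge0; apply: divr_ge0; rewrite ?ler0n // subr_ge0 ltW.
have c0 : 0 < c.
  have mc0 := main_const_ge0 k halpha.
  rewrite /c; move: (main_const alpha k) (_^-1) mc0 e0 => m e m0 e0.
  by rewrite ltr_wpDr ?mulr_ge0 // addr_ge0 // exprn_ge0 // addr_ge0.
exists (c * 3); first by rewrite mulr_gt0.
near=> N.
have hN : large alpha k r N by near: N; exact: large_near.
have ne : expR 1 <= N%:R :> R by near: N; exact: nbhs_infty_ger.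
apply: le_trans (density_raw_error halpha hk hr hN) _.
by rewrite -mulrA ler_pM2l // raw_error_le.
Unshelve. all: by end_near. Qed.
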